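(* Let $K$ be a field, $S=K[x_1,\dots,x_m,y_1,\dots,y_n]$ the standard bigraded polynomial ring and $Q=(y_1,\dots,y_n)$. Let $M$ be a finitely generated bigraded $S$-module which is relative Cohen--Macaulay with respect to $Q$ of relative dimension $q$. Then the function $f_M(j)=\operatorname{reg}H^q_Q(M)_j$ is bounded; i.e. there exists an integer $c$ such that $-c\leq\operatorname{reg}H^q_Q(M)_j\leq c$ for all $j\in\mathbb{Z}$ with $H^q_Q(M)_j\neq0$.
   Context: $S$ is bigraded by $\deg x_i=(1,0)$ and $\deg y_j=(0,1)$. A nonzero finitely generated bigraded $S$-module $M$ is relative Cohen--Macaulay with respect to $Q$ of relative dimension $q$ if $H^i_Q(M)=0$ for all $i\neq q$. $H^q_Q(M)_j=\bigoplus_{k\in\mathbb{Z}}H^q_Q(M)_{(k,j)}$ is a finitely generated graded module over $K[x]=K[x_1,\dots,x_m]$ with grading $(H^q_Q(M)_j)_k=H^q_Q(M)_{(k,j)}$. For a finitely generated graded $K[x]$-module $N$ with minimal graded free resolution $\mathbb{F}$, the Castelnuovo--Mumford regularity is $\operatorname{reg}(N)=\max\{b_i(\mathbb{F})-i: i\ge0\}$, where $b_i(\mathbb{F})$ is the maximal degree of the generators of $F_i$. *)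

(* Defs.v *)
From HB Require Import structures.
From mathcomp Require Import all_boot all_order all_algebra.
From mathcomp Require Import generic_quotient ring_quotient.
From mathcomp Require Import boolp.
From mathcomp Require Import mpoly.

Set Implicit Arguments.
Unset Strict Implicit.
Unset Printing Implicit Defensive.

Import Order.TTheory GRing.Theory Num.Theory.
Local Open Scope ring_scope.

(* R is G-graded with [hom a] cutting out R_a; [gm_comp g] cuts out M_g.  The
   last two fields say that M is the internal direct sum of the M_g. *)

Record gradedModule (G : zmodType) (R : nzRingType) (hom : G -> R -> Prop) :=
  GradedModule {
    gm_sort :> lmodType R;
    gm_comp : G -> gm_sort -> Prop;
    gm_comp0 : forall g, gm_comp g 0;
    gm_compB : forall g u v, gm_comp g u -> gm_comp g v -> gm_comp g (u - v);
    gm_compZ : forall a g p u,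
      hom a p -> gm_comp g u -> gm_comp (a + g) (p *: u);
    gm_dec : forall u, exists (s : seq G) (f : G -> gm_sort),
      [/\ uniq s, forall g, gm_comp g (f g) & u = \sum_(g <- s) f g];
    gm_dec_uniq : forall (s : seq G) (f : G -> gm_sort),
      uniq s -> (forall g, gm_comp g (f g)) -> \sum_(g <- s) f g = 0 ->
      forall g, g \in s -> f g = 0 }.

Record gradedHom G R hom (A B : @gradedModule G R hom) := GradedHom {
  gh_fun :> {linear A -> B};
  gh_comp : forall g u, gm_comp g u -> gm_comp g (gh_fun u) }.

Record gradedSubmodule G R hom (A : @gradedModule G R hom) := GradedSubmodule {
  gs_mem :> A -> Prop;
  gs_mem0 : gs_mem 0;
  gs_memP : forall p u v, gs_mem u -> gs_mem v -> gs_mem (p *: u + v);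
  gs_homog : forall (s : seq G) (f : G -> A),
    uniq s -> (forall g, gm_comp g (f g)) ->
    gs_mem (\sum_(g <- s) f g) -> forall g, g \in s -> gs_mem (f g) }.

Section GradedTheory.
Variables (G : zmodType) (R : nzRingType) (hom : G -> R -> Prop).
Implicit Types A B : gradedModule hom.

Definition is_zero A := forall u : A, u = 0.

Definition finitely_generated A :=
  exists (k : nat) (e : 'I_k -> A),
    forall u, exists c : 'I_k -> R, u = \sum_i c i *: e i.

(* Injectivity in the category of graded modules and degree 0 maps, not among
   all modules: this is what equips local cohomology with a grading. *)
Definition graded_injective (J : gradedModule hom) :=
  forall A B (i : gradedHom A B) (f : gradedHom A J),
    injective i -> exists h : gradedHom B J, forall u, h (i u) = f u.

Record injective_resolution (M : gradedModule hom) := InjectiveResolution {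
  ir_mod :> nat -> gradedModule hom;
  ir_diff : forall i, gradedHom (ir_mod i) (ir_mod i.+1);
  ir_aug : gradedHom M (ir_mod 0%N);
  ir_inj : forall i, graded_injective (ir_mod i);
  ir_aug_inj : injective ir_aug;
  ir_exact0 : forall u, ir_diff 0%N u = 0 <-> exists v, u = ir_aug v;
  ir_exact : forall i u, ir_diff i.+1 u = 0 <-> exists v, u = ir_diff i v }.

Lemma gm_compN A g (u : A) : gm_comp g u -> gm_comp g (- u).
Proof. by move=> gu; rewrite -sub0r; apply: gm_compB => //; apply: gm_comp0. Qed.

Lemma gm_compD A g (u v : A) : gm_comp g u -> gm_comp g v -> gm_comp g (u + v).
Proof. by move=> gu gv; rewrite -[v]opprK; apply/gm_compB/gm_compN. Qed.

Section Dec.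
Variables (V : zmodType) (comp : G -> V -> Prop).
Hypothesis comp0 : forall g, comp g 0.
Hypothesis compD : forall g u v, comp g u -> comp g v -> comp g (u + v).

Definition has_dec (u : V) := exists (s : seq G) (f : G -> V),
  [/\ uniq s, forall g, comp g (f g) & u = \sum_(g <- s) f g].

Lemma has_dec_full (u : V) : has_dec u -> exists (s : seq G) (f : G -> V),
  [/\ uniq s, forall g, comp g (f g), (forall g, g \notin s -> f g = 0)
    & u = \sum_(g <- s) f g].
Proof.
move=> [s [f [us fc ->]]]; exists s, (fun g => if g \in s then f g else 0).
split=> //; first by move=> g; case: ifP.
  by move=> g /negbTE ->.
by apply: eq_big_seq => g ->.
Qed.

Lemma sum_full (s s' : seq G) (f : G -> V) :
  uniq s -> uniq s' -> (forall g, g \notin s -> f g = 0) -> {subset s <= s'} ->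
  \sum_(g <- s') f g = \sum_(g <- s) f g.
Proof.
move=> us us' f0 ss'; rewrite (bigID (mem s)) /= [X in _ + X]big1 ?addr0; last first.
  by move=> g /f0.
rewrite -big_filter; apply: perm_big; apply: uniq_perm; rewrite ?filter_uniq //.
by move=> g; rewrite mem_filter /=; case: (boolP (g \in s)) => // /ss' ->.
Qed.

Lemma has_decD u v : has_dec u -> has_dec v -> has_dec (u + v).
Proof.
move=> /has_dec_full[s [f [us fc f0 ->]]] /has_dec_full[t [h [ut hc h0 ->]]].
exists (undup (s ++ t)), (fun g => f g + h g); split; rewrite ?undup_uniq //.
  by move=> g; apply: compD.
rewrite big_split /=; congr (_ + _); apply/esym/sum_full; rewrite ?undup_uniq //.
  by move=> g gs; rewrite mem_undup mem_cat gs.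
by move=> g gs; rewrite mem_undup mem_cat gs orbT.
Qed.

Lemma has_dec_comp g u : comp g u -> has_dec u.
Proof.
move=> gu; exists [:: g], (fun h => if h == g then u else 0); split=> //.
  by move=> h; case: eqP => [->|].
by rewrite big_seq1 eqxx.
Qed.

Lemma has_dec_sum (J : Type) (r : seq J) (F : J -> V) :
  (forall j, has_dec (F j)) -> has_dec (\sum_(j <- r) F j).
Proof.
move=> FD; elim/big_ind: _ => // [|u v]; last exact: has_decD.
by apply: has_dec_comp (0 : G) _ _; apply: comp0.
Qed.
End Dec.

Section Pred.
Variables (A : gradedModule hom) (S : gradedSubmodule A).

Definition gs_pred (u : A) : bool := `[< S u >].

Lemma gs_predP : submod_closed gs_pred.
Proof.
split=> [|p u v /asboolP Su /asboolP Sv]; apply/asboolP; first exact: gs_mem0.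
exact: gs_memP.
Qed.
HB.instance Definition _ := GRing.isSubmodClosed.Build R A gs_pred gs_predP.

End Pred.

Section Sub.
Variables (A : gradedModule hom) (S : gradedSubmodule A).

Definition sub_sort := {u : A | gs_pred S u}.
HB.instance Definition _ := SubChoice.on sub_sort.
HB.instance Definition _ := [SubChoice_isSubLmodule of sub_sort by <:].

Definition sub_comp g (u : sub_sort) := gm_comp g (val u).

Lemma sub_dec (u : sub_sort) : exists (s : seq G) (f : G -> sub_sort),
  [/\ uniq s, forall g, sub_comp g (f g) & u = \sum_(g <- s) f g].
Proof.
have [s [f [us fc f0 uE]]] := has_dec_full (@gm_comp0 _ _ _ A) (gm_dec (val u)).
have fS g : gs_pred S (f g).
  apply/asboolP; have [gs|gs] := boolP (g \in s); last by rewrite f0 //; apply: gs_mem0.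
  by apply: (gs_homog us fc) gs; rewrite -uE; apply/asboolP/(valP u).
exists s, (fun g => Sub (f g) (fS g)); split=> //.
by apply: val_inj; rewrite uE raddf_sum /=.
Qed.

Lemma sub_dec_uniq (s : seq G) (f : G -> sub_sort) :
  uniq s -> (forall g, sub_comp g (f g)) -> \sum_(g <- s) f g = 0 ->
  forall g, g \in s -> f g = 0.
Proof.
move=> us fc f0 g gs; apply: val_inj => /=.
apply: (@gm_dec_uniq _ _ _ A s (fun g => val (f g))) => //.
by rewrite -raddf_sum /= f0.
Qed.

Lemma sub_comp0 g : sub_comp g 0.
Proof. exact: gm_comp0. Qed.
Lemma sub_compB g u v : sub_comp g u -> sub_comp g v -> sub_comp g (u - v).
Proof. by move=> gu gv; rewrite /sub_comp raddfB /=; apply: gm_compB. Qed.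
Lemma sub_compZ a g p u : hom a p -> sub_comp g u -> sub_comp (a + g) (p *: u).
Proof. by move=> hp gu; rewrite /sub_comp linearZ /=; apply: gm_compZ. Qed.

Definition graded_sub : gradedModule hom :=
  GradedModule sub_comp0 sub_compB sub_compZ sub_dec sub_dec_uniq.
End Sub.

Section Quo.
Variables (A : gradedModule hom) (S : gradedSubmodule A).

Definition quo_sort := Quotient.quot (GRing.ZmodClosed.clone A (gs_pred S) _).
HB.instance Definition _ := GRing.Zmodule.on quo_sort.

Definition quo_pi : A -> quo_sort := \pi_(quo_sort)%qT.
Lemma quo_piB u v : quo_pi (u - v) = quo_pi u - quo_pi v.
Proof. by rewrite /quo_pi !piE. Qed.
Lemma quo_piD u v : quo_pi (u + v) = quo_pi u + quo_pi v.
Proof. by rewrite /quo_pi !piE. Qed.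
Lemma quo_eqP u v : quo_pi u = quo_pi v <-> S (u - v).
Proof.
split=> [e|/asboolP]; last first.
  by rewrite -[`[< _ >]]/(u - v \in gs_pred S) Quotient.idealrBE => /eqP.
apply/asboolP; rewrite -[`[< _ >]]/(u - v \in gs_pred S) Quotient.idealrBE.
exact/eqP.
Qed.

Definition quo_scale (p : R) (h : quo_sort) : quo_sort := quo_pi (p *: repr h).

Lemma quo_piZ p u : quo_pi (p *: u) = quo_scale p (quo_pi u).
Proof.
apply/quo_eqP; rewrite -scalerBr -[_ *: _]addr0; apply: gs_memP; last exact: gs_mem0.
apply/quo_eqP; by rewrite /quo_pi reprK.
Qed.

Lemma quo_piP (h : quo_sort) : exists u, h = quo_pi u.
Proof. by exists (repr h); rewrite /quo_pi reprK. Qed.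

Lemma quo_scaleA a b h : quo_scale a (quo_scale b h) = quo_scale (a * b) h.
Proof. by have [u ->] := quo_piP h; rewrite -!quo_piZ scalerA. Qed.
Lemma quo_scale1 : left_id 1 quo_scale.
Proof. by move=> h; have [u ->] := quo_piP h; rewrite -!quo_piZ scale1r. Qed.
Lemma quo_scaleDr : right_distributive quo_scale +%R.
Proof.
move=> p h h'; have [u ->] := quo_piP h; have [v ->] := quo_piP h'.
by rewrite -quo_piD -!quo_piZ scalerDr quo_piD.
Qed.
Lemma quo_scaleDl h : {morph quo_scale^~ h : a b / a + b}.
Proof.
by move=> a b; have [u ->] := quo_piP h; rewrite -!quo_piZ scalerDl quo_piD.
Qed.
HB.instance Definition _ := GRing.Zmodule_isLmodule.Build R quo_sort
  quo_scaleA quo_scale1 quo_scaleDr quo_scaleDl.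

Definition quo_comp g (h : quo_sort) := exists2 u : A, gm_comp g u & h = quo_pi u.

Lemma quo_pi0 : quo_pi 0 = 0.
Proof. by rewrite -(subrr 0) quo_piB subrr. Qed.

Lemma quo_pi_sum (J : Type) (r : seq J) (F : J -> A) :
  quo_pi (\sum_(j <- r) F j) = \sum_(j <- r) quo_pi (F j).
Proof. exact: (big_morph _ quo_piD quo_pi0). Qed.

Lemma quo_dec (h : quo_sort) : exists (s : seq G) (f : G -> quo_sort),
  [/\ uniq s, forall g, quo_comp g (f g) & h = \sum_(g <- s) f g].
Proof.
have [u ->] := quo_piP h; have [s [f [us fc ->]]] := gm_dec u.
exists s, (fun g => quo_pi (f g)); split=> //; last exact: quo_pi_sum.
by move=> g; exists (f g).
Qed.

Lemma quo_dec_uniq (s : seq G) (f : G -> quo_sort) :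
  uniq s -> (forall g, quo_comp g (f g)) -> \sum_(g <- s) f g = 0 ->
  forall g, g \in s -> f g = 0.
Proof.
move=> us fc f0 g gs.
have /choice[k kP] : forall g, exists u : A, gm_comp g u /\ f g = quo_pi u.
  by move=> g'; have [u ? ?] := fc g'; exists u.
have kc g' : gm_comp g' (k g') by case: (kP g').
have kS : S (\sum_(g <- s) k g).
  rewrite -[X in gs_mem S X]subr0; apply/quo_eqP; rewrite quo_pi_sum quo_pi0 -[RHS]f0.
  by apply: eq_bigr => g' _; case: (kP g').
have [_ ->] := kP g; rewrite -quo_pi0; apply/quo_eqP; rewrite subr0.
exact: (gs_homog us kc).
Qed.

Lemma quo_comp0 g : quo_comp g 0.
Proof. by exists 0; [apply: gm_comp0|rewrite quo_pi0]. Qed.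
Lemma quo_compB g h h' : quo_comp g h -> quo_comp g h' -> quo_comp g (h - h').
Proof.
move=> [u gu ->] [v gv ->]; exists (u - v); last by rewrite quo_piB.
exact: gm_compB.
Qed.
Lemma quo_compZ a g p h : hom a p -> quo_comp g h -> quo_comp (a + g) (p *: h).
Proof.
move=> hp [u gu ->]; exists (p *: u); last by rewrite quo_piZ.
exact: gm_compZ.
Qed.

Definition graded_quo : gradedModule hom :=
  GradedModule quo_comp0 quo_compB quo_compZ quo_dec quo_dec_uniq.
End Quo.

End GradedTheory.

Definition ideal_gen (R : nzRingType) (k : nat) (e : 'I_k -> R) (p : R) :=
  exists c : 'I_k -> R, p = \sum_i c i * e i.

(* S = K[x_1..x_m, y_1..y_n]: the first m variables are the x's. *)

Section Bigraded.
Variables (K : fieldType) (m n : nat).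
Local Notation S := {mpoly K[m + n]}.
Local Notation Kx := {mpoly K[m]}.

Definition xvar (i : 'I_m) : S := 'X_(lshift n i).
Definition yvar (j : 'I_n) : S := 'X_(rshift m j).

Definition bihom (d : int * int) (p : S) :=
  forall t, t \in msupp p ->
    ((\sum_(i < m) t (lshift n i))%N%:Z, (\sum_(j < n) t (rshift m j))%N%:Z) = d.

Definition xhom (d : int) (p : Kx) :=
  forall t, t \in msupp p -> (mdeg t)%:Z = d.

Definition bigradedModule := gradedModule bihom.
Definition xgradedModule := gradedModule xhom.

Definition Q : S -> Prop := ideal_gen yvar.

(* u is killed by Q^k, which is generated by the products of k elements of Q *)
Definition killedQ (M : lmodType S) (k : nat) (u : M) :=
  forall a : 'I_k -> S, (forall t, Q (a t)) -> (\prod_t a t) *: u = 0.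

(* Membership in Gamma_Q(M) *)
Definition torsionQ (M : lmodType S) (u : M) := exists k, killedQ k u.

Lemma bihom_y j : bihom (0, 1) (yvar j).
Proof.
move=> t; rewrite msuppX inE => /eqP ->; congr (_%:Z, _%:Z).
  by rewrite big1 // => i _; rewrite mnm1E eq_rlshift.
rewrite (bigD1 j) //= big1 ?mnm1E ?eqxx ?addn0 // => i ij.
by rewrite mnm1E eq_rshift eq_sym (negbTE ij).
Qed.

Lemma bihomM d e p r : bihom d p -> bihom e r -> bihom (d + e) (p * r).
Proof.
move=> hp hr t /msuppM_le /allpairsP[[t1 t2] /= [/hp <- /hr <- ->]].
apply/pair_equal_spec; split; rewrite /= -PoszD -big_split /=;
  by congr Posz; apply: eq_bigr => i _; rewrite mnmDE.
Qed.

Lemma bihom1 : bihom 0 1.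
Proof.
move=> t; rewrite msupp1 inE => /eqP ->.
by congr (_%:Z, _%:Z); rewrite big1 // => i _; rewrite mnm0E.
Qed.

Lemma killedQP (M : lmodType S) (k : nat) (u : M) :
  killedQ k u <-> forall a : 'I_k -> 'I_n, (\prod_t yvar (a t)) *: u = 0.
Proof.
split=> [ku a|].
  apply: ku => t; exists (fun j => (j == a t)%:R).
  rewrite (bigD1 (a t)) //= eqxx mul1r big1 ?addr0 // => j /negbTE ->.
  by rewrite mul0r.
elim: k u => [|k IHk] u ku a aQ.
  by have := ku (fun i : 'I_0 => False_rect _ (notF (ltn_ord i))); rewrite !big_ord0.
rewrite big_ord_recl mulrC -scalerA; have [c ->] := aQ ord0.
rewrite scaler_suml scaler_sumr big1 // => j _.
rewrite -scalerA scalerA mulrC -scalerA; rewrite IHk ?scaler0 // => b.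
rewrite scalerA mulrC.
have := ku (fun t => if unlift ord0 t is Some t' then b t' else j).
rewrite big_ord_recl unlift_none /=; congr (_ * _ *: _ = _).
by apply: eq_bigr => t _; rewrite liftK.
Qed.

Lemma killedQ_leq (M : lmodType S) (k l : nat) (u : M) :
  (k <= l)%N -> killedQ k u -> killedQ l u.
Proof.
move=> /subnK <-; elim: (l - k)%N => // r IH /IH {}IH.
move=> a aQ; rewrite addSn in a aQ *.
by rewrite big_ord_recl -scalerA IH ?scaler0.
Qed.

Lemma torsionQP (M : lmodType S) (p : S) (u v : M) :
  torsionQ u -> torsionQ v -> torsionQ (p *: u + v).
Proof.
move=> [a au] [b bv]; exists (maxn a b) => s sQ.
rewrite scalerDr scalerA mulrC -scalerA.
by rewrite (killedQ_leq (leq_maxl _ _) au) // (killedQ_leq (leq_maxr _ _) bv) //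
   scaler0 addr0.
Qed.

Lemma torsionQ0 (M : lmodType S) : torsionQ (0 : M).
Proof. by exists 0%N => a _; rewrite scaler0. Qed.

Lemma bihom_prod_y k (a : 'I_k -> 'I_n) : bihom (0, k%:Z) (\prod_t yvar (a t)).
Proof.
elim: k a => [|k IH] a; first by rewrite big_ord0; apply: bihom1.
rewrite big_ord_recl.
have -> : (0, k.+1%:Z) = ((0, 1) + (0, k%:Z) : int * int) by [].
by apply: bihomM; [apply: bihom_y|apply: IH].
Qed.

Lemma torsionQ_homog (M : bigradedModule) s (f : int * int -> M) :
  uniq s -> (forall g, gm_comp g (f g)) -> torsionQ (\sum_(g <- s) f g) ->
  forall g, g \in s -> torsionQ (f g).
Proof.
move=> us fc [k /killedQP ku] g gs; exists k; apply/killedQP => a.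
set p := \prod_t _; have hp : bihom (0, k%:Z) p := @bihom_prod_y k a.
have := @gm_dec_uniq _ _ _ M [seq (0, k%:Z) + g | g <- s]
  (fun g => p *: f (g - (0, k%:Z))).
move=> /(_ _ _ _ ((0, k%:Z) + g)); rewrite addrAC subrr add0r; apply.
- by rewrite map_inj_uniq //; apply: addrI.
- move=> h; rewrite -[X in gm_comp X](subrK (0, k%:Z)) addrC.
  by apply: gm_compZ.
- rewrite big_map.
  under eq_bigr do rewrite addrAC subrr add0r.
  by rewrite -scaler_sumr; apply: ku.
- by apply: map_f.
Qed.

(* Local cohomology as the right derived functors of Gamma_Q:
   H^i_Q(M) = H^i(Gamma_Q(I)) for an injective resolution I of M in the category
   of bigraded modules. *)

Section LocalCohomology.
Variables (M : bigradedModule) (I : injective_resolution M).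

Section Cocycles.
Variable i : nat.

Definition is_cocycle (u : I i) := torsionQ u /\ ir_diff I i u = 0.

Lemma is_cocycle0 : is_cocycle 0.
Proof. by split; [apply: torsionQ0|rewrite linear0]. Qed.

Lemma is_cocycleP p u v : is_cocycle u -> is_cocycle v -> is_cocycle (p *: u + v).
Proof.
move=> [tu du] [tv dv]; split; first exact: torsionQP.
by rewrite linearP du dv scaler0 addr0.
Qed.

Lemma is_cocycle_homog s (f : int * int -> I i) :
  uniq s -> (forall g, gm_comp g (f g)) -> is_cocycle (\sum_(g <- s) f g) ->
  forall g, g \in s -> is_cocycle (f g).
Proof.
move=> us fc [tf df] g gs; split; first exact: torsionQ_homog gs.
apply: (@gm_dec_uniq _ _ _ (I i.+1) s (fun g => ir_diff I i (f g))) => //.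
  by move=> h; apply: gh_comp.
by rewrite -raddf_sum.
Qed.

Definition cocycles : bigradedModule :=
  graded_sub (GradedSubmodule is_cocycle0 is_cocycleP is_cocycle_homog).

End Cocycles.

Definition is_coboundary i : I i -> Prop :=
  match i return I i -> Prop with
  | 0 => fun u => u = 0
  | k.+1 => fun u => exists2 v : I k, torsionQ v & u = ir_diff I k v
  end.

Section Cohomology.
Variable i : nat.

Definition coboundary (u : cocycles i) := is_coboundary (val u : I i).

Lemma coboundary0 : coboundary 0.
Proof.
rewrite /coboundary raddf0; case: i => [|k] //=.
by exists 0; [apply: torsionQ0|rewrite linear0].
Qed.

Lemma is_coboundaryP j p (u v : I j) :
  is_coboundary u -> is_coboundary v -> is_coboundary (p *: u + v).
Proof.
case: j u v => [|k] u v /=; first by move=> -> ->; rewrite scaler0 addr0.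
move=> [a ta ->] [b tb ->]; exists (p *: a + b); first exact: torsionQP.
by rewrite linearP.
Qed.

Lemma coboundaryP p u v : coboundary u -> coboundary v -> coboundary (p *: u + v).
Proof. by rewrite /coboundary linearP; apply: is_coboundaryP. Qed.

Lemma is_coboundary_homog j s (f : int * int -> I j) :
  uniq s -> (forall g, gm_comp g (f g)) -> is_coboundary (\sum_(g <- s) f g) ->
  forall g, g \in s -> is_coboundary (f g).
Proof.
case: j f => [|k] f us fc /=; first exact: gm_dec_uniq.
move=> [w tw fw] g gs.
have [t [h [ut hc h0 wE]]] := has_dec_full (@gm_comp0 _ _ _ (I k)) (gm_dec w).
pose f' g := if g \in s then f g else 0.
have hw : f' g = ir_diff I k (h g).
  apply/eqP; rewrite -subr_eq0; apply/eqP.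
  apply: (@gm_dec_uniq _ _ _ (I k.+1) (undup (s ++ t))
    (fun g => f' g - ir_diff I k (h g))); rewrite ?undup_uniq //.
  - move=> g'; apply: gm_compB; last exact: gh_comp.
    by rewrite /f'; case: ifP => _ //; apply: gm_comp0.
  - rewrite big_split /= sumrN -raddf_sum /=.
    have -> : \sum_(g <- undup (s ++ t)) f' g = \sum_(g <- s) f' g.
      apply: sum_full; rewrite ?undup_uniq // => g' g's; first by rewrite /f' (negbTE g's).
      by rewrite mem_undup mem_cat g's.
    have -> : \sum_(g <- undup (s ++ t)) h g = \sum_(g <- t) h g.
      apply: sum_full; rewrite ?undup_uniq // => g' g't.
      by rewrite mem_undup mem_cat g't orbT.
    rewrite -wE -fw; apply/eqP; rewrite subr_eq0; apply/eqP.
    by apply: eq_big_seq => g' g's; rewrite /f' g's.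
  - by rewrite mem_undup mem_cat gs.
rewrite /f' gs in hw; exists (h g) => //.
have [gt|gt] := boolP (g \in t); last by rewrite h0 //; apply: torsionQ0.
by apply: (torsionQ_homog ut hc) gt; rewrite -wE.
Qed.

Lemma coboundary_homog s (f : int * int -> cocycles i) :
  uniq s -> (forall g, gm_comp g (f g)) -> coboundary (\sum_(g <- s) f g) ->
  forall g, g \in s -> coboundary (f g).
Proof.
move=> us fc; rewrite /coboundary raddf_sum /=.
exact: (@is_coboundary_homog i s (fun g => val (f g))).
Qed.

Definition local_cohomology : bigradedModule :=
  graded_quo (GradedSubmodule coboundary0 coboundaryP coboundary_homog).

End Cohomology.
End LocalCohomology.


Definition relative_CM (M : bigradedModule) (I : injective_resolution M) (q : nat) :=
  [/\ ~ is_zero M, finitely_generated M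
    & forall i, i <> q -> is_zero (local_cohomology I i)].

(* N_j = (+)_k N_(k,j) as a graded K[x]-module *)
Section Row.

Lemma bihomD d p r : bihom d p -> bihom d r -> bihom d (p + r).
Proof.
by move=> hp hr t /msuppD_le; rewrite mem_cat => /orP[/hp|/hr].
Qed.

Lemma bihomZ d c p : bihom d p -> bihom d (c *: p).
Proof. by move=> hp t /msuppZ_le /hp. Qed.

Lemma bihom_x i : bihom (1, 0) (xvar i).
Proof.
move=> t; rewrite msuppX inE => /eqP ->; congr (_%:Z, _%:Z); last first.
  by rewrite big1 // => j _; rewrite mnm1E eq_lrshift.
rewrite (bigD1 i) //= big1 ?mnm1E ?eqxx ?addn0 // => j ij.
by rewrite mnm1E eq_lshift eq_sym (negbTE ij).
Qed.

Lemma bihom_prod (J : Type) (r : seq J) (d : J -> int * int) (F : J -> S) :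
  (forall j, bihom (d j) (F j)) -> bihom (\sum_(j <- r) d j) (\prod_(j <- r) F j).
Proof.
move=> dF; elim: r => [|j r IH]; first by rewrite !big_nil; apply: bihom1.
by rewrite !big_cons; apply: bihomM.
Qed.

Lemma bihomX d p k : bihom d p -> bihom (d *+ k) (p ^+ k).
Proof.
move=> dp; elim: k => [|k IH]; first exact: bihom1.
by rewrite mulrS exprS; apply: bihomM.
Qed.

Definition xincl (p : Kx) : S := p \mPo [tuple xvar i | i < m].

Lemma bihom_xincl d p : xhom d p -> bihom (d, 0) (xincl p).
Proof.
move=> hp; rewrite /xincl comp_mpolyEX big_seq.
elim/big_ind: _ => [||t /hp <-]; [by move=> t; rewrite msupp0|exact: bihomD|].
apply: bihomZ; rewrite comp_mpolyX.
have -> : ((mdeg t)%:Z, 0) = \sum_(i < m) ((1, 0) : int * int) *+ t i.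
  rewrite mdegE (big_morph Posz PoszD (erefl _)).
  elim/big_ind2: _ => [|a x b y <- <-|i _] //.
  by elim: (t i) => // k IH; rewrite mulrS -IH intS.
by apply: bihom_prod => i; apply: bihomX; rewrite tnth_mktuple; apply: bihom_x.
Qed.

Variables (N : bigradedModule) (j : int).

Definition in_row (u : N) := exists2 l : seq N,
  forall w, w \in l -> exists k, gm_comp (k, j) w & u = \sum_(w <- l) w.

Lemma in_row0 : in_row 0.
Proof. by exists [::] => //; rewrite big_nil. Qed.

Lemma in_rowD u v : in_row u -> in_row v -> in_row (u + v).
Proof.
move=> [l lP ->] [l' l'P ->]; exists (l ++ l'); last by rewrite big_cat.
by move=> w; rewrite mem_cat => /orP[/lP|/l'P].
Qed.

Lemma in_row_comp k u : gm_comp (k, j) u -> in_row u.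
Proof.
by move=> ku; exists [:: u]; rewrite ?big_seq1 // => w; rewrite inE => /eqP ->; exists k.
Qed.

Lemma in_rowZ p u : in_row u -> in_row (xincl p *: u).
Proof.
move=> [l lP ->]; rewrite scaler_sumr big_seq.
elim/big_ind: _ => [||w /lP[k kw]]; [exact: in_row0|exact: in_rowD|].
rewrite [p in xincl p]mpolyE /xincl raddf_sum /= scaler_suml.
elim/big_ind: _ => [||t _]; [exact: in_row0|exact: in_rowD|].
apply: (@in_row_comp ((mdeg t)%:Z + k)).
have -> : ((mdeg t)%:Z + k, j) = (((mdeg t)%:Z, 0) + (k, j) : int * int).
  by apply/pair_equal_spec; rewrite /= add0r.
apply: gm_compZ kw; apply: bihom_xincl => t' /msuppZ_le.
by rewrite msuppX inE => /eqP ->.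
Qed.

Definition row_pred (u : N) : bool := `[< in_row u >].

Lemma row_predP : zmod_closed row_pred.
Proof.
split=> [|u v /asboolP ru /asboolP rv]; apply/asboolP; first exact: in_row0.
apply: in_rowD ru _; rewrite -scaleN1r.
have -> : -1 = xincl (-1) :> S by rewrite /xincl raddfN /= comp_mpoly1.
exact: in_rowZ.
Qed.
HB.instance Definition _ := GRing.isZmodClosed.Build N row_pred row_predP.

Definition row_sort := {u : N | row_pred u}.
HB.instance Definition _ := SubChoice.on row_sort.
HB.instance Definition _ := [SubChoice_isSubZmodule of row_sort by <:].

Lemma row_scale_subproof (p : Kx) (u : row_sort) : row_pred (xincl p *: val u).
Proof. by apply/asboolP/in_rowZ/asboolP/(valP u). Qed.

Definition row_scale (p : Kx) (u : row_sort) : row_sort :=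
  Sub (xincl p *: val u) (row_scale_subproof p u).

Lemma row_scaleA a b u : row_scale a (row_scale b u) = row_scale (a * b) u.
Proof. by apply: val_inj; rewrite /= scalerA -rmorphM. Qed.
Lemma row_scale1 : left_id 1 row_scale.
Proof. by move=> u; apply: val_inj; rewrite /= /xincl comp_mpoly1 scale1r. Qed.
Lemma row_scaleDr : right_distributive row_scale +%R.
Proof. by move=> p u v; apply: val_inj; rewrite /= scalerDr. Qed.
Lemma row_scaleDl u : {morph row_scale^~ u : a b / a + b}.
Proof. by move=> a b; apply: val_inj; rewrite /= -scalerDl -raddfD. Qed.
HB.instance Definition _ := GRing.Zmodule_isLmodule.Build Kx row_sort
  row_scaleA row_scale1 row_scaleDr row_scaleDl.

Definition row_comp (k : int) (u : row_sort) := gm_comp (k, j) (val u).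

Lemma row_comp0 k : row_comp k 0.
Proof. exact: gm_comp0. Qed.
Lemma row_compB k u v : row_comp k u -> row_comp k v -> row_comp k (u - v).
Proof. by move=> ku kv; rewrite /row_comp raddfB; apply: gm_compB. Qed.
Lemma row_compD k u v : row_comp k u -> row_comp k v -> row_comp k (u + v).
Proof. by move=> ku kv; rewrite /row_comp raddfD; apply: gm_compD. Qed.
Lemma row_compZ a k p u : xhom a p -> row_comp k u -> row_comp (a + k) (p *: u).
Proof.
move=> hp ku; rewrite /row_comp /=.
have -> : (a + k, j) = ((a, 0) + (k, j) : int * int).
  by apply/pair_equal_spec; rewrite /= add0r.
by apply: gm_compZ => //; apply: bihom_xincl.
Qed.

Lemma row_dec (u : row_sort) : has_dec row_comp u.
Proof.
have /asboolP[l lP uE] := valP u; elim: l u lP uE => [|w l IH] u lP uE.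
  apply: (has_dec_comp row_comp0 (g := 0)).
  suff -> : u = 0 by apply: row_comp0.
  by apply: val_inj; rewrite uE big_nil.
have [k kw] := lP w (mem_head w l).
have wP : row_pred w by apply/asboolP/in_row_comp/kw.
rewrite -[u](subrK (Sub w wP)); apply: (has_decD row_comp0 row_compD).
  apply: IH => [v vl|]; first by apply: lP; rewrite inE vl orbT.
  by rewrite raddfB /= uE big_cons addrAC subrr add0r.
exact: (has_dec_comp row_comp0 (g := k)).
Qed.

Lemma row_dec_uniq (s : seq int) (f : int -> row_sort) :
  uniq s -> (forall k, row_comp k (f k)) -> \sum_(k <- s) f k = 0 ->
  forall k, k \in s -> f k = 0.
Proof.
move=> us fc f0 k ks; apply: val_inj => /=.
have := @gm_dec_uniq _ _ _ N [seq (k, j) | k <- s]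
  (fun g => if g.2 == j then val (f g.1) else 0) _ _ _ (k, j).
rewrite /= eqxx; apply.
- by rewrite map_inj_uniq // => ? ? [].
- by move=> [a b] /=; case: eqP => [->|_]; [apply: fc|apply: gm_comp0].
- rewrite big_map /=; under eq_bigr do rewrite eqxx.
  rewrite -[RHS]/(val (0 : row_sort)) -f0 raddf_sum; exact: eq_bigr.
- exact: map_f.
Qed.

Definition row_module : xgradedModule :=
  GradedModule row_comp0 row_compB row_compZ row_dec row_dec_uniq.
End Row.

(* (+)_t K[x](-d_t), for d the sequence of degrees of the generators *)
Section Free.
Variable d : seq int.
Local Notation F := 'rV[Kx]_(size d).

Definition free_comp (e : int) (v : F) :=
  forall t : 'I_(size d), xhom (e - d`_t) (v 0 t).

Lemma free_comp0 e : free_comp e 0.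
Proof. by move=> t w; rewrite mxE msupp0. Qed.
Lemma free_compB e u v : free_comp e u -> free_comp e v -> free_comp e (u - v).
Proof.
move=> eu ev t w; rewrite !mxE => /msuppB_le; rewrite mem_cat.
by move=> /orP[/eu|/ev].
Qed.
Lemma free_compD e u v : free_comp e u -> free_comp e v -> free_comp e (u + v).
Proof.
move=> eu ev t w; rewrite !mxE => /msuppD_le; rewrite mem_cat.
by move=> /orP[/eu|/ev].
Qed.
Lemma free_compZ a e p u : xhom a p -> free_comp e u -> free_comp (a + e) (p *: u).
Proof.
move=> hp eu t w; rewrite !mxE => /msuppM_le /allpairsP[[w1 w2] /= [/hp <- /eu w2e ->]].
by rewrite mdegD PoszD w2e addrA.
Qed.

Lemma free_dec (u : F) : has_dec free_comp u.
Proof.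
rewrite [u]row_sum_delta; apply: (has_dec_sum free_comp0 free_compD) => t.
rewrite [u 0 t]mpolyE scaler_suml; apply: (has_dec_sum free_comp0 free_compD) => w.
apply: (has_dec_comp free_comp0 (g := (mdeg w)%:Z + d`_t)) => t' w'.
rewrite !mxE eqxx /=; case: eqP => [->|_]; last by rewrite mulr0 msupp0.
rewrite mulr1 addrK => /msuppZ_le; rewrite msuppX inE => /eqP -> //.
Qed.

Lemma free_dec_uniq (s : seq int) (f : int -> F) :
  uniq s -> (forall e, free_comp e (f e)) -> \sum_(e <- s) f e = 0 ->
  forall e, e \in s -> f e = 0.
Proof.
move=> us fc f0 e es; apply/rowP => t; rewrite mxE; apply/mpolyP => w.
rewrite mcoeff0; have [wf|/memN_msupp_eq0 //] := boolP (w \in msupp (f e 0 t)).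
have := congr1 (fun v : F => (v 0 t)@_w) f0; rewrite summxE mxE mcoeff0 raddf_sum /=.
rewrite (bigD1_seq e) //= big1 ?addr0 // => e' e'e.
apply/eqP; rewrite mcoeff_eq0; apply: contra e'e => /fc.
by rewrite (fc _ _ _ wf) => /addIr ->.
Qed.

Definition graded_free : xgradedModule :=
  GradedModule free_comp0 free_compB free_compZ free_dec free_dec_uniq.
End Free.

(* F_i is the free module with generators in the degrees listed by mr_gens i;
   minimality is d(F_i.+1) \subset (x_1..x_m) F_i. *)
Record minimal_free_resolution (N : xgradedModule) := MinimalFreeResolution {
  mr_gens : nat -> seq int;
  mr_diff : forall i,
    gradedHom (graded_free (mr_gens i.+1)) (graded_free (mr_gens i));
  mr_aug : gradedHom (graded_free (mr_gens 0%N)) N;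
  mr_surj : forall u, exists v, u = mr_aug v;
  mr_exact0 : forall u, mr_aug u = 0 <-> exists v, u = mr_diff 0%N v;
  mr_exact : forall i u, mr_diff i u = 0 <-> exists v, u = mr_diff i.+1 v;
  mr_minimal : forall i v t,
    ideal_gen (fun k : 'I_m => 'X_k)
      ((mr_diff i v : 'rV[Kx]_(size (mr_gens i))) 0 t) }.

Definition is_max (P : int -> Prop) (r : int) := P r /\ forall a, P a -> a <= r.

(* b is the maximal degree of the generators of F_i; there is no such b when
   F_i = 0, so that zero modules do not contribute to the regularity *)
Definition is_b N (F : minimal_free_resolution N) (i : nat) (b : int) :=
  is_max (fun a => a \in mr_gens F i) b.

Definition is_reg N (r : int) := exists F : minimal_free_resolution N,
  is_max (fun a => exists i b, is_b F i b /\ a = b - i%:Z) r.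

End Bigraded.

(* Main.v *)
From HB Require Import structures.
Require Import Defs.
From mathcomp Require Import all_boot all_order all_algebra.
From mathcomp Require Import boolp.
From mathcomp Require Import mpoly zify.

(* Write A_e(J) for the elements of J killed by the powers v ^ e_v of some of the
   variables v. Graded injectivity makes v ^ s : A_(e_v + s)(I^p) -> A_e(I^p)
   surjective, so the cohomology of A_e(I^.), which is Ext(S / (v ^ e_v), M), obeys the
   long exact sequences of Koszul cohomology and is a Noetherian S-module. When all
   x_i act as 0 it therefore lives in boundedly many x-degrees; adding the powers
   y_j ^ t keeps this bound, and in the union over t so does the cohomology of the
   part of Gamma_Q(I^.) killed by the x_i. Since Gamma_Q(I^p) is Koszul-acyclic for
   x_1, ..., x_m and H^p_Q(M) = 0 for p <> q, that cohomology is the Koszul cohomology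
   of H^q_Q(M), so the latter vanishes in x-degrees k > b with b independent of j.
   A graded K[x]-module whose Koszul cohomology vanishes above b has generators of
   degree at most b + m, and the same holds for all its syzygies; together with a
   lower bound on the degrees this bounds the regularity. Raising the exponents of
   the y_j one at a time shows that each bigraded component of H^q_Q(M) is already
   reached at a finite t, hence is finite dimensional: the rows are finitely
   generated and their minimal resolutions exist. *)

Set Implicit Arguments.
Unset Strict Implicit.
Unset Printing Implicit Defensive.

Import Order.TTheory GRing.Theory Num.Theory.
Local Open Scope ring_scope.

(** * Noetherian modules *)

(** The point is uniformity over the rows: constants chosen row by row would prove nothing. It comes
    from finiteness over S instead of K[x]: the y-variables move between rows without changing the
    x-degree, so a finitely generated bigraded S-module killed by the x_i meets only finitely many
    x-degrees, in all rows at once. Koszul cohomology is the right invariant because H^(m-i)(x; N)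
    in degree k is Tor_i(K, N) in degree k + m; this is the origin of the constant b + m, and the
    reason why one bound on all Koszul cohomology bounds every F_i. Elements of Gamma_Q(I^p) have in
    general no common annihilating power of Q, so finiteness is only available at the stages with
    fixed powers of the y-variables, and the bounds found there must not depend on the stage. The
    vanishing of H^p_Q(M) for p <> q lets dimension shifting replace a spectral sequence:
    coboundaries are treated from 0 up to q, cocycles from q on. Cohomology is handled by predicates
    for cocycles and coboundaries, so that neither Ext modules nor connecting maps have to be
    constructed. *)

Lemma nondecreasing_subsequence (f : nat -> nat) : exists phi : nat -> nat,
  (forall i j, i < j -> phi i < phi j)%N /\
  (forall i j, i <= j -> f (phi i) <= f (phi j))%N.
Proof.
(* [g k] is a position at or after [k] where [f] attains its minimum over all positions from [k] on;
   iterating [g] gives the subsequence. *)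
have /choice[g gP] : forall k, exists j, (k <= j)%N /\ forall i, (k <= i -> f j <= f i)%N.
  move=> k; have vP : exists v, `[< exists2 j, (k <= j)%N & f j = v >].
    by exists (f k); apply/asboolP; exists k.
  case: (ex_minnP vP) => v /asboolP[j kj fE] vmin; exists j; split=> // i ki.
  by rewrite fE; apply: vmin; apply/asboolP; exists i.
pose phi := fix phi i := if i is i'.+1 then g (phi i').+1 else g 0.
have phiS i : (phi i < phi i.+1)%N by case: (gP (phi i).+1).
have phi_lt : forall i j, (i < j -> phi i < phi j)%N.
  by move=> i j; apply: (@homo_ltn _ phi (fun x y => x < y)%N) => //; apply: ltn_trans.
exists phi; split=> // i j; rewrite leq_eqVlt => /predU1P[->//|ij].
case: i ij => [|i] ij /=; first by case: (gP 0) => _; apply.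
by case: (gP (phi i).+1) => _; apply; apply: phi_lt; apply: ltn_trans ij.
Qed.

(** Without a finite basis one could choose greedily an infinite sequence in which no term divides a
    later one. Passing to nondecreasing subsequences, one coordinate after the other, excludes
    this. *)
Lemma dickson n (D : 'X_{1..n} -> Prop) : exists2 s : seq 'X_{1..n},
  forall t, t \in s -> D t & forall t, D t -> exists2 f, f \in s & (f <= t)%MM.
Proof.
have wqo (f : nat -> 'X_{1..n}) : exists i j, (i < j)%N /\ (f i <= f j)%MM.
  suff [phi [phi_lt phi_le]] : exists phi : nat -> nat,
      (forall i j, i < j -> phi i < phi j)%N /\
      forall c : 'I_n, c \in enum 'I_n ->
      (forall i j, i <= j -> f (phi i) c <= f (phi j) c)%N.
    exists (phi 0), (phi 1); split; first exact: phi_lt.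
    by apply/mnm_lepP => c; apply: phi_le; rewrite ?mem_enum.
  elim: (enum 'I_n) => [|c cs [phi [phi_lt phi_le]]]; first by exists id.
  have [psi [psi_lt psi_le]] := nondecreasing_subsequence (fun i => f (phi i) c).
  exists (phi \o psi); split=> [i j ij|c']; first exact/phi_lt/psi_lt.
  rewrite inE => /predU1P[->|c'cs] i j ij; first exact: psi_le.
  apply: phi_le => //; move: ij; rewrite leq_eqVlt => /predU1P[->//|ij].
  exact/ltnW/psi_lt.
apply: contrapT => noD.
have /choice[g gP] : forall s : seq 'X_{1..n}, exists t,
    (forall t, t \in s -> D t) -> D t /\ forall f, f \in s -> ~ (f <= t)%MM.
  move=> s; have [sD|] := pselect (forall t, t \in s -> D t); last by exists 0%MM.
  apply: contrapT => /forallNP nt; apply: noD; exists s => // t Dt.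
  apply: contrapT => ns; apply: (nt t) => _; split=> // f fs ft.
  by apply: ns; exists f.
pose L := fix L i := if i is i'.+1 then g (L i') :: L i' else [::].
have LD i : forall t, t \in L i -> D t.
  elim: i => //= i IH t; rewrite inE => /predU1P[->|/IH//].
  by case: (gP _ IH).
have Lin i j : (i < j)%N -> g (L i) \in L j.
  elim: j => // j IH; rewrite ltnS leq_eqVlt => /predU1P[->|/IH]; rewrite /= inE ?eqxx //.
  by move=> ->; rewrite orbT.
have [i [j [ij]]] := wqo (fun i => g (L i)).
by case: (gP _ (LD j)) => _; apply; apply: Lin.
Qed.

Section Noetherian.
Variable R : nzRingType.

Definition submodule (V : lmodType R) (W : V -> Prop) :=
  W 0 /\ forall a u v, W u -> W v -> W (a *: u + v).

(** Finite generation of the image of [W] in V / B, without forming the quotient. *)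
Definition fg_modulo (V : lmodType R) (W B : V -> Prop) :=
  exists (k : nat) (e : 'I_k -> V), (forall i, W (e i)) /\
    forall u, W u -> exists c : 'I_k -> R, B (u - \sum_i c i *: e i).

(* The subquotient Z / B is Noetherian. *)
Definition noetherian (V : lmodType R) (Z B : V -> Prop) :=
  forall W : V -> Prop, submodule W -> (forall u, W u -> Z u) -> fg_modulo W B.

Section Submodule.
Variables (V : lmodType R) (W : V -> Prop) (Wsub : submodule W).

Lemma submod0 : W 0. Proof. by case: Wsub. Qed.
Lemma submodD u v : W u -> W v -> W (u + v).
Proof. by case: Wsub => _ WP Wu Wv; rewrite -[u]scale1r; apply: WP. Qed.
Lemma submodZ a u : W u -> W (a *: u).
Proof. by case: Wsub => W0 WP Wu; rewrite -[_ *: _]addr0; apply: WP. Qed.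
Lemma submodN u : W u -> W (- u).
Proof. by rewrite -scaleN1r; apply: submodZ. Qed.
Lemma submodB u v : W u -> W v -> W (u - v).
Proof. by move=> Wu Wv; apply/submodD/submodN. Qed.
Lemma submod_sum (J : Type) (r : seq J) (P : pred J) (F : J -> V) :
  (forall j, P j -> W (F j)) -> W (\sum_(j <- r | P j) F j).
Proof. by move=> WF; elim/big_ind: _ => //; [apply: submod0|apply: submodD]. Qed.
End Submodule.

Definition linear_relation (V V' : lmodType R) (r : V -> V' -> Prop) :=
  r 0 0 /\ forall a u v u' v', r u u' -> r v v' -> r (a *: u + v) (a *: u' + v').

Lemma linear_relation_sum (V V' : lmodType R) (r : V -> V' -> Prop) k
    (c : 'I_k -> R) (u : 'I_k -> V) (u' : 'I_k -> V') :
  linear_relation r -> (forall i, r (u i) (u' i)) ->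
  r (\sum_i c i *: u i) (\sum_i c i *: u' i).
Proof.
move=> [r0 rP] ru; elim/big_ind2: _ => // [x x' y y' rx ry|i _].
  by rewrite -[x]scale1r -[x']scale1r; apply: rP.
by rewrite -[_ *: u i]addr0 -[_ *: u' i]addr0; apply: rP.
Qed.

(* A linear relation plays the part of a homomorphism from Z to Z' / B', whose
   kernel is the submodule of the second Noetherian hypothesis. *)
Lemma noetherian_extension (V V' : lmodType R) (Z B : V -> Prop)
    (Z' B' : V' -> Prop) (r : V -> V' -> Prop) :
  linear_relation r -> submodule Z' -> submodule B' ->
  noetherian Z' B' ->
  (forall u, Z u -> exists2 z, Z' z & r u z) ->
  noetherian (fun u => Z u /\ exists2 z, B' z & r u z) B ->
  noetherian Z B.
Proof.
move=> rlin Z'sub B'sub nZ' rZ nK W Wsub WZ; have [r0 rP] := rlin.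
have [|z [z' [z'P z'gen]]] := nZ' (fun z => Z' z /\ exists2 u, W u & r u z) _ (fun z => @proj1 _ _).
  split=> [|a u' v' [Zu' [u Wu ru]] [Zv' [v Wv rv]]].
    by split; [apply: submod0|exists 0; [apply: submod0|]].
  split; first by apply: submodD => //; apply: submodZ.
  by exists (a *: u + v); [apply: submodD => //; apply: submodZ|apply: rP].
have /choice[w wP] : forall i, exists u, W u /\ r u (z' i).
  by move=> i; have [_ [u Wu ru]] := z'P i; exists u.
have [||k [e [eP egen]]] := nK (fun u => W u /\ exists2 z, B' z & r u z).
- split=> [|a u v [Wu [u' Bu' ru]] [Wv [v' Bv' rv]]].
    by split; [apply: submod0|exists 0; [apply: submod0|]].
  split; first by apply: submodD => //; apply: submodZ.
  by exists (a *: u' + v'); [apply: submodD => //; apply: submodZ|apply: rP].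
- by move=> u [/WZ Zu zP].
exists (z + k)%N, (fun i => match split i with inl i => w i | inr i => e i end).
split=> [i|u Wu]; first by case: split => [j|j]; [case: (wP j)|case: (eP j)].
have [u' Zu' ru] := rZ _ (WZ _ Wu).
have [|c cP] := z'gen u'; first by split=> //; exists u.
have [|d dP] := egen (u - \sum_i c i *: w i).
  split; first by apply: submodB => //; apply: submod_sum => // i _; apply: (submodZ Wsub); case: (wP i).
  exists (u' - \sum_i c i *: z' i) => //; rewrite addrC [u' - _]addrC -!scaleN1r.
  by apply: rP => //; apply: linear_relation_sum => // i; case: (wP i).
exists (fun i => match split i with inl i => c i | inr i => d i end).
rewrite big_split_ord /= opprD addrA; congr (B (_ - _ - _)): dP.
  by apply: eq_bigr => i _; rewrite (unsplitK (inl i : 'I_z + 'I_k)).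
by apply: eq_bigr => i _; rewrite (unsplitK (inr i : 'I_z + 'I_k)).
Qed.

Lemma noetherian_zero (V : lmodType R) (Z B : V -> Prop) :
  (forall u, Z u -> B u) -> noetherian Z B.
Proof.
move=> ZB W _ WZ; exists 0, (fun=> 0); split=> [[]//|u /WZ/ZB Bu].
by exists (fun=> 0); rewrite big_ord0 subr0.
Qed.

Lemma noetherian_sub (V : lmodType R) (Z Z' B B' : V -> Prop) :
  (forall u, Z' u -> Z u) -> (forall u, B u -> B' u) -> noetherian Z B -> noetherian Z' B'.
Proof.
move=> ZZ BB nZ W Wsub WZ; have [k [e [eW egen]]] := nZ W Wsub (fun u Wu => ZZ u (WZ u Wu)).
by exists k, e; split=> // u /egen[c /BB]; exists c.
Qed.

End Noetherian.

Lemma mcoeffZXM (R : comNzRingType) (n : nat) (c : R) s t (p : {mpoly R[n]}) :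
  ((c *: 'X_[s]) * p)@_(s + t)%MM = c * p@_t.
Proof. by rewrite -scalerAl mcoeffZ mulrC [_ * p]mulrC mcoeffMX mulrC. Qed.

(** Groebner basis argument: [dickson] selects finitely many elements of [W] whose leading monomials
    divide all others, and division by them terminates because the monomial order is well
    founded. *)
Lemma hilbert_basis (K : fieldType) (n : nat) :
  noetherian (fun _ : {mpoly K[n]}^o => True) (fun u => u = 0).
Proof.
move=> W Wsub _.
have [s sD sgen] := dickson (fun t => exists2 p : {mpoly K[n]}^o, W p & p != 0 /\ mlead p = t).
have /choice[e eP] : forall i : 'I_(size s), exists p : {mpoly K[n]}^o,
    [/\ W p, p != 0 & mlead p = nth 0%MM s i].
  by move=> i; have [p Wp [p0 pE]] := sD _ (mem_nth 0%MM (ltn_ord i)); exists p.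
exists (size s), e; split=> [i|u]; first by case: (eP i).
suff H : forall t (u : {mpoly K[n]}^o), (mlead u <= t)%O -> W u ->
    exists c : 'I_(size s) -> {mpoly K[n]}, u - \sum_i c i *: e i = 0.
  exact: H (lexx _).
elim/(well_founded_induction (@ltom_wf n)) => t IH {}u ut Wu.
have [->|u0] := eqVneq u 0.
  by exists (fun=> 0); rewrite big1 ?subr0 // => i _; rewrite scale0r.
have [f fs fu] : exists2 f, f \in s & (f <= mlead u)%MM by apply: sgen; exists u.
have fi := fs; rewrite -index_mem in fi; pose i := Ordinal fi.
have [Wi i0 iE] := eP i; rewrite /= nth_index // in iE.
pose a : {mpoly K[n]} := (u@_(mlead u) / (e i)@_f) *: 'X_[mlead u - f].
have Wv : W (u - a *: e i) by apply: submodB => //; apply: submodZ.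
have eif0 : (e i)@_f != 0 by rewrite -iE mleadc_eq0.
have aE t' : (a *: e i)@_(mlead u - f + t')%MM = u@_(mlead u) / (e i)@_f * (e i)@_t'.
  exact: mcoeffZXM.
have alead : (mlead (a *: e i) <= mlead u)%O.
  apply: le_trans (mleadM_le _ _) _; rewrite iE.
  apply: (@le_trans _ _ (mlead u - f + f)%MM); last by rewrite submK.
  by rewrite lemc_add2l; apply: le_trans (mleadZ_le _ _) _; rewrite mleadXm.
have vlt : u - a *: e i != 0 -> (mlead (u - a *: e i) < mlead u)%O.
  move=> v0; rewrite lt_neqAle; apply/andP; split.
    apply: contra_neq v0 => vE; apply/eqP; rewrite -mleadc_eq0 vE mcoeffB.
    by rewrite -{2}(submK fu) aE divfK // subrr.
  by apply: le_trans (mleadB_le _ _) _; rewrite leUx lexx alead.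
have [c cE] : exists c : 'I_(size s) -> {mpoly K[n]}, u - a *: e i - \sum_i c i *: e i = 0.
  have [->|v0] := eqVneq (u - a *: e i) 0.
    by exists (fun=> 0); rewrite big1 ?subr0 // => j _; rewrite scale0r.
  exact: (IH _ (lt_le_trans (vlt v0) ut) _ (lexx _) Wv).
exists (fun j => (if j == i then a else 0) + c j).
rewrite (eq_bigr (fun j => (if j == i then a else 0) *: e j + c j *: e j)); last first.
  by move=> j _; rewrite scalerDl.
rewrite big_split /= (bigD1 i) //= eqxx [X in _ *: _ + X]big1 ?addr0; last first.
  by move=> j /negbTE ->; rewrite scale0r.
by rewrite opprD addrA.
Qed.

(** Induction on the number of generators: [r] relates [u] to its possible coefficients at the first
    generator, and what is related to 0 is spanned by the remaining ones. *)
Lemma noetherian_fg (K : fieldType) (n : nat) (V : lmodType {mpoly K[n]}) k (e : 'I_k -> V) :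
  noetherian (fun u => exists c : 'I_k -> {mpoly K[n]}, u = \sum_i c i *: e i)
             (fun u => u = 0).
Proof.
elim: k e => [|k IH] e.
  by apply: noetherian_zero => u [c ->]; rewrite big_ord0.
pose r (u : V) (a : {mpoly K[n]}^o) := exists c : 'I_k -> {mpoly K[n]},
  u = (a : {mpoly K[n]}) *: e ord0 + \sum_i c i *: e (lift ord0 i).
apply: (noetherian_extension (r := r)) (@hilbert_basis K n) _ _ => //.
- split=> [|a u v u' v' [c ->] [d ->]].
    by exists (fun=> 0); rewrite scale0r add0r big1 // => i _; rewrite scale0r.
  exists (fun i => a * c i + d i); rewrite scalerDr scalerDl addrACA scalerA.
  congr (_ + _); rewrite scaler_sumr -big_split; apply: eq_bigr => i _.
  by rewrite scalerDl scalerA.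
- by split=> // a u v -> ->; rewrite scaler0 addr0.
- move=> u [c ->]; exists (c ord0) => //; exists (fun i => c (lift ord0 i)).
  by rewrite big_ord_recl.
apply: noetherian_sub (IH (fun i => e (lift ord0 i))) => //.
by move=> u [_ [z -> [c ->]]]; exists c; rewrite scale0r add0r.
Qed.

(** * Homogeneous components *)

Section Components.
Variables (G : zmodType) (R : nzRingType) (hom : G -> R -> Prop).
Implicit Types A B : gradedModule hom.

(** A total family that vanishes outside a finite set is unique as a function, which a pair of a
    support and a family is not; this makes [gproj] well behaved. *)
Definition is_dec A (u : A) (f : G -> A) := (forall g, gm_comp g (f g)) /\
  exists s : seq G, [/\ uniq s, forall g, g \notin s -> f g = 0 & u = \sum_(g <- s) f g].

Lemma dec_exists A (u : A) : exists f, is_dec u f.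
Proof.
have [s [f [us fc f0 uE]]] := has_dec_full (@gm_comp0 _ _ _ A) (gm_dec u).
by exists f; split=> //; exists s.
Qed.

Definition gproj A (g : G) (u : A) : A := projT1 (cid (dec_exists u)) g.
Arguments gproj {A} g u.

Lemma dec_widen A (u : A) f (s : seq G) : is_dec u f ->
  exists t, [/\ uniq t, {subset s <= t}, forall g, g \notin t -> f g = 0
    & u = \sum_(g <- t) f g].
Proof.
move=> [_ [t [ut f0 ->]]]; exists (undup (t ++ s)); split; rewrite ?undup_uniq //.
- by move=> g gs; rewrite mem_undup mem_cat gs orbT.
- by move=> g; rewrite mem_undup mem_cat negb_or => /andP[/f0].
by apply/esym/sum_full; rewrite ?undup_uniq // => g gt; rewrite mem_undup mem_cat gt.
Qed.

Lemma dec_unique A (u : A) f h : is_dec u f -> is_dec u h -> f =1 h.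
Proof.
move=> uf uh g; have [s [us f0 uE]] := proj2 uf.
have [t [ut st h0 uE']] := dec_widen (g :: s) uh.
apply/eqP; rewrite -subr_eq0; apply/eqP.
apply: (@gm_dec_uniq _ _ _ A t (fun g => f g - h g)) => //.
- by move=> k; apply: gm_compB; [case: uf|case: uh].
- rewrite big_split /= sumrN -uE' (sum_full us ut) // -?uE ?subrr // => k ks.
  by apply: st; rewrite inE ks orbT.
- by apply: st; rewrite inE eqxx.
Qed.

Lemma gproj_dec A (u : A) : is_dec u (gproj^~ u).
Proof. exact: projT2 (cid (dec_exists u)). Qed.

Lemma gproj_comp A g (u : A) : gm_comp g (gproj g u).
Proof. by case: (gproj_dec u). Qed.

Lemma gprojE A (u : A) f g : is_dec u f -> gproj g u = f g.
Proof. by move=> uf; apply: dec_unique (gproj_dec u) uf g. Qed.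

Lemma gproj_sum A (u : A) : exists s : seq G,
  [/\ uniq s, forall g, g \notin s -> gproj g u = 0 & u = \sum_(g <- s) gproj g u].
Proof. by case: (gproj_dec u). Qed.

Lemma dec_homogeneous A (u : A) g :
  gm_comp g u -> is_dec u (fun h => if h == g then u else 0).
Proof.
move=> gu; split=> [h|]; first by case: eqP => [->|_] //; apply: gm_comp0.
exists [:: g]; split=> // [h|]; first by rewrite inE => /negbTE ->.
by rewrite big_seq1 eqxx.
Qed.

Lemma gproj_id A (u : A) g : gm_comp g u -> gproj g u = u.
Proof. by move/dec_homogeneous/gprojE => /(_ g); rewrite eqxx. Qed.

Lemma gproj_neq A (u : A) g h : gm_comp g u -> h != g -> gproj h u = 0.
Proof. by move/dec_homogeneous/gprojE => /(_ h) -> /negbTE ->. Qed.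

Lemma gproj0 A g : gproj g (0 : A) = 0.
Proof. exact/gproj_id/gm_comp0. Qed.

Lemma gproj_hom A B (f : gradedHom A B) g u : gproj g (f u) = f (gproj g u).
Proof.
apply: (@gprojE _ _ (fun h => f (gproj h u))); split=> [h|].
  by apply/gh_comp/gproj_comp.
have [s [us u0 uE]] := gproj_sum u; exists s; split=> //.
  by move=> h /u0 ->; rewrite linear0.
by rewrite {1}uE linear_sum.
Qed.

Lemma gprojZ A a g p (u : A) : hom a p -> gproj (a + g) (p *: u) = p *: gproj g u.
Proof.
move=> ap; have [s [us u0 uE]] := gproj_sum u.
rewrite (@gprojE _ (p *: u) (fun h => p *: gproj (h - a) u)); first by rewrite addrAC subrr add0r.
split=> [h|].
  by rewrite -{1}[h](subrK a) addrC; apply/gm_compZ/gproj_comp.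
exists [seq a + h | h <- s]; split.
- by rewrite map_inj_uniq //; apply: addrI.
- move=> h hs; rewrite u0 ?scaler0 //; apply: contra hs => hs.
  by apply/mapP; exists (h - a) => //; rewrite addrC subrK.
rewrite big_map {1}uE scaler_sumr; apply: eq_bigr => h _.
by rewrite addrAC subrr add0r.
Qed.

Lemma gprojD A g (u v : A) : gproj g (u + v) = gproj g u + gproj g v.
Proof.
apply: (@gprojE _ _ (fun g => gproj g u + gproj g v)); split=> [h|].
  by apply: gm_compD; apply: gproj_comp.
have [s [us u0 uE]] := gproj_sum u.
have [t [ut st v0 vE]] := dec_widen s (gproj_dec v).
exists t; split=> // [h ht|].
  have hs : h \notin s by apply: contra ht => /st.
  by rewrite u0 // v0 // addr0.
by rewrite big_split /= -vE; congr (_ + _); rewrite {1}uE; apply/esym/sum_full.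
Qed.

Lemma gproj_bigsum A g (J : Type) (r : seq J) (F : J -> A) :
  gproj g (\sum_(j <- r) F j) = \sum_(j <- r) gproj g (F j).
Proof. exact: (big_morph _ (gprojD g) (gproj0 A g)). Qed.

Lemma gprojN A g (u : A) : gproj g (- u) = - gproj g u.
Proof. by apply/eqP; rewrite -addr_eq0 -gprojD addNr gproj0. Qed.

Lemma gprojB A g (u v : A) : gproj g (u - v) = gproj g u - gproj g v.
Proof. by rewrite gprojD gprojN. Qed.

End Components.

(** * Extending partial homomorphisms on monomial ideals *)

Section Monomials.
Variables (K : fieldType) (m n : nat).
Local Notation S := {mpoly K[m + n]}.
Local Notation mon := 'X_{1..m + n}.

Definition bideg (t : mon) : int * int :=
  ((\sum_(i < m) t (lshift n i))%N%:Z, (\sum_(j < n) t (rshift m j))%N%:Z).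

Lemma bidegD s t : bideg (s + t)%MM = bideg s + bideg t.
Proof.
by congr pair; rewrite /= -PoszD -big_split /=; congr Posz;
  apply: eq_bigr => i _; rewrite mnmDE.
Qed.

Lemma bihomXm t : bihom (bideg t) ('X_[t] : S).
Proof. by move=> s; rewrite msuppX inE => /eqP ->. Qed.

Lemma bihomC (c : K) : bihom 0 (c%:MP : S).
Proof. by rewrite -[_%:MP]mulr1 mul_mpolyC => t /msuppZ_le; apply: bihom1. Qed.

Section Shift.
Variable g0 : int * int.

(** The grading of S(-g0), in which 1 has degree [g0]. *)
Definition shift_comp (g : int * int) (p : S^o) := bihom (g - g0) (p : S).

Lemma shift_comp0 g : shift_comp g 0.
Proof. by move=> t; rewrite msupp0. Qed.
Lemma shift_compD g p r : shift_comp g p -> shift_comp g r -> shift_comp g (p + r).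
Proof. exact: bihomD. Qed.
Lemma shift_compB g p r : shift_comp g p -> shift_comp g r -> shift_comp g (p - r).
Proof. by move=> gp gr t /msuppB_le; rewrite mem_cat => /orP[/gp|/gr]. Qed.
Lemma shift_compZ a g p r :
  bihom a p -> shift_comp g r -> shift_comp (a + g) (p *: r).
Proof. by move=> ap gr; rewrite /shift_comp -addrA; apply: bihomM. Qed.

Lemma shift_dec (p : S^o) : has_dec shift_comp p.
Proof.
rewrite [p]mpolyE; apply: (has_dec_sum shift_comp0 shift_compD) => t.
apply: (has_dec_comp shift_comp0 (g := bideg t + g0)).
by rewrite /shift_comp addrK; apply/bihomZ/bihomXm.
Qed.

Lemma mcoeff_shift_sum (s : seq (int * int)) (f : int * int -> S^o) g t :
  uniq s -> (forall g, shift_comp g (f g)) -> g \in s -> t \in msupp (f g : S) ->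
  (\sum_(h <- s) f h : S)@_t = (f g : S)@_t.
Proof.
move=> us fc gs tf; rewrite raddf_sum /= (bigD1_seq g) //= big1 ?addr0 // => h hg.
apply/eqP; rewrite mcoeff_eq0; apply: contra hg => /fc.
by rewrite (fc _ _ tf) => /addIr ->.
Qed.

Lemma shift_dec_uniq (s : seq (int * int)) (f : int * int -> S^o) :
  uniq s -> (forall g, shift_comp g (f g)) -> \sum_(g <- s) f g = 0 ->
  forall g, g \in s -> f g = 0.
Proof.
move=> us fc f0 g gs; apply/mpolyP => t; rewrite mcoeff0.
have [tf|/memN_msupp_eq0 //] := boolP (t \in msupp (f g : S)).
by rewrite -(mcoeff_shift_sum us fc gs tf) f0 mcoeff0.
Qed.

Definition shifted_ring : bigradedModule K m n :=
  GradedModule shift_comp0 shift_compB shift_compZ shift_dec shift_dec_uniq.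

Variables (U : mon -> Prop) (Uup : forall s t, U t -> U (s + t)%MM).

Definition monomial_ideal (p : shifted_ring) := forall t, t \in msupp (p : S) -> U t.

Lemma monomial_ideal0 : monomial_ideal 0.
Proof. by move=> t; rewrite msupp0. Qed.

Lemma monomial_idealP a p r : monomial_ideal p -> monomial_ideal r ->
  monomial_ideal (a *: p + r).
Proof.
move=> Up Ur t /msuppD_le; rewrite mem_cat => /orP[|/Ur//].
by move/msuppM_le => /allpairsP[[t1 t2] /= [_ /Up t2U ->]]; apply: Uup.
Qed.

Lemma monomial_ideal_homog (s : seq (int * int)) (f : int * int -> shifted_ring) :
  uniq s -> (forall g, gm_comp g (f g)) -> monomial_ideal (\sum_(g <- s) f g) ->
  forall g, g \in s -> monomial_ideal (f g).
Proof.
move=> us fc Uf g gs t tf; apply: Uf.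
by rewrite mcoeff_msupp (mcoeff_shift_sum us fc gs tf) -mcoeff_msupp.
Qed.

Definition graded_monomial_ideal : bigradedModule K m n :=
  graded_sub (GradedSubmodule monomial_ideal0 monomial_idealP monomial_ideal_homog).

(** The consequence of graded injectivity in the style of Baer's criterion: [phi] extends to a
    homomorphism from the monomial ideal to [J], hence to S(-g0), and [w] is the image of 1. *)
Lemma monomial_extension (J : bigradedModule K m n) (phi : mon -> J) :
  graded_injective J ->
  (forall t, U t -> gm_comp (bideg t + g0) (phi t)) ->
  (forall s t, U t -> phi (s + t)%MM = 'X_[s] *: phi t) ->
  exists2 w, gm_comp g0 w & forall t, U t -> 'X_[t] *: w = phi t.
Proof.
move=> Jinj phic phiM.
(* The K-linear extension of [phi] to all of S. It is S-linear only on polynomials supported in [U],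
   since nothing is assumed of [phi] elsewhere. *)
pose L (p : S) := \sum_(t <- msupp p) (p@_t)%:MP *: phi t.
have LE p s : uniq s -> {subset msupp p <= s} -> L p = \sum_(t <- s) (p@_t)%:MP *: phi t.
  move=> us ps; rewrite /L [RHS](bigID (mem (msupp p))) /= [X in _ + X]big1 ?addr0.
    rewrite -[RHS]big_filter; apply: perm_big; apply: uniq_perm; rewrite ?filter_uniq //.
    by move=> t; rewrite mem_filter /=; case: (boolP (t \in msupp p)) => // /ps ->.
  by move=> t /memN_msupp_eq0 ->; rewrite mpolyC0 scale0r.
have LD p r : L (p + r) = L p + L r.
  pose s := undup (msupp p ++ msupp r).
  have ps : {subset msupp p <= s} by move=> t tp; rewrite mem_undup mem_cat tp.
  have rs : {subset msupp r <= s} by move=> t tp; rewrite mem_undup mem_cat tp orbT.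
  have prs : {subset msupp (p + r) <= s} by move=> t /msuppD_le; rewrite mem_undup.
  rewrite (LE p s) ?(LE r s) ?(LE (p + r) s) ?undup_uniq // -big_split.
  by apply: eq_bigr => t _; rewrite mcoeffD mpolyCD scalerDl.
have L0 : L 0 = 0 by rewrite /L msupp0 big_nil.
have LX c t : L (c *: 'X_[t]) = c%:MP *: phi t.
  rewrite (LE _ [:: t]) //; last by move=> s /msuppZ_le; rewrite msuppX.
  by rewrite big_seq1 mcoeffZ mcoeffX eqxx mulr1.
have Lsum (T : Type) (r : seq T) (F : T -> S) : L (\sum_(j <- r) F j) = \sum_(j <- r) L (F j).
  exact: (big_morph _ LD L0).
have LM a (p : S) : monomial_ideal p -> L (a * p) = a *: L p.
  move=> Up; rewrite [a]mpolyE mulr_suml Lsum scaler_suml; apply: eq_bigr => s _.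
  rewrite {1}[p]mpolyE mulr_sumr Lsum scaler_sumr; rewrite !big_seq; apply: eq_bigr => t tp.
  have -> : (a@_s *: 'X_[s]) * (p@_t *: 'X_[t]) = (a@_s * p@_t) *: 'X_[s + t] :> S.
    by rewrite -scalerAl -scalerAr scalerA -mpolyXD.
  rewrite LX phiM; last exact: Up.
  rewrite !scalerA; congr (_ *: _).
  by rewrite -[a@_s *: _]mul_mpolyC mpolyCM mulrAC.
pose f (u : graded_monomial_ideal) : J := L (val u).
have flin : linear f.
  move=> a u v; rewrite /f /= [L _]LD; congr (_ + _); apply: LM.
  exact/asboolP/(valP u).
pose fL := GRing.isLinear.Build _ _ _ _ f flin.
pose F : {linear graded_monomial_ideal -> J} := HB.pack f fL.
have Fc g u : gm_comp g u -> gm_comp g (F u).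
  move=> gu; rewrite /F /= /f /L big_seq; elim/big_ind: _ => [||t tu].
  - exact: gm_comp0.
  - exact: gm_compD.
  have Ut : U t by have /asboolP := valP u; apply.
  rewrite -[g]add0r; apply: gm_compZ; first exact: bihomC.
  have := phic t Ut; have /(_ t tu) := gu; rewrite -/(bideg t) => ->.
  by rewrite subrK.
have vlin : linear (val : graded_monomial_ideal -> shifted_ring) by move=> a u v; rewrite linearP.
pose vL := GRing.isLinear.Build _ _ _ _ (val : graded_monomial_ideal -> shifted_ring) vlin.
pose V : {linear graded_monomial_ideal -> shifted_ring} :=
  HB.pack (val : graded_monomial_ideal -> shifted_ring) vL.
have Vc g u : gm_comp g u -> gm_comp g (V u) by [].
have [h hP] := Jinj _ _ (GradedHom Vc) (GradedHom Fc) val_inj.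
exists (h 1); first by apply: gh_comp; rewrite /= /shift_comp subrr; apply: bihom1.
move=> t Ut.
have Xt : gs_pred (GradedSubmodule monomial_ideal0 monomial_idealP monomial_ideal_homog)
    ('X_[t] : shifted_ring).
  by apply/asboolP => s; rewrite msuppX inE => /eqP ->.
have hX : h ('X_[t] : shifted_ring) = phi t.
  by have /= -> := hP (Sub _ Xt); rewrite /f /= -['X_[t]]scale1r LX mpolyC1 scale1r.
by rewrite -hX -linearZ; congr (h _); apply: mulr1.
Qed.

End Shift.
End Monomials.

(** * Ext groups of powers of the variables *)

Section Exponents.
Variables (K : fieldType) (m n : nat).
Local Notation S := {mpoly K[m + n]}.
Local Notation mon := 'X_{1..m + n}.
Local Notation var := 'I_(m + n).

(* An exponent e stands for the ideal generated by the powers v ^ s with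
   e v = Some s. *)
Definition expo := var -> option nat.

Definition vpow (v : var) (s : nat) : S := 'X_[U_(v) *+ s].

Definition kill (J : lmodType S) (e : expo) (u : J) :=
  forall v s, e v = Some s -> vpow v s *: u = 0.

Definition expo_set (e : expo) v s : expo := fun w => if w == v then Some s else e w.

Definition expo_unset (e : expo) v : expo := fun w => if w == v then None else e w.

Definition expo_none : expo := fun=> None.

Lemma expo_setK e v s : e v = Some s -> expo_set (expo_unset e v) v s = e.
Proof.
by move=> ev; apply/funext => w; rewrite /expo_set /expo_unset; case: eqP => // ->.
Qed.

(** Induction on the number of variables where [e] and [e0] differ. [A] records which variables may
    receive a power, so that a property depending on degrees has to survive only those. *)
Lemma expo_ind (P : expo -> Prop) (A : pred var) (e0 : expo) :
  P e0 ->
  (forall e v s, A v -> e v = None -> P e -> P (expo_set e v s)) ->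
  forall e, (forall v, e0 v = None \/ e v = e0 v) ->
  (forall v, e v <> None -> A v \/ e v = e0 v) -> P e.
Proof.
move=> P0 PS e; have [k] := ubnP #|[pred v | e v != e0 v]|.
elim: k e => // k IH e ek ext eA.
have [/existsP[v ve]|/existsPn eq] := boolP [exists v, e v != e0 v]; last first.
  by rewrite (_ : e = e0) //; apply/funext => v; apply/eqP/negbNE/eq.
have e0v : e0 v = None by case: (ext v) => // evE; rewrite evE eqxx in ve.
case ev: (e v) => [s|]; last by rewrite ev e0v eqxx in ve.
have Av : A v by have := eA v; rewrite ev e0v => -[].
rewrite -(expo_setK ev); apply: PS => //; first by rewrite /expo_unset eqxx.
apply: IH.
- rewrite -ltnS; apply: leq_trans ek; rewrite ltnS; apply: proper_card.
  apply/properP; split.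
    apply/subsetP => w; rewrite !inE /expo_unset.
    by have [->|//] := eqVneq w v; rewrite e0v eqxx.
  by exists v; rewrite !inE // /expo_unset eqxx e0v eqxx.
- by move=> w; rewrite /expo_unset; case: eqP => [->|_]; [left|apply: ext].
- by move=> w; rewrite /expo_unset; case: eqP => // _; apply: eA.
Qed.

Lemma vpow0 v : vpow v 0 = 1.
Proof. by rewrite /vpow mulm0n mpolyX0. Qed.

Lemma vpowD v s t : vpow v (s + t) = vpow v s * vpow v t.
Proof. by rewrite /vpow -!mpolyXn exprD. Qed.

Lemma vpow_dvd (J : lmodType S) v s t (u : J) :
  (s <= t)%N -> vpow v s *: u = 0 -> vpow v t *: u = 0.
Proof. by move=> /subnK <- su; rewrite vpowD -scalerA su scaler0. Qed.

Section Kill.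
Variable J : lmodType S.
Implicit Types (u w : J) (e : expo).

Lemma kill_submodule e : submodule (@kill J e).
Proof.
split=> [v s _|a u w ku kw v s es]; first by rewrite scaler0.
by rewrite scalerDr scalerA mulrC -scalerA ku // kw // scaler0 addr0.
Qed.

Lemma kill0 e : kill e (0 : J).
Proof. exact: (submod0 (kill_submodule e)). Qed.

Lemma killP e a u w : kill e u -> kill e w -> kill e (a *: u + w).
Proof. exact: (proj2 (kill_submodule e)). Qed.

Lemma killZ e a u : kill e u -> kill e (a *: u).
Proof. exact: (submodZ (kill_submodule e)). Qed.

Lemma killB e u w : kill e u -> kill e w -> kill e (u - w).
Proof. exact: (submodB (kill_submodule e)). Qed.

Lemma kill_set e v s u : e v = None ->
  kill (expo_set e v s) u <-> kill e u /\ vpow v s *: u = 0.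
Proof.
move=> ev; split=> [ku|[ku su] w t].
  split; last by apply: ku; rewrite /expo_set eqxx.
  move=> w t ew; apply: ku; rewrite /expo_set; case: eqP => // wv.
  by rewrite wv ev in ew.
by rewrite /expo_set; case: eqP => [-> [<-]|_] //; apply: ku.
Qed.

Lemma kill_mon e u v s (t : mon) : kill e u -> e v = Some s -> (s <= t v)%N -> 'X_[t] *: u = 0.
Proof.
move=> ku ev st; have le : (U_(v) *+ s <= t)%MM.
  by apply/mnm_lepP => w; rewrite mulmnE mnm1E; case: eqP => [<-|_]; rewrite ?mul1n.
by rewrite -(submK le) mpolyXD -scalerA ku // scaler0.
Qed.

End Kill.

Lemma kill_lin (J J' : lmodType S) (f : {linear J -> J'}) e (u : J) :
  kill e u -> kill e (f u).
Proof. by move=> ku v s es; rewrite -linearZ ku // linear0. Qed.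

Lemma kill_gproj (J : bigradedModule K m n) e g (u : J) : kill e u -> kill e (gproj g u).
Proof.
move=> ku v s es; have hX : bihom (bideg (U_(v) *+ s)%MM) (vpow v s) by apply: bihomXm.
by rewrite -(gprojZ g u hX) ku // gproj0.
Qed.

(** A variable without a power stays without one. This covers at once the surjectivity of v ^ s on
    the elements killed by [e] when [v] is free, and the passage from exponent r to s + r
    otherwise. *)
Definition expo_bump (e : expo) v s : expo :=
  fun w => if w == v then omap (addn s) (e w) else e w.

(** The conditions on [w] prescribe a map on the ideal generated by v ^ s and the powers in [e']: v
    ^ s times a monomial t goes to t [u], multiples of the powers in [e'] go to 0. The two rules
    agree where they overlap because [e] kills [u], and [monomial_extension] supplies [w]. *)
Lemma kill_divide_homogeneous (J : bigradedModule K m n) e v s (g : int * int) (u : J) :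
  graded_injective J -> gm_comp (bideg (U_(v) *+ s)%MM + g) u -> kill e u ->
  exists w, [/\ gm_comp g w, kill (expo_bump e v s) w & vpow v s *: w = u].
Proof.
move=> Jinj gu ku.
pose e' := expo_bump e v s.
pose U (t : mon) := (s <= t v)%N \/ exists w r, e' w = Some r /\ (r <= t w)%N.
pose phi (t : mon) : J := if (s <= t v)%N then 'X_[t - U_(v) *+ s] *: u else 0.
have phi0 (t : mon) w r : e' w = Some r -> (r <= t w)%N -> phi t = 0.
  rewrite /e' /expo_bump /phi => ew rt; case: ifP => // st.
  move: ew rt; have [->|wv] := eqVneq w v.
    case ev: (e v) => [r'|] //= [<-] rt; apply: kill_mon ku ev _.
    by rewrite mnmBE mulmnE mnm1E eqxx mul1n leq_subRL.
  move=> ew rt; apply: kill_mon ku ew _.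
  by rewrite mnmBE mulmnE mnm1E eq_sym (negbTE wv) subn0.
have le (t : mon) : (s <= t v)%N -> (U_(v) *+ s <= t)%MM.
  by move=> st; apply/mnm_lepP => w; rewrite mulmnE mnm1E; case: eqP => [<-|_]; rewrite ?mul1n.
have [|t Ut|r t Ut|w gw wP] := @monomial_extension K m n g U _ J phi Jinj.
- by move=> r t [st|[w [r' [ew rt]]]]; [left|right; exists w, r'; split=> //];
    rewrite mnmDE (leq_trans _ (leq_addl _ _)).
- case: (boolP (s <= t v)%N) => [st|/negbTE st]; last by rewrite /phi st; apply: gm_comp0.
  rewrite /phi st -(submK (le _ st)) bidegD -addrA addmK; apply: gm_compZ gu.
  exact: bihomXm.
- case: Ut => [st|[w [r' [ew rt]]]]; last first.
    rewrite (phi0 t w r') // scaler0 (phi0 _ w r') //.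
    by rewrite mnmDE (leq_trans rt) // leq_addl.
  rewrite /phi st mnmDE (leq_trans st (leq_addl _ _)) scalerA -mpolyXD.
  by rewrite addmBA // le.
exists w; split=> // [w' r ew|].
  rewrite /vpow wP ?(phi0 _ w' r) // ?mulmnE ?mnm1E ?eqxx ?mul1n //.
  by right; exists w', r; rewrite mulmnE mnm1E eqxx mul1n.
rewrite /vpow wP; last by left; rewrite mulmnE mnm1E eqxx mul1n.
rewrite /phi mulmnE mnm1E eqxx mul1n leqnn (_ : (_ - _)%MM = 0%MM) ?mpolyX0 ?scale1r //.
by apply/mnmP => c; rewrite mnmBE mnm0E subnn.
Qed.

Lemma kill_divide (J : bigradedModule K m n) e v s (u : J) :
  graded_injective J -> kill e u ->
  exists2 w, kill (expo_bump e v s) w & vpow v s *: w = u.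
Proof.
move=> Jinj ku; have [l [_ _ uE]] := gproj_sum u.
have /choice[w wP] : forall g, exists w : J,
    kill (expo_bump e v s) w /\ vpow v s *: w = gproj g u.
  move=> g; pose d := bideg (U_(v) *+ s)%MM.
  have gu : gm_comp (d + (g - d)) (gproj g u) by rewrite addrC subrK; apply: gproj_comp.
  have [w [_ kw wE]] := kill_divide_homogeneous Jinj gu (kill_gproj g ku).
  by exists w.
exists (\sum_(g <- l) w g).
  apply: (@submod_sum _ _ (@kill J (expo_bump e v s))) => [|g _]; first exact: kill_submodule.
  by have [] := wP g.
by rewrite scaler_sumr [RHS]uE; apply: eq_bigr => g _; case: (wP g).
Qed.

End Exponents.

(** * Exact sequences for adjoining or lowering a power of a variable *)

Section ExtComplexes.
Variables (K : fieldType) (m n : nat) (M : bigradedModule K m n).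
Variable I : injective_resolution M.
Local Notation S := {mpoly K[m + n]}.
Local Notation var := 'I_(m + n).
Local Notation d := (ir_diff I).
Implicit Types (e : expo m n) (g : int * int) (p : nat).

Lemma ir_diffK p (w : I p) : d p.+1 (d p w) = 0.
Proof. by apply/ir_exact; exists w. Qed.

(* cyc / cobd compute Ext^p_S(S / (v ^ e v), M). *)
Definition cyc e p (u : I p) := kill e u /\ d p u = 0.

Definition cobd e p : I p -> Prop :=
  match p return I p -> Prop with
  | 0 => fun u => u = 0
  | k.+1 => fun u => exists2 w : I k, kill e w & u = d k w
  end.

Definition acyclic e p g := forall u : I p, gm_comp g u -> cyc e u -> cobd e u.

Lemma cyc_submodule e p : submodule (@cyc e p).
Proof.
split=> [|a u v [ku du] [kv dv]].
  by split; [apply: kill0|rewrite linear0].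
by split; [apply: killP|rewrite linearP du dv scaler0 addr0].
Qed.

Lemma cobd_submodule e p : submodule (@cobd e p).
Proof.
case: p => [|p]; first by split=> // a u v -> ->; rewrite scaler0 addr0.
split=> [|a u v [w kw ->] [w' kw' ->]].
  by exists 0; [apply: kill0|rewrite linear0].
by exists (a *: w + w'); [apply: killP|rewrite linearP].
Qed.

Lemma cyc_gproj e p g (u : I p) : cyc e u -> cyc e (gproj g u).
Proof.
by move=> [ku du]; split; [apply: kill_gproj|rewrite -gproj_hom du gproj0].
Qed.

Lemma cobd_gproj e p g (u : I p) : cobd e u -> cobd e (gproj g u).
Proof.
case: p u => [|p] u /=; first by move=> ->; apply: gproj0.
by move=> [w kw ->]; exists (gproj g w); [apply: kill_gproj|rewrite gproj_hom].
Qed.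

Lemma cobd_homogeneous e p g (u : I p.+1) : gm_comp g u -> cobd e u ->
  exists w : I p, [/\ gm_comp g w, kill e w & u = d p w].
Proof.
move=> gu [w kw uE]; exists (gproj g w); split; first exact: gproj_comp.
  exact: kill_gproj.
by rewrite -gproj_hom -uE gproj_id.
Qed.

Lemma vpow_comp p g v s (u : I p) : gm_comp g u -> gm_comp (bideg (U_(v) *+ s)%MM + g) (vpow K v s *: u).
Proof. by move=> gu; apply: gm_compZ gu; apply: bihomXm. Qed.

Lemma kill_vpow e p v s (u : I p) : kill e u -> kill e (vpow K v s *: u).
Proof. exact: killZ. Qed.

Lemma expo_bump_none e v s : e v = None -> expo_bump e v s = e.
Proof. by move=> ev; apply/funext => w; rewrite /expo_bump; case: eqP => // ->; rewrite ev. Qed.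

(* 0 -> H^p-1 / v^s -> H^p(expo_set e v s) -> H^p(e) *)
Lemma acyclic_set e v s p g : e v = None ->
  acyclic e p g -> (forall p', p = p'.+1 -> acyclic e p' (bideg (U_(v) *+ s)%MM + g)) ->
  acyclic (expo_set e v s) p g.
Proof.
move=> ev ep ep' u gu [ku du].
have [keu su] := (kill_set s u ev).1 ku.
case: p u gu ku du ep ep' keu su => [|p] u gu ku du ep ep' keu su; first exact: ep.
have [w [gw kw uE]] := cobd_homogeneous gu (ep u gu (conj keu du)).
(* The cochain [w] need not be killed by v ^ s, so a cocycle [w'] with the same multiple by v ^ s is
   subtracted: v ^ s w is a cocycle, hence some d z, and dividing z by v ^ s gives z' with w' = d
   z'. *)
have [w' kw' wE] : exists2 w', kill e w' & d p w' = 0 /\ vpow K v s *: (w - w') = 0.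
  have swc : cobd e (vpow K v s *: w).
    apply: ep' => //; first exact: vpow_comp.
    by split; [apply: kill_vpow|rewrite linearZ -uE].
  move: swc; rewrite {uE ep ep' su ku du keu gu u gw}; case: p w kw => [|p] w kw.
    by move=> /= sw; exists 0; [apply: kill0|rewrite linear0 subr0].
  case=> z kz swE; have [z' kz' zE] := kill_divide v s (@ir_inj _ _ _ _ I p) kz.
  rewrite expo_bump_none // in kz'.
  exists (d p z'); first exact: kill_lin.
  by rewrite ir_diffK scalerBr swE -linearZ zE subrr.
exists (w - w'); last by rewrite linearB wE.1 subr0.
by apply/(kill_set _ _ ev); split; [apply: killB|case: wE].
Qed.

(** The exact sequence used in [acyclic_set], as two extensions. The first is induced by inclusion
    of cochains. The second treats its kernel by inverting the connecting map: u = d w goes to v ^ s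
    w, which is only a relation since w is determined up to cocycles. *)
Lemma noetherian_set e v s p : e v = None ->
  noetherian (@cyc e p) (@cobd e p) ->
  (forall p', p = p'.+1 -> noetherian (@cyc e p') (@cobd e p')) ->
  noetherian (@cyc (expo_set e v s) p) (@cobd (expo_set e v s) p).
Proof.
move=> ev np np'.
apply: (noetherian_extension (r := fun u z => u = z)) np _ _.
- by split=> // a u u' z z' -> ->.
- exact: cyc_submodule.
- exact: cobd_submodule.
- by move=> u [/(kill_set _ _ ev)[ku _] du]; exists u.
case: p np' => [|p] np'; first by apply: noetherian_zero => u [_ [z /= ->]].
pose r (u : I p.+1) (z : I p) := exists w, [/\ kill e w, u = d p w & z = vpow K v s *: w].
apply: (noetherian_extension (r := r)) (np' p erefl) _ _.
- split; first by exists 0; split; rewrite ?linear0 ?scaler0 //; apply: kill0.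
  move=> a u u' z z' [w [kw -> ->]] [w' [kw' -> ->]]; exists (a *: w + w'); split.
  + exact: killP.
  + by rewrite linearP.
  + by rewrite scalerDr !scalerA mulrC.
- exact: cyc_submodule.
- exact: cobd_submodule.
- move=> u [[/(kill_set _ _ ev)[_ su] _] [z [w kw zE] uz]].
  exists (vpow K v s *: w); last by exists w; rewrite uz.
  by split; [apply: kill_vpow|rewrite linearZ -zE -uz].
apply: noetherian_zero => u [_ [z zc [w [kw -> zE]]]].
have [w' kw' [dw' sw']] : exists2 w', kill e w' & d p w' = 0 /\ vpow K v s *: (w - w') = 0.
  rewrite zE in zc; clear - zc kw ev.
  case: p w zc kw => [|p] w /= zc kw.
    by exists 0; [apply: kill0|rewrite linear0 subr0].
  have [y ky wE] := zc; have [y' ky' yE] := kill_divide v s (@ir_inj _ _ _ _ I p) ky.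
  rewrite expo_bump_none // in ky'.
  exists (d p y'); first exact: kill_lin.
  by rewrite ir_diffK scalerBr wE -linearZ yE subrr.
exists (w - w'); last by rewrite linearB dw' subr0.
by apply/(kill_set _ _ ev); split=> //; apply: killB.
Qed.

(* 0 -> A(v ^ s) -> A(v ^ s.+1) -> A(v) -> 0, the second map being v ^ s *)
Lemma cyc_lower e v s p g (u : I p) :
  acyclic (expo_set e v 1) p (bideg (U_(v) *+ s)%MM + g) ->
  gm_comp g u -> cyc (expo_set e v s.+1) u ->
  exists w, [/\ gm_comp g w, cyc (expo_set e v s) w & cobd (expo_set e v s.+1) (u - w)].
Proof.
set e1 := expo_set e v s.+1 => ac gu [ku du].
have setP t (w : I p) : (forall v' s', v' <> v -> e v' = Some s' -> vpow K v' s' *: w = 0) ->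
    vpow K v t *: w = 0 -> kill (expo_set e v t) w.
  by move=> kw tw v' s'; rewrite /expo_set; case: eqP => [-> [<-]|ne] //; apply: kw.
have oth v' s' : v' <> v -> e v' = Some s' -> vpow K v' s' *: u = 0.
  by move=> ne es; apply: ku; rewrite /e1 /expo_set; case: eqP.
have suk : kill (expo_set e v 1) (vpow K v s *: u).
  apply: setP => [v' s' ne es|]; first by rewrite scalerA mulrC -scalerA oth // scaler0.
  by rewrite scalerA -vpowD add1n ku // /e1 /expo_set eqxx.
have dsu : d p (vpow K v s *: u) = 0 by rewrite linearZ /= du scaler0.
have {ac dsu} sc := ac _ (vpow_comp v s gu) (conj suk dsu).
case: p u gu ku du setP oth suk sc => [|p] u gu ku du setP oth suk sc.
  exists u; split=> //; last by rewrite subrr; apply: submod0 (cobd_submodule _ _).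
  by split=> //; apply: setP.
have [z [gz kz suE]] := cobd_homogeneous (vpow_comp v s gu) sc.
(* Here v ^ s u = d z with z killed by v, and z = v ^ s w with w killed by v ^ (s + 1); so v ^ s
   kills u - d w, which is the representative wanted. *)
have [w [gw kw zE]] := kill_divide_homogeneous (@ir_inj _ _ _ _ I p) gz kz.
have {}kw : kill e1 w.
  move=> v' s' es; apply: kw; move: es; rewrite /e1 /expo_set /expo_bump.
  by case: eqP => //= _ <-; rewrite addn1.
exists (u - d p w); split.
- by apply: gm_compB => //; apply: gh_comp.
- split; last by rewrite linearB du ir_diffK subrr.
  apply: setP => [v' s' ne es|]; last by rewrite scalerBr suE -linearZ zE subrr.
  have e1v' : e1 v' = Some s' by rewrite /e1 /expo_set; case: eqP.
  by rewrite scalerBr (oth v') // -linearZ (kw _ _ e1v') linear0 subr0.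
- by exists w => //; rewrite opprB addrC subrK.
Qed.

(** With no powers the complex is the resolution itself, with cohomology M in degree 0 only; the
    powers are then adjoined one by one. *)
Lemma noetherian_ext e p : finitely_generated M ->
  noetherian (@cyc e p) (@cobd e p).
Proof.
move=> [k [a aP]].
have base p' : noetherian (@cyc (@expo_none m n) p') (@cobd (@expo_none m n) p').
  case: p' => [|p']; last first.
    by apply: noetherian_zero => u [_ /ir_exact[v ->]]; exists v.
  have nM := @noetherian_fg K _ _ _ (fun i => ir_aug I (a i)).
  apply: (noetherian_sub _ _ nM) => // u [_ /ir_exact0[v ->]].
  have [c ->] := aP v; exists c; rewrite linear_sum; apply: eq_bigr => i _.
  by rewrite linearZ.
move: p; apply: (expo_ind (A := predT) (e0 := @expo_none m n)
  (P := fun e => forall p, noetherian (@cyc e p) (@cobd e p))) => //; first 1 last.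
- by move=> v; left.
- by move=> v _; left.
by move=> {}e v s _ ev IH p; apply: noetherian_set.
Qed.

Lemma acyclic_none p g : (0 < p)%N -> acyclic (@expo_none m n) p g.
Proof. by case: p => // p _ u _ [_ /ir_exact[v ->]]; exists v. Qed.

(** The resolution may be infinite. Each adjoined power raises the last possible cohomological
    degree by at most one, so later bounds need to be taken over finitely many [p] only. *)
Lemma acyclic_large e : exists N, forall p g, (N < p)%N -> acyclic e p g.
Proof.
apply: (expo_ind (A := predT) (e0 := @expo_none m n)
  (P := fun e => exists N, forall p g, (N < p)%N -> acyclic e p g)) => //.
- by exists 0; apply: acyclic_none.
- move=> {}e v s _ ev [N NP]; exists N.+1 => p g Np; apply: acyclic_set => //.
    exact/NP/ltnW.
  by move=> p' pE; apply: NP; rewrite pE in Np.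
- by move=> v; left.
- by move=> v _; left.
Qed.

(** Adjoining v ^ s needs acyclicity in g and in g + deg(v ^ s), so [D] has only to be stable under
    the degrees of the variables in [A]. *)
Lemma acyclic_extend (D : int * int -> Prop) (A : pred var) e e' :
  (forall g v s, A v -> D g -> D (bideg (U_(v) *+ s)%MM + g)) ->
  (forall v, e v = None \/ e' v = e v) ->
  (forall v, e' v <> None -> A v \/ e' v = e v) ->
  (forall p g, D g -> acyclic e p g) -> forall p g, D g -> acyclic e' p g.
Proof.
move=> DA ext eA eP.
apply: (expo_ind (A := A) (e0 := e) (P := fun e => forall p g, D g -> acyclic e p g)) => //.
move=> {ext eA}e' v s Av ev IH p g Dg.
by apply: acyclic_set => // [|p' _]; apply: IH => //; apply: DA.
Qed.

End ExtComplexes.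

(** * Finiteness and boundedness of graded components *)

Lemma int_upper_bound (T : eqType) (s : seq T) (f : T -> int) :
  exists b : int, forall x, x \in s -> f x <= b.
Proof.
elim: s => [|x s [b bP]]; first by exists 0.
exists (Num.max (f x) b) => y; rewrite inE => /predU1P[->|/bP yb].
  by rewrite le_max lexx.
by rewrite le_max yb orbT.
Qed.

Section FiniteSpan.
Variables (K : fieldType) (N : nat) (V : lmodType {mpoly K[N]}).

(** Coefficients are indexed by vectors, so repeated entries of [s] share one; the lists are
    therefore made duplicate-free by [undup]. *)
Definition kspan (s : seq V) (w : V) :=
  exists c : V -> K, w = \sum_(v <- s) (c v)%:MP *: v.

Lemma kspan0 s : kspan s 0.
Proof. by exists (fun=> 0); rewrite big1 // => v _; rewrite mpolyC0 scale0r. Qed.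

Lemma kspanD s u w : kspan s u -> kspan s w -> kspan s (u + w).
Proof.
move=> [c ->] [c' ->]; exists (fun v => c v + c' v); rewrite -big_split.
by apply: eq_bigr => v _; rewrite mpolyCD scalerDl.
Qed.

Lemma kspanZ s (a : K) v : uniq s -> v \in s -> kspan s (a%:MP *: v).
Proof.
move=> us vs; exists (fun w => if w == v then a else 0).
rewrite (bigD1_seq v) //= eqxx big1 ?addr0 // => w /negbTE ->.
by rewrite mpolyC0 scale0r.
Qed.

End FiniteSpan.

Lemma kspan_map (K : fieldType) (N N' : nat) (V : lmodType {mpoly K[N]})
    (V' : lmodType {mpoly K[N']}) (f : V -> V') (s : seq V) w :
  (forall u v, f (u + v) = f u + f v) -> f 0 = 0 ->
  (forall (a : K) v, f (a%:MP *: v) = a%:MP *: f v) ->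
  kspan s w -> kspan (undup [seq f v | v <- s]) (f w).
Proof.
move=> fD f0 fZ [c ->]; rewrite (big_morph f fD f0) big_seq.
elim/big_ind: _ => [||v vs]; [exact: kspan0|exact: kspanD|].
by rewrite fZ; apply: kspanZ; rewrite ?undup_uniq // mem_undup map_f.
Qed.

Section HomogeneousGenerators.
Variables (K : fieldType) (m n : nat) (J : bigradedModule K m n).
Local Notation S := {mpoly K[m + n]}.
Local Notation mon := 'X_{1..m + n}.
Variables (Z B : J -> Prop).
Hypothesis Zgproj : forall g u, Z u -> Z (gproj g u).
Hypothesis Bgproj : forall g u, B u -> B (gproj g u).

Definition homog_part (a : int * int) (p : S) : S :=
  \sum_(t <- msupp p | bideg t == a) p@_t *: 'X_[t].

Lemma bihom_homog_part a p : bihom a (homog_part a p).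
Proof.
rewrite /homog_part; elim/big_ind: _ => [t|p1 p2|t /eqP <-]; first by rewrite msupp0.
  exact: bihomD.
exact/bihomZ/bihomXm.
Qed.

Lemma gproj_scale g h (p : S) (v : J) : gm_comp h v ->
  gproj g (p *: v) = homog_part (g - h) p *: v.
Proof.
move=> hv; rewrite {1}[p]mpolyE scaler_suml gproj_bigsum /homog_part scaler_suml.
rewrite [RHS]big_mkcond; apply: eq_bigr => t _.
have tv : gm_comp (bideg t + h) ((p@_t *: 'X_[t]) *: v).
  by apply: gm_compZ hv; apply/bihomZ/bihomXm.
case: eqP => [tg|ne]; first by apply: gproj_id; rewrite -[g](subrK h) -tg.
by apply: gproj_neq tv _; apply: contra_not_neq ne => ->; rewrite addrK.
Qed.

(* r lists pairs of a coefficient and a generator with its degree. *)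
Definition combination (l : seq ((int * int) * J)) (g : int * int)
    (r : seq (S * ((int * int) * J))) :=
  forall x, x \in r -> x.2 \in l /\ bihom (g - x.2.1) x.1.

Lemma fg_homogeneous : fg_modulo Z B -> exists l : seq ((int * int) * J),
  (forall x, x \in l -> gm_comp x.1 x.2 /\ Z x.2) /\
  forall g u, Z u -> gm_comp g u ->
  exists2 r, combination l g r & B (u - \sum_(x <- r) x.1 *: x.2.2).
Proof.
move=> [k [e [eZ egen]]].
have /choice[s sP] : forall i, exists s : seq (int * int),
    e i = \sum_(h <- s) gproj h (e i).
  by move=> i; have [s [_ _ sE]] := gproj_sum (e i); exists s.
exists [seq (h, gproj h (e i)) | i <- enum 'I_k, h <- s i]; split.
  move=> _ /allpairsPdep[i [h [_ _ ->]]] /=.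
  by split; [apply: gproj_comp|apply/Zgproj/eZ].
move=> g u Zu gu; have [c cP] := egen u Zu.
exists [seq (homog_part (g - h) (c i), (h, gproj h (e i))) | i <- enum 'I_k, h <- s i].
  move=> _ /allpairsPdep[i [h [ik hs ->]]] /=; split; last exact: bihom_homog_part.
  by apply/allpairsPdep; exists i, h.
have := Bgproj g cP; rewrite gprojB (gproj_id gu) gproj_bigsum.
congr (B (_ - _)); rewrite big_allpairs_dep /= big_enum /=; apply: eq_bigr => i _.
rewrite {1}[e i]sP scaler_sumr gproj_bigsum; apply: eq_bigr => h _.
exact/gproj_scale/gproj_comp.
Qed.

(** Monomials of positive degree kill the generators, so nothing nonzero modulo [B] lies beyond the
    largest degree of a generator. The degree [pi] will be the x-degree or the y-degree. *)
Lemma fg_bounded (pi : int * int -> int) :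
  (forall g h, pi (g - h) = pi g - pi h) ->
  (forall t u, 0 < pi (bideg t) -> Z u -> 'X_[t] *: u = 0) ->
  fg_modulo Z B ->
  exists b, forall g u, b < pi g -> Z u -> gm_comp g u -> B u.
Proof.
move=> piB Zkill /fg_homogeneous[l [lZ lgen]].
have [b bP] := int_upper_bound l (fun x => pi x.1).
exists b => g u bg Zu gu; have [r rP] := lgen g u Zu gu.
rewrite big_seq big1 ?subr0 // => x /rP[/[dup] xl /lZ[_ Zx] xc].
rewrite [x.1]mpolyE scaler_suml big_seq big1 // => t /xc tE.
rewrite -mul_mpolyC -scalerA Zkill ?scaler0 // -[bideg t]/(_, _) tE piB subr_gt0.
exact: le_lt_trans (bP _ xl) bg.
Qed.

Lemma fg_finite_dim g : (forall t u, Z u -> Z ('X_[t] *: u)) -> fg_modulo Z B ->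
  exists s : seq J, (forall v, v \in s -> Z v) /\
  forall u, Z u -> gm_comp g u -> exists2 w, kspan s w & B (u - w).
Proof.
move=> ZX /fg_homogeneous[l [lZ lgen]].
(* [D a] exceeds the total degree of every monomial of bidegree [a], so that finitely many monomials
   come into question. *)
pose D (a : int * int) := (`|a.1| + `|a.2|).+1%N.
exists (undup [seq 'X_[bmnm t] *: x.2 | x <- l, t <- enum {: bmultinom (m + n) (D (g - x.1))}]).
split=> [v|u Zu gu].
  by rewrite mem_undup => /allpairsPdep[x [t [/lZ[_ Zx] _ ->]]]; apply: ZX.
have [r rP rB] := lgen g u Zu gu; exists (\sum_(x <- r) x.1 *: x.2.2) => //.
rewrite big_seq; elim/big_ind: _ => [||x /rP[xl xc]]; [exact: kspan0|exact: kspanD|].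
rewrite [x.1]mpolyE scaler_suml big_seq.
elim/big_ind: _ => [||t tx]; [exact: kspan0|exact: kspanD|].
rewrite -mul_mpolyC -scalerA; apply: kspanZ; first exact: undup_uniq.
have tD : (mdeg t < D (g - x.2.1)%R)%N.
  rewrite /D -(xc t tx) /= ltnS mdegE big_split_ord /=.
  exact: leqnn.
rewrite mem_undup; apply/allpairsPdep; exists x.2, (BMultinom tD); split=> //.
by rewrite mem_enum.
Qed.

End HomogeneousGenerators.

Lemma fg_bounded_below (K : fieldType) (m n : nat) (M : bigradedModule K m n) :
  finitely_generated M -> exists a0 : int, forall g (u : M), g.1 < a0 -> gm_comp g u -> u = 0.
Proof.
move=> [k [e eP]].
have [||l [_ lgen]] := @fg_homogeneous K m n M (fun=> True) (fun u => u = 0) (fun _ _ => id).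
- by move=> g u ->; apply: gproj0.
- by exists k, e; split=> // u _; have [c ->] := eP u; exists c; rewrite subrr.
have [b bP] := int_upper_bound l (fun x => - x.1.1).
exists (- b) => g u gb gu; have [r rP /eqP] := lgen g u I gu.
rewrite subr_eq0 => /eqP ->; rewrite big_seq big1 // => x /rP[/bP xb xc].
suff -> : x.1 = 0 by rewrite scale0r.
apply/mpolyP => t; rewrite mcoeff0; apply/eqP; rewrite mcoeff_eq0; apply/negP => /xc.
move=> /(congr1 fst) /= tE; have : (0 : int) <= g.1 - x.2.1.1 by rewrite -tE.
rewrite leNgt => /negP; apply; rewrite subr_lt0; apply: lt_le_trans gb _.
by rewrite lerNl.
Qed.

(** * The Q-torsion complex as a union of stages with fixed powers of the y-variables *)

Section TorsionComplex.
Variables (K : fieldType) (m n : nat) (M : bigradedModule K m n).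
Variable I : injective_resolution M.
Hypothesis fgM : finitely_generated M.
Local Notation S := {mpoly K[m + n]}.
Local Notation mon := 'X_{1..m + n}.
Local Notation d := (ir_diff I).

Definition yexpo (f : 'I_n -> nat) : expo m n :=
  fun v => match split v with inl _ => None | inr j => Some (f j) end.

(* The ideal (x_i : i < r) + (y_j ^ t : j < n); t = None drops the y-powers. *)
Definition xyexpo (r : nat) (t : option nat) : expo m n :=
  fun v => match split v with inl i => if (i < r)%N then Some 1 else None | inr j => t end.

Lemma split_lshift (i : 'I_m) : split (lshift n i) = inl i.
Proof. exact: (unsplitK (inl i)). Qed.

Lemma split_rshift (j : 'I_n) : split (rshift m j) = inr j.
Proof. exact: (unsplitK (inr j)). Qed.

Lemma bideg_x i s : @bideg m n (U_(lshift n i) *+ s)%MM = (s%:Z, 0 : int).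
Proof.
congr (_%:Z, _%:Z); last first.
  by rewrite big1 // => j _; rewrite mulmnE mnm1E eq_lrshift mul0n.
rewrite (bigD1 i) //= mulmnE mnm1E eqxx mul1n big1 ?addn0 // => j ji.
by rewrite mulmnE mnm1E eq_lshift eq_sym (negbTE ji) mul0n.
Qed.

Lemma bideg_y j s : @bideg m n (U_(rshift m j) *+ s)%MM = (0 : int, s%:Z).
Proof.
congr (_%:Z, _%:Z); first by rewrite big1 // => i _; rewrite mulmnE mnm1E eq_rlshift mul0n.
rewrite (bigD1 j) //= mulmnE mnm1E eqxx mul1n big1 ?addn0 // => i ij.
by rewrite mulmnE mnm1E eq_rshift eq_sym (negbTE ij) mul0n.
Qed.

(** Pigeonhole: among n t + 1 factors some y_j occurs at least t times. The extra factor also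
    settles n = 0, where Q = 0 and every element is torsion. *)
Lemma torsion_kill (J : lmodType S) (u : J) :
  torsionQ u <-> exists t, kill (yexpo (fun=> t)) u.
Proof.
split=> [[k /killedQP ku]|[t ku]].
  exists k => v s; rewrite /yexpo; case: splitP => // j vj [<-].
  have -> : v = rshift m j by apply: val_inj.
  have := ku (fun=> j); rewrite prodr_const card_ord => <-.
  by rewrite /vpow -mpolyXn.
exists (n * t).+1; apply/killedQP => a.
have -> : \prod_i yvar K m (a i) = 'X_[\sum_i U_(rshift m (a i))] :> S.
  by rewrite -mprodXE.
have [j tj] : exists j : 'I_n, (t <= \sum_(i < (n * t).+1) (a i == j))%N.
  apply: contrapT => /forallNP nt.
  have : (\sum_(j < n) \sum_(i < (n * t).+1) (a i == j) <= \sum_(j < n) t)%N.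
    by apply: leq_sum => j _; have /negP := nt j; rewrite -ltnNge => /ltnW.
  rewrite exchange_big /= (eq_bigr (fun=> 1%N)); last first.
    move=> i _; rewrite (bigD1 (a i)) //= eqxx big1 ?addn0 // => j.
    by rewrite eq_sym => /negbTE ->.
  by rewrite !sum_nat_const !card_ord muln1 ltnn.
apply: (kill_mon (v := rshift m j) ku); first by rewrite /yexpo split_rshift.
rewrite mnm_sumE; apply: leq_trans tj _; apply: leq_sum => i _.
by rewrite mnm1E eq_rshift.
Qed.

Lemma kill_yexpo_le (J : lmodType S) (u : J) (f h : 'I_n -> nat) :
  (forall j, (f j <= h j)%N) -> kill (yexpo f) u -> kill (yexpo h) u.
Proof.
move=> fh ku v s; have := ku v; rewrite /yexpo; case: split => // j kj [<-].
by apply: vpow_dvd (fh j) _; apply: kj.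
Qed.

Lemma kill_xyexpo (J : lmodType S) (u : J) r t :
  kill (xyexpo r (Some t)) u <->
  (forall i : 'I_m, (i < r)%N -> xvar K n i *: u = 0) /\ kill (yexpo (fun=> t)) u.
Proof.
split=> [ku|[xu yu] v s].
  split=> [i ir|v s].
    have := ku (lshift n i) 1; rewrite /xyexpo split_lshift ir => /(_ erefl).
    by rewrite /vpow mulm1n.
  by have := ku v s; rewrite /yexpo /xyexpo; case: split.
rewrite /xyexpo; case: splitP => [i vi|j vj].
  case: ifP => // ir [<-]; rewrite /vpow mulm1n.
  have -> : v = lshift n i by apply: val_inj.
  exact: xu.
case=> <-; apply: yu; rewrite /yexpo.
have -> : v = rshift m j by apply: val_inj.
by rewrite split_rshift.
Qed.

Lemma ext_fg e p : fg_modulo (@cyc _ _ _ _ I e p) (@cobd _ _ _ _ I e p).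
Proof. exact: (@noetherian_ext K m n M I e p fgM _ (@cyc_submodule K m n M I e p)). Qed.

Lemma bideg_pos1 (t : mon) : 0 < (bideg t).1 -> exists i, (0 < t (lshift n i))%N.
Proof.
move=> t0; apply: contrapT => /forallNP nt; move: t0; rewrite /= big1 ?ltxx // => i _.
by apply/eqP; rewrite -leqn0 leqNgt; apply/negP.
Qed.

Lemma bideg_pos2 (t : mon) : 0 < (bideg t).2 -> exists j, (0 < t (rshift m j))%N.
Proof.
move=> t0; apply: contrapT => /forallNP nt; move: t0; rewrite /= big1 ?ltxx // => i _.
by apply/eqP; rewrite -leqn0 leqNgt; apply/negP.
Qed.

(** Every monomial of positive x-degree kills the cocycles, so [fg_bounded] applies for each [p];
    [acyclic_large] reduces to finitely many [p]. *)
Lemma acyclic_x_bound : exists b : int, forall p g, b < g.1 ->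
  acyclic I (xyexpo m None) p g.
Proof.
have [N NP] := acyclic_large I (xyexpo m None).
have /choice[b bP] : forall p, exists b : int, forall g, b < g.1 ->
    acyclic I (xyexpo m None) p g.
  move=> p; have [||||b bP] := fg_bounded (J := I p) (pi := fst) _ _ _ _ (ext_fg (xyexpo m None) p).
  - by move=> g u; apply: cyc_gproj.
  - by move=> g u; apply: cobd_gproj.
  - by [].
  - move=> t u /bideg_pos1[i ti] [ku _]; apply: (kill_mon ku) ti.
    by rewrite /xyexpo split_lshift ltn_ord.
  by exists b => g bg u gu cu; apply: bP bg _ _.
have [c cP] := int_upper_bound (iota 0 N.+1) b.
exists c => p g cg; have [Np|pN] := ltnP N p; first exact: NP.
by apply: bP; apply: le_lt_trans (cP p _) cg; rewrite mem_iota.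
Qed.

(** Powers of the y_j have x-degree 0, so the half-plane b < g.1 is stable and [b] does not depend
    on [t]. *)
Lemma acyclic_xy_bound : exists b : int, forall t p g, b < g.1 ->
  acyclic I (xyexpo m (Some t)) p g.
Proof.
have [b bP] := acyclic_x_bound; exists b => t.
apply: (acyclic_extend (D := fun g => b < g.1)
  (A := fun v => if split v is inr _ then true else false) (e := xyexpo m None)) => //.
- move=> g v s; case: splitP => // j vj _.
  have -> : v = rshift m j by apply: val_inj.
  by rewrite bideg_y /= add0r.
- by move=> v; rewrite /xyexpo; case: split => [i|j]; [right|left].
- by move=> v; rewrite /xyexpo; case: split => [i|j]; [right|left].
Qed.

(** The bound is that of M: in bidegrees where M vanishes the resolution is exact everywhere, and
    powers of the y_j do not change the x-degree. *)
Lemma acyclic_y_below : exists a0 : int, forall t p g, g.1 < a0 ->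
  acyclic I (yexpo (fun=> t)) p g.
Proof.
have [a0 a0P] := fg_bounded_below fgM; exists a0 => t.
apply: (acyclic_extend (D := fun g => g.1 < a0)
  (A := fun v => if split v is inr _ then true else false) (e := @expo_none m n)) => //.
- move=> g v s; case: splitP => // j vj _.
  have -> : v = rshift m j by apply: val_inj.
  by rewrite bideg_y /= add0r.
- by move=> v; left.
- by move=> v; rewrite /yexpo; case: split => [i|j] //; left.
move=> p g ga; case: p => [|p]; last exact: acyclic_none.
move=> u gu [_ /ir_exact0[v uE]] /=; rewrite uE; suff -> : v = 0 by rewrite linear0.
apply: (a0P g) => //; suff <- : gproj g v = v by apply: gproj_comp.
by apply: (@ir_aug_inj _ _ _ _ I); rewrite -gproj_hom -uE gproj_id.
Qed.

Lemma expo_set_yexpo f j s :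
  expo_set (yexpo f) (rshift m j) s = yexpo (fun i => if i == j then s else f i).
Proof.
apply/funext => v; rewrite /expo_set /yexpo; case: splitP => [i vi|i vi].
  case: eqP => // vE; have := ltn_ord i; rewrite -vi vE /= ltnNge leq_addr //.
have -> : v = rshift m i by apply: val_inj.
by rewrite eq_rshift; case: eqP.
Qed.

(* Raising the exponents one at a time, starting from the ideal (y_1, ..., y_n). *)
Lemma acyclic_y_above q : exists c : int, forall f g, c < g.2 -> acyclic I (yexpo f) q g.
Proof.
(* [D] holds indices whose exponent is 1. The outer induction enlarges [D]; the inner one lowers the
   exponent of one index outside it. When [D] is everything, each y_j acts as 0 and [fg_bounded]
   applies to the y-degree. *)
suff H k (D : {set 'I_n}) : (#|~: D| <= k)%N -> exists c : int, forall f g,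
    (forall j, j \in D -> f j = 1) -> c < g.2 -> acyclic I (yexpo f) q g.
  have [c cP] := H _ set0 (leqnn _); exists c => f g; apply: cP => j.
  by rewrite inE.
elim: k D => [|k IH] D Dk.
  have DT j : j \in D.
    by move: Dk; rewrite leqn0 cards_eq0 => /eqP/setP/(_ j); rewrite !inE => /negbFE.
  have [||||c cP] := fg_bounded (J := I q) (pi := snd) _ _ _ _ (ext_fg (yexpo (fun=> 1)) q).
  - by move=> g u; apply: cyc_gproj.
  - by move=> g u; apply: cobd_gproj.
  - by [].
  - move=> t u /bideg_pos2[j tj] [ku _]; apply: (kill_mon ku) tj.
    by rewrite /yexpo split_rshift.
  exists c => f g f1 cg; rewrite (_ : f = fun=> 1); last by apply/funext => j; apply: f1.
  by move=> u gu cu; apply: cP cg _ _.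
have [|/subsetPn[j _ jD]] := boolP (setT \subset D).
  by rewrite subTset => /eqP DT; apply: IH; rewrite DT setCT cards0.
have [|c cP] := IH (j |: D).
  rewrite -ltnS; apply: leq_trans Dk; apply: proper_card.
  apply/properP; split; first by apply/subsetP => i; rewrite !inE negb_or => /andP[].
  by exists j; rewrite !inE ?eqxx.
exists c => f g f1; have [s] : exists s, f j = s by exists (f j).
elim: s f f1 => [|s IHs] f f1 fj cg u gu cu.
  have -> : u = 0.
    have [ku _] := cu; have := ku (rshift m j) 0; rewrite /yexpo split_rshift fj vpow0 scale1r.
    by apply.
  exact: (submod0 (@cobd_submodule _ _ _ _ I _ q)).
have fE : yexpo f = expo_set (yexpo f) (rshift m j) s.+1.
  by rewrite expo_set_yexpo; congr yexpo; apply/funext => i; case: eqP => // ->.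
rewrite fE in cu *.
have [|w [gw cw wu]] := cyc_lower (v := rshift m j) (s := s) _ gu cu.
  (* Multiplying by y_j ^ s raises the y-degree, so [c] serves unchanged. *)
  rewrite expo_set_yexpo; apply: cP => [i|]; last by rewrite bideg_y /= (lt_le_trans cg) // lerDr.
  by rewrite !inE; case: eqP => // _ /f1.
have cwb : cobd (expo_set (yexpo f) (rshift m j) s) w.
  move: cw; rewrite expo_set_yexpo; apply: IHs => //; last by rewrite eqxx.
  by move=> i iD; case: eqP => [ij|_]; [rewrite -ij iD in jD|apply: f1].
rewrite -[u](subrK w); apply: (submodD (@cobd_submodule _ _ _ _ I _ q)) => //.
case: (q) w cwb {gw cw wu u gu cu} => [|p] w //= [z kz wE]; exists z => //.
move: kz; rewrite !expo_set_yexpo; apply: kill_yexpo_le => i.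
by case: eqP.
Qed.

Lemma is_coboundary0 p : @is_coboundary _ _ _ _ I p 0.
Proof. by case: p => [|p] //=; exists 0; [apply: torsionQ0|rewrite linear0]. Qed.

Lemma is_coboundaryD p (u v : I p) : is_coboundary u -> is_coboundary v -> is_coboundary (u + v).
Proof. by move=> cu cv; rewrite -[u]scale1r; apply: is_coboundaryP. Qed.

Lemma cobd_torsion f p (u : I p) : cobd (yexpo f) u -> is_coboundary u.
Proof.
case: p u => [|p] u //= [w kw ->]; exists w => //; apply/torsion_kill.
exists (\max_j f j); apply: kill_yexpo_le kw => j.
exact: leq_bigmax.
Qed.

Lemma cyc_stable q (g : int * int) : exists t0, forall u : I q, gm_comp g u ->
  is_cocycle u ->
  exists w, [/\ gm_comp g w, cyc (yexpo (fun=> t0)) w & is_coboundary (u - w)].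
Proof.
have [c cP] := acyclic_y_above q.
(* With this [t0] one has c < s + g.2 for all s >= t0, so [cyc_lower] permits every lowering of an
   exponent from s + 1 to s. The induction is on the total excess of the exponents over [t0]. *)
exists (`|c| + `|g.2|).+1%N; set t0 := (_ + _).+1 => u gu [/torsion_kill[t ku] du].
suff H k f : (\sum_j (f j - t0) <= k)%N -> (forall j, (t0 <= f j)%N) ->
    forall u : I q, gm_comp g u -> cyc (yexpo f) u ->
    exists w, [/\ gm_comp g w, cyc (yexpo (fun=> t0)) w & is_coboundary (u - w)].
  apply: (H _ (fun=> maxn t t0) (leqnn _)) => // [j|]; first exact: leq_maxr.
  by split=> //; apply: kill_yexpo_le ku => j; apply: leq_maxl.
elim: k f => [|k IH] f fk ft0 {ku du gu}u gu cu.
  exists u; split=> //; last by rewrite subrr; apply: is_coboundary0.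
  suff <- : f = fun=> t0 by [].
  apply/funext => j; apply/eqP; rewrite eqn_leq ft0 andbT -subn_eq0 -leqn0.
  by apply: leq_trans fk; rewrite (bigD1 j) //= leq_addr.
have [f0|/forallPn[j fj0]] := boolP [forall j, f j == t0].
  by apply: (IH f) => //; rewrite big1 // => j _; rewrite (eqP (forallP f0 j)) subnn.
have [s fj] : exists s, f j = s.+1.
  by exists (f j).-1; rewrite prednK // (leq_trans _ (ft0 j)).
have st0 : (t0 <= s)%N by rewrite -ltnS -fj ltn_neqAle eq_sym fj0 ft0.
have fE : yexpo f = expo_set (yexpo f) (rshift m j) s.+1.
  by rewrite expo_set_yexpo; congr yexpo; apply/funext => i; case: eqP => // ->.
rewrite fE in cu; have [|w [gw cw wu]] := cyc_lower (v := rshift m j) (s := s) _ gu cu.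
  rewrite expo_set_yexpo; apply: cP; rewrite bideg_y /=.
  have : t0%:Z <= s%:Z by rewrite lez_nat.
  by rewrite /t0; lia.
rewrite expo_set_yexpo in cw; have [|i|w' [gw' cw' ww']] := IH _ _ _ w gw cw.
- rewrite -ltnS; apply: leq_trans fk; rewrite (bigD1 j) //= [X in (_ < X)%N](bigD1 j) //=.
  rewrite eqxx fj subSn // addSn ltnS leq_add2l; apply: leq_sum => i /negbTE ->.
  exact: leqnn.
- by case: eqP.
exists w'; split=> //; rewrite -[u](subrK w) -addrA; apply: is_coboundaryD => //.
by rewrite -fE in wu; apply: cobd_torsion wu.
Qed.

Lemma cohomology_below : exists a0 : int, forall q g (h : local_cohomology I q),
  g.1 < a0 -> gm_comp g h -> h = 0.
Proof.
have [a0 a0P] := acyclic_y_below; exists a0 => q g h ga [u gu ->].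
rewrite -(quo_pi0 _); apply/quo_eqP; rewrite subr0.
have [/torsion_kill[t ku] du] : is_cocycle (val u : I q) by apply/asboolP/(valP u).
exact/(@cobd_torsion (fun=> t))/(a0P t q g).
Qed.

Lemma cohomology_finite_dim q g : exists s : seq (local_cohomology I q),
  forall h, gm_comp g h -> kspan s h.
Proof.
have [t0 t0P] := cyc_stable q g.
have [||||s0 [s0Z s0P]] := @fg_finite_dim K m n (I q) (@cyc _ _ _ _ I (yexpo (fun=> t0)) q)
  (@cobd _ _ _ _ I (yexpo (fun=> t0)) q) _ _ g.
- by move=> h u; apply: cyc_gproj.
- by move=> h u; apply: cobd_gproj.
- by move=> t u; apply: (submodZ (@cyc_submodule _ _ _ _ I _ q)).
- exact: ext_fg.
(* The default 0 is never taken on [s0], whose members are cocycles. *)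
pose lift (v : I q) : cocycles I q := insubd 0 v.
have liftE v : v \in s0 -> val (lift v) = v.
  move=> /s0Z[kv dv]; rewrite /lift val_insubd ifT //; apply/asboolP; split=> //.
  by apply/torsion_kill; exists t0.
pose cls (v : I q) : local_cohomology I q := quo_pi _ (lift v).
exists (undup [seq cls v | v <- s0]) => h [u gu ->].
have cu : is_cocycle (val u : I q) by apply/asboolP/(valP u).
have [w [gw cw uw]] := t0P _ gu cu.
have [w' [c w'E] ww'] := s0P w cw gw.
suff -> : quo_pi _ u = \sum_(v <- s0) (c v)%:MP *: cls v.
  rewrite big_seq; elim/big_ind: _ => [||v vs]; [exact: kspan0|exact: kspanD|].
  by apply: kspanZ; rewrite ?undup_uniq // mem_undup map_f.
transitivity (quo_pi (GradedSubmodule (coboundary0 I q) (@coboundaryP _ _ _ _ I q)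
  (@coboundary_homog _ _ _ _ I q)) (\sum_(v <- s0) (c v)%:MP *: lift v)).
  apply/quo_eqP; rewrite /= /coboundary raddfB raddf_sum /=.
  rewrite (eq_big_seq (fun v => (c v)%:MP *: v)) -?w'E; last first.
    by move=> v vs; congr (_ *: _); apply: liftE.
  rewrite -[val u](subrK w) -addrA; apply: is_coboundaryD => //.
  exact: cobd_torsion ww'.
by rewrite quo_pi_sum; apply: eq_bigr => v _; rewrite quo_piZ.
Qed.

(** This is the hypothesis of [kvanish_divisible] for Gamma_Q(I^p). The variable with index [r]
    carries no power in [xyexpo r], so dividing by it loses no annihilator of [u]. *)
Lemma torsion_divide p r (hr : (r < m)%N) g (u : I p) :
  gm_comp ((1, 0) + g) u -> torsionQ u ->
  (forall i : 'I_m, (i < r)%N -> xvar K n i *: u = 0) ->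
  exists w, [/\ gm_comp g w, torsionQ w,
    forall i : 'I_m, (i < r)%N -> xvar K n i *: w = 0 & xvar K n (Ordinal hr) *: w = u].
Proof.
move=> gu /torsion_kill[t yu] xu.
have ku : kill (xyexpo r (Some t)) u by apply/kill_xyexpo.
have gu' : gm_comp (bideg (U_(lshift n (Ordinal hr)) *+ 1)%MM + g) u by rewrite bideg_x.
have [w [gw kw wE]] := kill_divide_homogeneous (@ir_inj _ _ _ _ I p) gu' ku.
rewrite expo_bump_none in kw; last by rewrite /xyexpo split_lshift /= ltnn.
have [xw yw] := (kill_xyexpo w r t).1 kw.
exists w; split=> //; first by apply/torsion_kill; exists t.
Qed.

Lemma xkilled_exact : exists b : int, forall g, b < g.1 ->
  (forall u : I 0, gm_comp g u -> torsionQ u -> (forall i, xvar K n i *: u = 0) ->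
    d 0 u = 0 -> u = 0) /\
  (forall p (u : I p.+1), gm_comp g u -> torsionQ u -> (forall i, xvar K n i *: u = 0) ->
    d p.+1 u = 0 -> exists w : I p, [/\ gm_comp g w, torsionQ w,
      forall i, xvar K n i *: w = 0 & u = d p w]).
Proof.
have [b bP] := acyclic_xy_bound; exists b => g bg.
split=> [u gu /torsion_kill[t yu] xu du|p u gu /torsion_kill[t yu] xu du].
  by apply: (bP t 0 g bg u gu); split=> //; apply/kill_xyexpo.
have cu : cyc (xyexpo m (Some t)) u by split=> //; apply/kill_xyexpo.
have [w [gw /kill_xyexpo[xw yw] wE]] := cobd_homogeneous gu (bP t p.+1 g bg u gu cu).
exists w; split=> // [|i]; last exact: xw.
by apply/torsion_kill; exists t.
Qed.

End TorsionComplex.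

(** * Koszul complexes *)

Section Koszul.
Variables (R : comNzRingType) (V : lmodType R) (x : nat -> R).

(* The Koszul complex of x_0, ..., x_(r-1) with values in V, as an iterated mapping
   cone; all cohomological degrees are put together in V^(2^r). *)
Fixpoint kos (r : nat) : lmodType R :=
  match r with 0 => V | r'.+1 => (kos r' * kos r')%type end.

Fixpoint kdiff r : kos r -> kos r :=
  match r return kos r -> kos r with
  | 0 => fun=> 0
  | r'.+1 => fun u => (kdiff u.1, x r' *: u.1 - kdiff u.2)
  end.

Lemma kdiff_linear r : linear (@kdiff r).
Proof.
elim: r => [|r IH] a u v /=; first by rewrite scaler0 addr0.
congr pair; first exact: IH.
by rewrite IH scalerDr scalerA mulrC -scalerA opprD addrACA -scalerN -scalerDr.
Qed.
HB.instance Definition _ r := GRing.isLinear.Build R (kos r) (kos r) _ (@kdiff r) (@kdiff_linear r).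

Lemma kdiffK r (u : kos r) : kdiff (kdiff u) = 0.
Proof.
elim: r u => [|r IH] u //=; rewrite !IH linearB /= linearZ /= IH subr0 subrr.
by [].
Qed.

(* P k is the component of degree k of a graded submodule of V. *)
Variable P : int -> V -> Prop.
Hypothesis P0 : forall k, P k 0.
Hypothesis PB : forall k u v, P k u -> P k v -> P k (u - v).
Hypothesis PX : forall k i u, P k u -> P (k + 1) (x i *: u).

(* Cochains of cohomological degree i and internal degree k. *)
Fixpoint kmem r (i : nat) (k : int) : kos r -> Prop :=
  match r return kos r -> Prop with
  | 0 => fun u => if i == 0 then P k u else u = 0
  | r'.+1 => fun u => kmem i k u.1 /\
      (if i is i'.+1 then kmem i' (k + 1) u.2 else u.2 = 0)
  end.

Definition kbdry r i k (u : kos r) :=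
  if i is i'.+1 then exists2 w, kmem i' k w & u = kdiff w else u = 0.

Definition kvanish r i k := forall u : kos r, kmem i k u -> kdiff u = 0 -> kbdry i k u.

Lemma kmem0 r i k : @kmem r i k 0.
Proof.
elim: r i k => [|r IH] i k /=; first by case: eqP.
by split; [apply: IH|case: i => // i; apply: IH].
Qed.

Lemma kmemB r i k (u v : kos r) : kmem i k u -> kmem i k v -> kmem i k (u - v).
Proof.
elim: r i k u v => [|r IH] i k u v /=.
  by case: eqP => [_|_ -> ->]; [apply: PB|rewrite subrr].
move=> [u1 u2] [v1 v2]; split; first exact: IH.
by case: i u1 u2 v1 v2 => [|i] _ u2 _ v2; [rewrite u2 v2 subrr|apply: IH].
Qed.

Lemma kmemN r i k (u : kos r) : kmem i k u -> kmem i k (- u).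
Proof. by move=> ku; rewrite -sub0r; apply: kmemB => //; apply: kmem0. Qed.

Lemma kmemD r i k (u v : kos r) : kmem i k u -> kmem i k v -> kmem i k (u + v).
Proof. by move=> ku kv; rewrite -[v]opprK; apply/kmemB/kmemN. Qed.

Lemma kmemX r i j k (u : kos r) : kmem i k u -> kmem i (k + 1) (x j *: u).
Proof.
elim: r i k u => [|r IH] i k u /=.
  by case: eqP => [_|_ ->]; [apply: PX|rewrite scaler0].
move=> [u1 u2]; split; first exact: IH.
by case: i u1 u2 => [|i] _ u2; [rewrite u2 scaler0|apply: IH].
Qed.

Lemma kmem_diff r i k (u : kos r) : kmem i k u -> kmem i.+1 k (kdiff u).
Proof.
elim: r i k u => [|r IH] i k u //= [u1 u2]; split; first exact: IH.
apply: kmemB; first exact: kmemX.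
by case: i u1 u2 => [|i] _ u2; [rewrite u2 linear0; apply: kmem0|apply: IH].
Qed.

Lemma kmem_large r i k (u : kos r) : (r < i)%N -> kmem i k u -> u = 0.
Proof.
elim: r i k u => [|r IH] i k u /=; first by case: i.
case: i => // i; rewrite ltnS => ri [u1 u2]; rewrite [u]surjective_pairing.
by rewrite (IH _ _ _ (leqW ri) u1) (IH _ _ _ ri u2).
Qed.

Lemma kmem_zero r i k (u : kos r) : (forall k v, P k v -> v = 0) -> kmem i k u -> u = 0.
Proof.
move=> Pz; elim: r i k u => [|r IH] i k u /=; first by case: eqP => // _ /Pz.
move=> [u1 u2]; rewrite [u]surjective_pairing (IH _ _ _ u1); congr pair.
by case: i u1 u2 => [|i] _ u2 //; apply: IH u2.
Qed.

(* The copies of V in cohomological degrees 0 and r. *)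
Fixpoint kbot r (v : V) : kos r := match r with 0 => v | r'.+1 => (kbot r' v, 0) end.
Fixpoint ktop r (v : V) : kos r := match r with 0 => v | r'.+1 => (0, ktop r' v) end.

Lemma kbot_linear r : linear (kbot r).
Proof.
elim: r => [|r IH] a u v //=; rewrite IH.
by rewrite -[RHS]/(a *: kbot r u + kbot r v, a *: 0 + 0) scaler0 addr0.
Qed.
HB.instance Definition _ r := GRing.isLinear.Build R V (kos r) _ (kbot r) (@kbot_linear r).

Lemma ktop_linear r : linear (ktop r).
Proof.
elim: r => [|r IH] a u v //=; rewrite IH.
by rewrite -[RHS]/(a *: 0 + 0, a *: ktop r u + ktop r v) scaler0 addr0.
Qed.
HB.instance Definition _ r := GRing.isLinear.Build R V (kos r) _ (ktop r) (@ktop_linear r).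

Lemma kmem_bot r k (u : kos r) : kmem 0 k u <-> exists2 v, P k v & u = kbot r v.
Proof.
elim: r k u => [|r IH] k u /=; first by split=> [Pu|[v Pv ->] //]; exists u.
split=> [[/IH[v Pv u1] u2]|[v Pv ->]]; first by exists v; rewrite // [u]surjective_pairing u1 u2.
by split=> //; apply/IH; exists v.
Qed.

Lemma kdiff_bot r v : kdiff (kbot r v) = 0 <-> forall i, (i < r)%N -> x i *: v = 0.
Proof.
have inj r' : injective (kbot r') by elim: r' => // r' IH u w [/IH].
elim: r => [|r IH] /=; first by split.
rewrite linear0 subr0; split=> [[dv xv] i|xv].
  rewrite ltnS leq_eqVlt => /predU1P[->|]; last exact: IH.1.
  by apply: (inj r); rewrite linearZ linear0.
congr pair; first by apply/IH => i ir; apply/xv/ltnW.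
by rewrite -linearZ /= xv // linear0.
Qed.

Lemma kmem_top r k (u : kos r) : kmem r k u <-> exists2 v, P (k + r%:Z) v & u = ktop r v.
Proof.
elim: r k u => [|r IH] k u /=.
  by rewrite addr0; split=> [Pu|[v Pv ->] //]; exists u.
have kE : k + 1 + r%:Z = k + r.+1%:Z by rewrite -addrA -PoszD.
split=> [[u1 /IH[v Pv u2]]|[v Pv ->]].
  by exists v; rewrite -?kE // [u]surjective_pairing u2 (kmem_large _ u1).
by split; [apply: kmem0|apply/IH; exists v; rewrite ?kE].
Qed.

Lemma kdiff_top r v : kdiff (ktop r v) = 0.
Proof. by elim: r => //= r ->; rewrite linear0 scaler0 subr0. Qed.

Definition xspan r k (v : V) := exists2 w : nat -> V,
  forall i, (i < r)%N -> P k (w i) & v = \sum_(i < r) x i *: w i.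

Lemma xspanS r k v : xspan r.+1 k v <-> exists2 w, P k w & xspan r k (v - x r *: w).
Proof.
split=> [[w wP ->]|[w0 Pw0 [w wP wE]]].
  exists (w r); first exact: wP.
  by exists w => [i ir|]; [apply/wP/ltnW|rewrite big_ord_recr addrK].
exists (fun i => if i == r then w0 else w i) => [i|].
  by rewrite ltnS leq_eqVlt; case: eqP => //= _; apply: wP.
rewrite big_ord_recr /= eqxx -[v](subrK (x r *: w0)) wE; congr (_ + _).
by apply: eq_bigr => i _; rewrite ltn_eqF.
Qed.

(** Top Koszul cohomology is V / (x_0, ..., x_(r-1)) V. Each of the [r] cones shifts the internal
    degree by one, and the coefficients lie one degree below. *)
Lemma kbdry_top r k v : kbdry r k (ktop r v) <-> xspan r (k + r%:Z - 1) v.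
Proof.
elim: r k v => [|r IH] k v.
  split=> /= [->|[w _ ->]]; last by rewrite big_ord0.
  by exists (fun=> 0); rewrite ?big_ord0.
have kE : k + r.+1%:Z - 1 = k + 1 + r%:Z - 1 by rewrite -[r.+1]addn1 PoszD addrA addrAC.
have kE' : k + r.+1%:Z - 1 = k + r%:Z by rewrite -[r.+1]addn1 PoszD addrA addrK.
split=> [[[w1 w2] /= [/kmem_top[v1 Pv1 ->] kw2] [_]]|].
  rewrite -linearZ /= => vE; apply/xspanS; exists v1; first by rewrite kE'.
  rewrite kE; apply/IH; rewrite linearB /= vE addrAC subrr add0r.
  clear - P0 PB kw2; case: r w2 kw2 => [|r] w2 kw2; first exact: oppr0.
  by exists (- w2); [apply: kmemN|rewrite linearN].
move=> /xspanS[v1 Pv1]; rewrite kE => /IH; rewrite linearB => bd.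
have [w2 kw2 w2E] : exists2 w2 : kos r,
    (if r is r'.+1 then kmem r' (k + 1) w2 else w2 = 0) & ktop r v - ktop r (x r *: v1) = kdiff w2.
  case: r {IH kE kE' Pv1} bd => [|r] bd; last by have [w2] := bd; exists w2.
  by exists 0; rewrite ?linear0.
exists (ktop r v1, - w2) => /=.
  split; first by apply/kmem_top; exists v1; rewrite -?kE'.
  by case: r {IH kE kE' Pv1 bd} w2 kw2 w2E => [|r] w2 kw2 w2E; [rewrite kw2 oppr0|apply: kmemN].
by rewrite kdiff_top linearN /= -w2E opprK -linearZ /= addrC subrK.
Qed.

(** Exactness for the mapping cone: if u.1 = d w, subtracting d (w, 0) leaves a cocycle in the
    second factor, of cohomological degree [i] and internal degree k + 1. *)
Lemma kbdry_cone r i k (u : kos r.+1) : kmem i.+1 k u -> kdiff u = 0 ->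
  kbdry i.+1 k u.1 -> kvanish r i (k + 1) -> kbdry i.+1 k u.
Proof.
case: u => u1 u2 /= [ku1 ku2] [du1 du2] [w kw u1E] van.
have [w2 kw2 w2E] : exists2 w2 : kos r,
    (if i is i'.+1 then kmem i' (k + 1) w2 else w2 = 0) & u2 - x r *: w = kdiff w2.
  have /van : kmem i (k + 1) (u2 - x r *: w) by apply: kmemB => //; apply: kmemX.
  have -> : kdiff (u2 - x r *: w) = 0.
    by rewrite linearB linearZ /= -u1E; apply/eqP; rewrite -oppr_eq0 opprB du2.
  move=> /(_ erefl); case: (i) => [|i'] /=; first by move=> ->; exists 0; rewrite ?linear0.
  by case=> w2; exists w2.
exists (w, - w2) => /=.
  split=> //; case: (i) kw2 => [|i'] kw2; [by rewrite kw2 oppr0|exact: kmemN].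
by rewrite -u1E linearN /= opprK -w2E addrC subrK.
Qed.

(** The dual of a regular sequence: each x_s is surjective on what the earlier ones kill, so
    cohomology survives in degree 0 only. The delicate case is degree 1, where the second factor of
    the cone has degree 0; there the remaining cocycle is [v], killed by the earlier x_i, and is
    removed by dividing it by x_r. *)
Lemma kvanish_divisible r i k :
  (forall s k v, (s < r)%N -> P (k + 1) v -> (forall i, (i < s)%N -> x i *: v = 0) ->
    exists w, [/\ P k w, forall i, (i < s)%N -> x i *: w = 0 & x s *: w = v]) ->
  kvanish r i.+1 k.
Proof.
elim: r i k => [|r IH] i k div u; first by exists 0; [apply: kmem0|].
have {}IH i' k' := IH i' k' (fun s k v sr => div s k v (leqW sr)).
move=> ku du; have bd1 : kbdry i.+1 k u.1.
  by apply: IH; [case: ku|case: du].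
case: i ku bd1 => [|i] ku bd1; last by apply: kbdry_cone bd1 _.
case: u ku du bd1 => u1 u2 /= [ku1 ku2] [du1 du2] [w kw wE].
have : kmem 0 (k + 1) (u2 - x r *: w) by apply: kmemB => //; apply: kmemX.
have dz : kdiff (u2 - x r *: w) = 0.
  by rewrite linearB linearZ /= -wE; apply/eqP; rewrite -oppr_eq0 opprB du2.
move=> /kmem_bot[v Pv vE]; rewrite vE in dz; move/kdiff_bot in dz.
have [v' [Pv' xv' v'E]] := div r k v (ltnSn _) Pv dz.
exists (w + kbot r v', 0) => /=.
  by split=> //; apply: kmemD => //; apply/kmem_bot; exists v'.
have dv' : kdiff (kbot r v') = 0 by apply/kdiff_bot.
rewrite linearD /= dv' addr0 -wE linear0 subr0 scalerDr.
by rewrite -linearZ /= v'E -vE addrC subrK.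
Qed.

(** For a regular sequence only the top degree survives. The delicate case is i = r, where the first
    factor of the cone is in its own top degree; regularity of x_r modulo the earlier ones shows
    that it is a boundary. *)
Lemma kvanish_regular r i k :
  (forall s k v, (s < r)%N -> P k v -> xspan s k (x s *: v) -> xspan s (k - 1) v) ->
  (i < r)%N -> kvanish r i k.
Proof.
elim: r i k => // r IH i k reg ir u ku du.
have {}IH i' k' := IH i' k' (fun s k v sr => reg s k v (leqW sr)).
have bd1 : kbdry i k u.1.
  move: ir; rewrite ltnS leq_eqVlt => /predU1P[iE|ir]; last by apply: IH => //; [case: ku|case: du].
  case: u ku du; rewrite {}iE => u1 u2 /= [/kmem_top[v Pv ->] ku2] [_ /eqP].
  rewrite subr_eq0 -linearZ => /eqP u2E; apply/kbdry_top/reg => //.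
  have -> : k + r%:Z = k + 1 + r%:Z - 1 by rewrite addrAC addrK.
  apply/kbdry_top; rewrite u2E; case: (r) u2 ku2 {u2E} => [|r'] u2 /= ku2; first by [].
  by exists u2.
case: i ir ku bd1 => [|i] ir ku bd1; last by apply: kbdry_cone bd1 _ => //; apply: IH.
by case: u ku du bd1 => u1 u2 /= [_ ->] _ ->.
Qed.

End Koszul.

(** * The long exact sequence of Koszul cohomology *)

Section KoszulMap.
Variables (R R' : comNzRingType) (V : lmodType R) (V' : lmodType R').
Variables (x : nat -> R) (x' : nat -> R') (f : V -> V').
Hypothesis fB : forall u v, f (u - v) = f u - f v.
Hypothesis fX : forall i u, f (x i *: u) = x' i *: f u.

Fixpoint kmap r : kos V r -> kos V' r :=
  match r return kos V r -> kos V' r with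
  | 0 => f
  | r'.+1 => fun u => (kmap u.1, kmap u.2)
  end.

Lemma kmapB r (u v : kos V r) : kmap (u - v) = kmap u - kmap v.
Proof. by elim: r u v => [|r IH] u v //=; rewrite !IH. Qed.

Lemma kmap0 r : kmap (0 : kos V r) = 0.
Proof. by rewrite -(subrr 0) kmapB subrr. Qed.

Lemma kmapX r i (u : kos V r) : kmap (x i *: u) = x' i *: kmap u.
Proof. by elim: r u => [|r IH] u //=; rewrite !IH. Qed.

Lemma kmap_diff r (u : kos V r) : kmap (kdiff x u) = kdiff x' (kmap u).
Proof.
elim: r u => [|r IH] u /=; first by rewrite -(subrr 0) fB subrr.
by rewrite kmapB kmapX !IH.
Qed.

Lemma kmap_bot r v : kmap (kbot r v) = kbot r (f v).
Proof. by elim: r => //= r ->; rewrite kmap0. Qed.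

Lemma kmem_map (P : int -> V -> Prop) (P' : int -> V' -> Prop) r i k (u : kos V r) :
  (forall k u, P k u -> P' k (f u)) -> kmem P i k u -> kmem P' i k (kmap u).
Proof.
move=> PP'; elim: r i k u => [|r IH] i k u /=.
  by case: eqP => [_|_ ->]; [apply: PP'|rewrite -(subrr 0) fB subrr].
move=> [u1 u2]; split; first exact: IH.
by case: i u1 u2 => [|i] _ u2; [rewrite u2 kmap0|apply: IH].
Qed.

End KoszulMap.

Definition kfamily (R : comNzRingType) (V : lmodType R) (x : nat -> R)
    (P : int -> V -> Prop) :=
  [/\ forall k, P k 0, forall k u v, P k u -> P k v -> P k (u - v)
    & forall k i u, P k u -> P (k + 1) (x i *: u)].

(* f and g need only be semilinear with respect to the x_i: the rings may differ. *)
Record kexact (RA RB RC : comNzRingType) (A : lmodType RA) (B : lmodType RB)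
    (C : lmodType RC) (xA : nat -> RA) (xB : nat -> RB) (xC : nat -> RC)
    (f : A -> B) (g : B -> C)
    (PA : int -> A -> Prop) (PB : int -> B -> Prop) (PC : int -> C -> Prop) := KExact {
  ke_familyA : kfamily xA PA;
  ke_familyB : kfamily xB PB;
  ke_fB : forall u v, f (u - v) = f u - f v;
  ke_fX : forall i u, f (xA i *: u) = xB i *: f u;
  ke_gB : forall u v, g (u - v) = g u - g v;
  ke_gX : forall i u, g (xB i *: u) = xC i *: g u;
  ke_fP : forall k a, PA k a -> PB k (f a);
  ke_gP : forall k b, PB k b -> PC k (g b);
  ke_inj : forall k a, PA k a -> f a = 0 -> a = 0;
  ke_gf : forall k a, PA k a -> g (f a) = 0;
  ke_ker : forall k b, PB k b -> g b = 0 -> exists2 a, PA k a & f a = b;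
  ke_surj : forall k c, PC k c -> exists2 b, PB k b & g b = c }.

Section KoszulExact.
Variables (RA RB RC : comNzRingType) (A : lmodType RA) (B : lmodType RB) (C : lmodType RC).
Variables (xA : nat -> RA) (xB : nat -> RB) (xC : nat -> RC) (f : A -> B) (g : B -> C).
Variables (PA : int -> A -> Prop) (PB : int -> B -> Prop) (PC : int -> C -> Prop).
Hypothesis ABC : kexact xA xB xC f g PA PB PC.

Let PA0 k : PA k 0. Proof. by case: (ke_familyA ABC). Qed.
Let PAB k u v : PA k u -> PA k v -> PA k (u - v). Proof. by case: (ke_familyA ABC) => _ + _; apply. Qed.
Let PAX k i u : PA k u -> PA (k + 1) (xA i *: u). Proof. by case: (ke_familyA ABC) => _ _; apply. Qed.
Let PB0 k : PB k 0. Proof. by case: (ke_familyB ABC). Qed.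
Let PBB k u v : PB k u -> PB k v -> PB k (u - v). Proof. by case: (ke_familyB ABC) => _ + _; apply. Qed.
Let PBX k i u : PB k u -> PB (k + 1) (xB i *: u). Proof. by case: (ke_familyB ABC) => _ _; apply. Qed.
Let fB := ke_fB ABC.
Let fX := ke_fX ABC.
Let gB := ke_gB ABC.
Let gX := ke_gX ABC.
Let fP := ke_fP ABC.
Let gP := ke_gP ABC.
Let f_inj := ke_inj ABC.
Let gf0 := ke_gf ABC.
Let exact := ke_ker ABC.
Let g_surj := ke_surj ABC.

Local Notation fk := (kmap f).
Local Notation gk := (kmap g).

Lemma kmap_inj r i k (a : kos A r) : kmem PA i k a -> fk a = 0 -> a = 0.
Proof.
elim: r i k a => [|r IH] i k a /=; first by case: eqP => // _; apply: f_inj.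
move=> [a1 a2] fa; rewrite [a]surjective_pairing; move: fa => [fa1 fa2].
rewrite (IH _ _ _ a1 fa1); congr pair.
by case: i a1 a2 => [|i] _ a2 //; apply: IH a2 fa2.
Qed.

Lemma kmap_comp0 r i k (a : kos A r) : kmem PA i k a -> gk (fk a) = 0.
Proof.
elim: r i k a => [|r IH] i k a /=.
  by case: eqP => [_|_ ->]; [apply: gf0|apply: gf0 (PA0 0)].
move=> [a1 a2]; rewrite (IH _ _ _ a1); suff -> : gk (fk a.2) = 0 by [].
by case: i a1 a2 => [|i] _ a2; [rewrite a2 (kmap0 fB) (kmap0 gB)|apply: IH a2].
Qed.

Lemma kmap_exact r i k (b : kos B r) : kmem PB i k b -> gk b = 0 ->
  exists2 a, kmem PA i k a & fk a = b.
Proof.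
elim: r i k b => [|r IH] i k b /=.
  case: eqP => [_|_ ->]; first exact: exact.
  by exists 0; rewrite // -(subrr 0) fB subrr.
move=> [b1 b2] [gb1 gb2]; have [a1 ka1 a1E] := IH _ _ _ b1 gb1.
case: i b1 b2 ka1 => [|i] b1 b2 ka1.
  by exists (a1, 0) => //=; rewrite a1E (kmap0 fB) -b2 -surjective_pairing.
have [a2 ka2 a2E] := IH _ _ _ b2 gb2.
by exists (a1, a2) => //=; rewrite a1E a2E -surjective_pairing.
Qed.

Lemma kmap_surj r i k (c : kos C r) : kmem PC i k c -> exists2 b, kmem PB i k b & gk b = c.
Proof.
elim: r i k c => [|r IH] i k c /=.
  case: eqP => [_|_ ->]; first exact: g_surj.
  by exists 0; rewrite // -(subrr 0) gB subrr.
move=> [c1 c2]; have [b1 kb1 b1E] := IH _ _ _ c1.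
case: i c1 c2 kb1 => [|i] c1 c2 kb1.
  by exists (b1, 0) => //=; rewrite b1E (kmap0 gB) -c2 -surjective_pairing.
have [b2 kb2 b2E] := IH _ _ _ c2.
by exists (b1, b2) => //=; rewrite b1E b2E -surjective_pairing.
Qed.

(** Surjectivity of H^i(B) -> H^i(C) on the level of cocycles, that is, vanishing of the connecting
    map to H^(i+1)(A); this cuts the long exact sequence without defining that map. *)
Definition kliftable r i k := forall c : kos C r, kmem PC i k c -> kdiff xC c = 0 ->
  exists b, [/\ kmem PB i k b, kdiff xB b = 0 & gk b = c].

Lemma kliftable_left r i k : kvanish xA PA r i.+1 k -> kliftable r i k.
Proof.
move=> van c kc dc; have [b kb bE] := kmap_surj kc.
have [|a ka aE] := kmap_exact (kmem_diff PB0 PBB PBX kb).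
  by rewrite (kmap_diff gB gX) bE dc.
have da : kdiff xA a = 0.
  apply: (@kmap_inj _ i.+2 k); first exact: kmem_diff.
  by rewrite (kmap_diff fB fX) aE kdiffK.
have [a' ka' a'E] := van a ka da.
exists (b - fk a'); split.
- by apply: kmemB => //; apply: kmem_map ka'.
- by rewrite linearB /= -aE a'E (kmap_diff fB fX) subrr.
- by rewrite (kmapB gB) bE (kmap_comp0 ka') subr0.
Qed.

Lemma kliftable_right r i k : kvanish xC PC r i k -> kliftable r i k.
Proof.
case: i => [|i] van c kc dc.
  by exists 0; rewrite (van c kc dc) linear0 (kmap0 gB); split=> //; apply: kmem0.
have [c' kc' c'E] := van c kc dc; have [b' kb' b'E] := kmap_surj kc'.
exists (kdiff xB b'); split; [exact: kmem_diff|exact: kdiffK|].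
by rewrite (kmap_diff gB gX) b'E c'E.
Qed.

Lemma kvanish_right r i k : kliftable r i k -> kvanish xB PB r i k -> kvanish xC PC r i k.
Proof.
move=> lif van c kc dc; have [b [kb db <-]] := lif c kc dc.
have := van b kb db; case: (i) => [|i'] /=; first by move=> ->; rewrite (kmap0 gB).
case=> w kw ->; exists (gk w); last exact: kmap_diff.
exact: kmem_map kw.
Qed.

Lemma kvanish_left0 r k : kvanish xB PB r 0 k -> kvanish xA PA r 0 k.
Proof.
move=> van a ka da; apply: (kmap_inj ka); apply: van; first exact: kmem_map ka.
by rewrite -(kmap_diff fB fX) da (kmap0 fB).
Qed.

Lemma kvanish_left r i k : kliftable r i k -> kvanish xB PB r i.+1 k ->
  kvanish xA PA r i.+1 k.
Proof.
move=> lif van a ka da.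
have [||b kb bE] := van (fk a); first exact: kmem_map ka.
  by rewrite -(kmap_diff fB fX) da (kmap0 fB).
have [||b' [kb' db' b'E]] := lif (gk b); first exact: kmem_map kb.
  by rewrite -(kmap_diff gB gX) -bE (kmap_comp0 ka).
have [||a' ka' a'E] := @kmap_exact r i k (b - b'); first exact: kmemB.
  by rewrite (kmapB gB) b'E subrr.
exists a' => //; apply/eqP; rewrite -subr_eq0; apply/eqP.
apply: (@kmap_inj _ i.+1 k); first by apply: kmemB => //; apply: kmem_diff.
by rewrite (kmapB fB) (kmap_diff fB fX) a'E linearB /= db' subr0 bE subrr.
Qed.

End KoszulExact.

(** An isomorphism of families is an exact sequence whose third family is zero. The two rings may
    differ, as they do for a row and the bigraded module containing it. *)
Lemma kvanish_iso (RA RB : comNzRingType) (A : lmodType RA) (B : lmodType RB)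
    (xA : nat -> RA) (xB : nat -> RB) (f : A -> B)
    (PA : int -> A -> Prop) (PB : int -> B -> Prop) r i k :
  (forall u v, f (u - v) = f u - f v) -> (forall i u, f (xA i *: u) = xB i *: f u) ->
  injective f -> (forall k a, PA k a <-> PB k (f a)) ->
  (forall k b, PB k b -> exists a, f a = b) -> kfamily xB PB ->
  kvanish xB PB r i k -> kvanish xA PA r i k.
Proof.
move=> fB fX f_inj PAB f_surj FB van; have [PB0 PBB PBX] := FB.
have f0 : f 0 = 0 by rewrite -(subrr 0) fB subrr.
have ABC : kexact xA xB xB f (fun=> 0 : B) PA PB (fun _ c => c = 0).
  split=> //.
  - split=> [j|j u v /PAB Pu /PAB Pv|j l u /PAB Pu]; apply/PAB; rewrite ?f0 ?fB ?fX //.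
      exact: PBB.
    exact: PBX.
  - by move=> u v; rewrite subrr.
  - by move=> l u; rewrite scaler0.
  - by move=> j a /PAB.
  - by move=> j a _ fa; apply: f_inj; rewrite fa f0.
  - by move=> j b Pb _; have [a aE] := f_surj j b Pb; exists a; rewrite // PAB aE.
  - by move=> j c ->; exists 0.
case: i van => [|i] van; first exact: (kvanish_left0 ABC van).
apply: (kvanish_left ABC _ van) => c kc _.
rewrite (kmem_zero _ kc) => [|//]; exists 0.
by rewrite linear0 (kmap0 (ke_gB ABC)); split=> //; apply: kmem0.
Qed.

(** * Koszul cohomology of local cohomology *)

Section CohomologyKoszul.
Variables (K : fieldType) (m n : nat) (M : bigradedModule K m n).
Variables (I : injective_resolution M) (q : nat).
Hypothesis fgM : finitely_generated M.
Hypothesis cohomology_zero : forall p, p <> q -> is_zero (local_cohomology I p).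
Local Notation S := {mpoly K[m + n]}.
Local Notation Kx := {mpoly K[m]}.
Local Notation d := (ir_diff I).

(** [kos] takes a sequence indexed by [nat]; the value 0 beyond [m] keeps the conditions of
    [kfamily] true for every index. *)
Definition xseq (i : nat) : S := if insub i is Some i' then xvar K n (i' : 'I_m) else 0.
Definition kxseq (i : nat) : Kx := if insub i is Some i' then 'X_(i' : 'I_m) else 0.

Lemma xseq_ord (i : 'I_m) : xseq i = xvar K n i.
Proof. by rewrite /xseq valK. Qed.

Lemma kxseq_ord (i : 'I_m) : kxseq i = 'X_i.
Proof. by rewrite /kxseq valK. Qed.

Lemma xincl_kxseq i : xincl n (kxseq i) = xseq i.
Proof.
rewrite /kxseq /xseq /xincl; case: insubP => [i' _ _|_]; last by rewrite comp_mpoly0.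
by rewrite comp_mpolyXU -tnth_nth tnth_mktuple.
Qed.

Lemma bihom_xseq i : bihom (1, 0) (xseq i).
Proof.
rewrite /xseq; case: insubP => [i' _ _|_]; first exact: bihom_x.
by move=> t; rewrite msupp0.
Qed.

Lemma xhom_kxseq i : xhom 1 (kxseq i).
Proof.
rewrite /kxseq; case: insubP => [i' _ _|_ t]; last by rewrite msupp0.
by move=> t; rewrite msuppX inE => /eqP ->; rewrite mdeg1.
Qed.

Variable j : int.

Lemma xseq_comp (J : bigradedModule K m n) k i (u : J) :
  gm_comp (k, j) u -> gm_comp (k + 1, j) (xseq i *: u).
Proof.
move=> ku; have -> : (k + 1, j) = ((1, 0) + (k, j) : int * int).
  by apply/pair_equal_spec; rewrite /= addrC add0r.
by apply: gm_compZ ku; apply: bihom_xseq.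
Qed.

Lemma torsionQZ (J : lmodType S) a (u : J) : torsionQ u -> torsionQ (a *: u).
Proof. by move=> tu; rewrite -[_ *: _]addr0; apply: torsionQP => //; apply: torsionQ0. Qed.

Lemma torsionQB (J : lmodType S) (u v : J) : torsionQ u -> torsionQ v -> torsionQ (u - v).
Proof. by move=> tu tv; rewrite addrC -scaleN1r; apply: torsionQP. Qed.

Lemma torsionQ_lin (J J' : lmodType S) (f : {linear J -> J'}) (u : J) :
  torsionQ u -> torsionQ (f u).
Proof. by move=> [t tu]; exists t => a aQ; rewrite -linearZ tu // linear0. Qed.

Lemma torsionQ_gproj (J : bigradedModule K m n) g (u : J) : torsionQ u -> torsionQ (gproj g u).
Proof. by move=> /torsion_kill[t tu]; apply/torsion_kill; exists t; apply: kill_gproj. Qed.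

Lemma is_coboundaryB p (u v : I p) : is_coboundary u -> is_coboundary v -> is_coboundary (u - v).
Proof. by move=> cu cv; rewrite addrC -scaleN1r; apply: is_coboundaryP. Qed.

Lemma is_coboundaryZ p a (u : I p) : is_coboundary u -> is_coboundary (a *: u).
Proof. by move=> cu; rewrite -[_ *: _]addr0; apply: is_coboundaryP => //; apply: is_coboundary0. Qed.

Lemma coboundary_cocycle p (u : I p) : is_coboundary u -> is_cocycle u.
Proof.
case: p u => [|p] u /=; first by move=> ->; apply: is_cocycle0.
by move=> [w tw ->]; split; [apply: torsionQ_lin|apply: ir_diffK].
Qed.

Lemma is_coboundary_lift p g (u : I p.+1) : gm_comp g u -> is_coboundary u ->
  exists w : I p, [/\ gm_comp g w, torsionQ w & d p w = u].
Proof.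
move=> gu [w tw uE]; exists (gproj g w); split; first exact: gproj_comp.
  exact: torsionQ_gproj.
by rewrite -gproj_hom -uE gproj_id.
Qed.

Lemma class_eq0 p (u : cocycles I p) :
  quo_pi (GradedSubmodule (coboundary0 I p) (@coboundaryP _ _ _ _ I p) (@coboundary_homog _ _ _ _ I p)) u = 0
  <-> is_coboundary (val u : I p).
Proof.
rewrite -(quo_pi0 _); split=> [/quo_eqP|cu]; first by rewrite subr0.
by apply/quo_eqP; rewrite subr0.
Qed.

Lemma cocycle_coboundary p (u : I p) : p <> q -> is_cocycle u -> is_coboundary u.
Proof.
move=> pq cu; have uP : gs_pred (GradedSubmodule (is_cocycle0 I p) (@is_cocycleP _ _ _ _ I p)
    (@is_cocycle_homog _ _ _ _ I p)) u by apply/asboolP.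
exact: (class_eq0 (Sub u uP)).1 (cohomology_zero pq _).
Qed.

Definition torsion_fam p (k : int) (u : I p) := gm_comp (k, j) u /\ torsionQ u.
Definition cocycle_fam p (k : int) (u : I p) := gm_comp (k, j) u /\ is_cocycle u.
Definition coboundary_fam p (k : int) (u : I p) := gm_comp (k, j) u /\ is_coboundary u.

Lemma torsion_family p : kfamily xseq (@torsion_fam p).
Proof.
split=> [k|k u v [ku tu] [kv tv]|k i u [ku tu]]; split.
- exact: gm_comp0.
- exact: torsionQ0.
- exact: gm_compB.
- exact: torsionQB.
- exact: xseq_comp.
- exact: torsionQZ.
Qed.

Lemma cocycle_family p : kfamily xseq (@cocycle_fam p).
Proof.
split=> [k|k u v [ku [tu du]] [kv [tv dv]]|k i u [ku [tu du]]]; split.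
- exact: gm_comp0.
- exact: is_cocycle0.
- exact: gm_compB.
- by split; [apply: torsionQB|rewrite linearB du dv subrr].
- exact: xseq_comp.
- by split; [apply: torsionQZ|rewrite linearZ /= du scaler0].
Qed.

Lemma coboundary_family p : kfamily xseq (@coboundary_fam p).
Proof.
split=> [k|k u v [ku cu] [kv cv]|k i u [ku cu]]; split.
- exact: gm_comp0.
- exact: is_coboundary0.
- exact: gm_compB.
- exact: is_coboundaryB.
- exact: xseq_comp.
- exact: is_coboundaryZ.
Qed.

(** The sequence 0 -> Z^p -> Gamma_Q(I^p) -> Z^(p+1) -> 0, surjective on the right because
    H^(p+1)_Q(M) = 0. *)
Lemma kexact_cocycle p : p.+1 <> q -> kexact xseq xseq xseq id (d p)
  (@cocycle_fam p) (@torsion_fam p) (@cocycle_fam p.+1).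
Proof.
move=> pq; split=> //.
- exact: cocycle_family.
- exact: torsion_family.
- by move=> u v; rewrite linearB.
- by move=> i u; rewrite linearZ.
- by move=> k u [ku []].
- move=> k u [ku tu]; split; first exact: gh_comp.
  by split; [apply: torsionQ_lin|apply: ir_diffK].
- by move=> k u [_ []].
- by move=> k u [ku tu] du; exists u.
- move=> k u [ku /(cocycle_coboundary pq)/(is_coboundary_lift ku)[w [kw tw dw]]].
  by exists w.
Qed.

(** The sequence 0 -> B^p -> Gamma_Q(I^p) -> B^(p+1) -> 0, exact in the middle because H^p_Q(M) = 0
    gives Z^p = B^p. *)
Lemma kexact_coboundary p : p <> q -> kexact xseq xseq xseq id (d p)
  (@coboundary_fam p) (@torsion_fam p) (@coboundary_fam p.+1).
Proof.
move=> pq; split=> //.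
- exact: coboundary_family.
- exact: torsion_family.
- by move=> u v; rewrite linearB.
- by move=> i u; rewrite linearZ.
- by move=> k u [ku /coboundary_cocycle[]].
- by move=> k u [ku tu]; split; [apply: gh_comp|exists u].
- by move=> k u [_ /coboundary_cocycle[]].
- by move=> k u [ku tu] du; exists u => //; split=> //; apply: cocycle_coboundary.
- by move=> k u [ku /(is_coboundary_lift ku)[w [kw tw dw]]]; exists w.
Qed.

Lemma torsion_vanish p i k : kvanish xseq (@torsion_fam p) m i.+1 k.
Proof.
have [F0 FB FX] := torsion_family p.
apply: kvanish_divisible => // s k' v sm [kv tv] xv.
have [||w [kw tw xw wE]] := torsion_divide sm (u := v) (g := (k', j)) _ tv.
- by rewrite (_ : _ + _ = (k' + 1, j)) //; apply/pair_equal_spec; rewrite /= addrC add0r.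
- by move=> i' si; rewrite -xseq_ord; apply: xv.
exists w; split=> // [i' is'|]; last by rewrite -wE -xseq_ord.
by rewrite (xseq_ord (Ordinal (ltn_trans is' sm))); apply: xw.
Qed.

Variable k : int.
(* The conclusion of xkilled_exact in the fixed bidegree (k, j). *)
Hypothesis exact0 : forall u : I 0, gm_comp (k, j) u -> torsionQ u ->
  (forall i, xvar K n i *: u = 0) -> d 0 u = 0 -> u = 0.
Hypothesis exactS : forall p (u : I p.+1), gm_comp (k, j) u -> torsionQ u ->
  (forall i, xvar K n i *: u = 0) -> d p.+1 u = 0 ->
  exists w : I p, [/\ gm_comp (k, j) w, torsionQ w,
    forall i, xvar K n i *: w = 0 & u = d p w].

Lemma xseq_kill (J : lmodType S) (u : J) :
  (forall i, (i < m)%N -> xseq i *: u = 0) <-> forall i, xvar K n i *: u = 0.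
Proof.
split=> xu i; first by rewrite -xseq_ord; apply: xu.
by move=> im; rewrite (xseq_ord (Ordinal im)).
Qed.

(** Dimension shifting upwards from B^0 = 0: H^(i+1)(B^(p+1)) lies between H^(i+1) of the acyclic
    middle term and H^(i+2)(B^p). *)
Lemma coboundary_vanish p i : (p <= q)%N -> kvanish xseq (@coboundary_fam p) m i.+1 k.
Proof.
elim: p i => [|p IH] i pq.
  move=> u ku _; rewrite (kmem_zero _ ku) => [|k' v [_ ->]//]; exists 0.
    by apply: kmem0 => k'; case: (coboundary_family 0).
  by rewrite linear0.
have pq' : p <> q by move=> pE; rewrite pE ltnn in pq.
apply: (kvanish_right (kexact_coboundary pq')); last exact: torsion_vanish.
by apply: (kliftable_left (kexact_coboundary pq')); apply/IH/ltnW.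
Qed.

(** H^(i+1)(Z^p) is a quotient of H^i(Z^(p+1)), so [i] falls while [p] rises. At the end a cocycle
    killed by the x_i must come from a cochain killed by the x_i, which is [exactS]. *)
Lemma cocycle_vanish p i : (q <= p)%N -> kvanish xseq (@cocycle_fam p) m i.+1 k.
Proof.
elim: i p => [|i IH] p qp.
  have pq : p.+1 <> q by move=> pE; rewrite -pE ltnn in qp.
  have E := kexact_cocycle pq.
  apply: (kvanish_left E); last exact: torsion_vanish.
  move=> c /kmem_bot[v [kv [tv dv]] ->] /kdiff_bot/xseq_kill xv.
  have [w [kw tw xw ->]] := exactS kv tv xv dv.
  exists (kbot m w); split; last by rewrite (kmap_bot (ke_gB E)).
    by apply/kmem_bot; exists w.
  exact/kdiff_bot/xseq_kill.
have pq : p.+1 <> q by move=> pE; rewrite -pE ltnn in qp.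
apply: (kvanish_left (kexact_cocycle pq)); last exact: torsion_vanish.
by apply: (kliftable_right (kexact_cocycle pq)); apply/IH/leqW.
Qed.

Lemma killed_coboundary p (u : I p) : gm_comp (k, j) u -> is_cocycle u ->
  (forall i, xvar K n i *: u = 0) -> is_coboundary u.
Proof.
case: p u => [|p] u ku [tu du] xu /=; first exact: exact0.
by have [w [_ tw _ ->]] := exactS ku tu xu du; exists w.
Qed.

Definition comp_fam (J : bigradedModule K m n) (k : int) (u : J) := gm_comp (k, j) u.

Lemma comp_family (J : bigradedModule K m n) : kfamily xseq (@comp_fam J).
Proof.
by split=> [k'|k' u v|k' i u]; [apply: gm_comp0|apply: gm_compB|apply: xseq_comp].
Qed.

Local Notation coboundaries := (GradedSubmodule (coboundary0 I q)
  (@coboundaryP _ _ _ _ I q) (@coboundary_homog _ _ _ _ I q)).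

Definition sub_coboundary_fam (k : int) (u : cocycles I q) :=
  gm_comp (k, j) u /\ is_coboundary (val u : I q).

Lemma kexact_cohomology : kexact xseq xseq xseq (id : cocycles I q -> cocycles I q)
  (quo_pi coboundaries : cocycles I q -> local_cohomology I q)
  sub_coboundary_fam (@comp_fam (cocycles I q)) (@comp_fam (local_cohomology I q)).
Proof.
split=> //.
- split=> [k'|k' u v [ku cu] [kv cv]|k' i u [ku cu]]; split.
  + exact: gm_comp0.
  + exact: is_coboundary0.
  + exact: gm_compB.
  + by rewrite linearB; apply: is_coboundaryB.
  + exact: xseq_comp.
  + by rewrite linearZ; apply: is_coboundaryZ.
- exact: comp_family.
- exact: quo_piB.
- by move=> i u; rewrite quo_piZ.
- by move=> k' u [].
- by move=> k' u ku; exists u.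
- by move=> k' u [_ /class_eq0].
- by move=> k' u ku /class_eq0 cu; exists u.
- by move=> k' _ [u ku ->]; exists u.
Qed.

(** From 0 -> B^q -> Z^q -> H^q -> 0: since H^(i+1)(B^q) = 0, Koszul cocycles of H^q lift to Z^q.
    For i > 0 the cohomology of Z^q vanishes; for i = 0 the lift is a cocycle killed by the x_i,
    hence a coboundary. *)
Lemma cohomology_vanish i : kvanish xseq (@comp_fam (local_cohomology I q)) m i k.
Proof.
have E := kexact_cohomology.
have vsurj k' (u : I q) : cocycle_fam k' u -> exists u' : cocycles I q, val u' = u.
  move=> [_ cu]; have uP : gs_pred (GradedSubmodule (is_cocycle0 I q) (@is_cocycleP _ _ _ _ I q)
    (@is_cocycle_homog _ _ _ _ I q)) u by apply/asboolP.
  by exists (Sub u uP).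
have vB (u v : cocycles I q) : val (u - v) = val u - val v :> I q by rewrite linearB.
have vX l (u : cocycles I q) : val (xseq l *: u) = xseq l *: (val u : I q) by rewrite linearZ.
have vanB i' : kvanish xseq sub_coboundary_fam m i'.+1 k.
  apply: (kvanish_iso (f := val) (PB := @coboundary_fam q) vB vX val_inj) => //.
  - by move=> k' u [ku /coboundary_cocycle cu]; apply: (vsurj k').
  - exact: coboundary_family.
  - exact: coboundary_vanish.
have lif i' : kliftable xseq xseq (quo_pi coboundaries) (@comp_fam (cocycles I q))
    (@comp_fam (local_cohomology I q)) m i' k.
  exact: (kliftable_left E).
case: i => [|i]; last first.
  apply: (kvanish_right E) => //.
  apply: (kvanish_iso (f := val) (PB := @cocycle_fam q) vB vX val_inj) => //.
  - by move=> k' u; split=> [ku|[]//]; split=> //; apply/asboolP/(valP u).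
  - exact: cocycle_family.
  - exact: cocycle_vanish.
move=> c kc dc; have [b [/kmem_bot[v kv ->] db <-]] := lif 0 c kc dc.
rewrite (kmap_bot (ke_gB E)) /= (class_eq0 v).2 ?linear0 //.
have xv : forall i, xvar K n i *: (val v : I q) = 0.
  by apply/xseq_kill => i im; rewrite -vX ((kdiff_bot _ _ v).1 db) // linear0.
by apply: killed_coboundary => //; apply/asboolP/(valP v).
Qed.

End CohomologyKoszul.

(** * Transfer to the rows *)

Section Row.
Variables (K : fieldType) (m n : nat) (N : bigradedModule K m n) (j : int).

Lemma row_vanish i k : kvanish (xseq K m n) (@comp_fam K m n j N) m i k ->
  kvanish (kxseq K m) (fun k (u : row_module N j) => gm_comp k u) m i k.
Proof.
apply: (kvanish_iso (f := val : row_module N j -> N)) => //.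
- by move=> l u; rewrite -xincl_kxseq.
- exact: val_inj.
- move=> k' v kv; have vP : row_pred j v by apply/asboolP/(in_row_comp kv).
  by exists (Sub v vP).
- exact: comp_family.
Qed.

Lemma row_finite_dim k (s : seq N) : (forall u, gm_comp (k, j) u -> kspan s u) ->
  exists s' : seq (row_module N j), forall u, gm_comp k u -> kspan s' u.
Proof.
move=> sP; have pP v : row_pred j (gproj (k, j) v : N).
  by apply/asboolP/(in_row_comp (k := k))/gproj_comp.
pose f v : row_module N j := Sub (gproj (k, j) v) (pP v).
exists (undup [seq f v | v <- s]) => u ku.
have -> : u = f (val u) by apply: val_inj; rewrite /= gproj_id.
apply: kspan_map (sP _ ku) => [v w||a v]; apply: val_inj => /=.
- by rewrite gprojD.
- by rewrite gproj0.
rewrite /xincl comp_mpolyC -[X in gproj X _](add0r (k, j)) (gprojZ (a := 0)) //.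
exact: bihomC.
Qed.

End Row.

(** * Minimal free resolutions over K[x] *)

Section Polynomials.
Variables (K : fieldType) (m : nat).
Local Notation Kx := {mpoly K[m]}.
Local Notation mon := 'X_{1..m}.
Local Notation kx := (kxseq K m).

Lemma xhomD a (p r : Kx) : xhom a p -> xhom a r -> xhom a (p + r).
Proof. by move=> ap ar t /msuppD_le; rewrite mem_cat => /orP[/ap|/ar]. Qed.

(* Membership in the ideal (x_i : i < r). *)
Definition xdivisible r (p : Kx) := forall t, t \in msupp p -> exists2 i : 'I_m, (i < r)%N & (0 < t i)%N.

Lemma xdivisible0 r : xdivisible r 0.
Proof. by move=> t; rewrite msupp0. Qed.

Lemma xdivisibleD r p p' : xdivisible r p -> xdivisible r p' -> xdivisible r (p + p').
Proof. by move=> rp rp' t /msuppD_le; rewrite mem_cat => /orP[/rp|/rp']. Qed.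

Lemma xdivisible_kx r i p : (i < r)%N -> xdivisible r (kx i * p).
Proof.
move=> ir t; rewrite /kxseq; case: insubP => [i' _ iE|_]; last by rewrite mul0r msupp0.
move=> /msuppM_le /allpairsP[[t1 t2] /= []]; rewrite msuppX inE => /eqP -> _ ->.
by exists i'; rewrite ?iE // mnmDE mnm1E eqxx.
Qed.

Lemma xdivisible_sum (J : Type) (s : seq J) (P : pred J) (F : J -> Kx) r :
  (forall j, P j -> xdivisible r (F j)) -> xdivisible r (\sum_(j <- s | P j) F j).
Proof. by move=> rF; elim/big_ind: _ => //; [apply: xdivisible0|apply: xdivisibleD]. Qed.

Lemma xdivisible_ideal p : ideal_gen (fun k : 'I_m => 'X_k : Kx) p <-> xdivisible m p.
Proof.
split=> [[c ->]|].
  by apply: xdivisible_sum => k _; rewrite mulrC -kxseq_ord; apply: xdivisible_kx.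
move=> rp; rewrite [p]mpolyE big_seq; elim/big_ind: _ => [|p1 p2 [c ->] [c' ->]|t /rp[i _ ti]].
- by exists (fun=> 0); rewrite big1 // => k _; rewrite mul0r.
- exists (fun k => c k + c' k); rewrite -big_split; apply: eq_bigr => k _.
  by rewrite mulrDl.
exists (fun k => if k == i then p@_t *: 'X_[t - U_(i)] else 0).
rewrite (bigD1 i) //= eqxx big1 ?addr0 => [|k /negbTE ->]; last by rewrite mul0r.
by rewrite -scalerAl -mpolyXD submK // lep1mP -lt0n.
Qed.

Lemma xdivisible_span r e (p : Kx) : xhom e p -> xdivisible r p ->
  exists w : nat -> Kx, (forall i, xhom (e - 1) (w i)) /\ p = \sum_(i < r) kx i * w i.
Proof.
move=> ep rp; rewrite [p]mpolyE big_seq.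
elim/big_ind: _ => [|p1 p2 [w [wP ->]] [w' [wP' ->]]|t tp].
- exists (fun=> 0); split=> [i t|]; first by rewrite msupp0.
  by rewrite big1 // => i _; rewrite mulr0.
- exists (fun i => w i + w' i); split=> [i|]; first exact: xhomD.
  by rewrite -big_split; apply: eq_bigr => i _; rewrite mulrDr.
have [i ir ti] := rp t tp; have le : (U_(i) <= t)%MM by rewrite lep1mP -lt0n.
exists (fun l => if l == i :> nat then p@_t *: 'X_[t - U_(i)] else 0); split=> [l|].
  case: eqP => _ t'; last by rewrite msupp0.
  move=> /msuppZ_le; rewrite msuppX inE => /eqP ->; rewrite -(ep t tp) -{2}(submK le).
  by rewrite mdegD mdeg1 PoszD addrK.
rewrite (bigD1 (Ordinal ir)) //= eqxx big1 ?addr0 => [|l li]; last first.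
  by rewrite ifN ?mulr0.
by rewrite kxseq_ord -scalerAr -mpolyXD addmC submK.
Qed.

Lemma xdivisible_regular r (i : 'I_m) p : (r <= i)%N -> xdivisible r ('X_i * p) -> xdivisible r p.
Proof.
move=> ri rp t tp.
have [|l lr] := rp (U_(i) + t)%MM.
  by rewrite mcoeff_msupp mulrC mcoeffMX -mcoeff_msupp.
rewrite mnmDE mnm1E; case: eqP => [il|_]; last by exists l.
by move: lr; rewrite -il ltnNge ri.
Qed.

Lemma xdivisible1 : ~ xdivisible m (1 : Kx).
Proof.
by move=> /(_ 0%MM); rewrite msupp1 inE eqxx => /(_ erefl)[i _]; rewrite mnm0E.
Qed.

Lemma xhom_constant e (p : Kx) : xhom e p -> ~ xdivisible m p ->
  e = 0 /\ exists2 c, c != 0 & p = c%:MP.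
Proof.
move=> ep np; have p0 : 0%MM \in msupp p.
  apply: contrapT => n0; apply: np => t tp.
  apply: contrapT => nt; apply: n0; suff <- : t = 0%MM by [].
  apply/mnmP => i; rewrite mnm0E; apply/eqP; rewrite -leqn0 leqNgt; apply/negP => ti.
  by apply: nt; exists i.
have e0 : e = 0 by rewrite -(ep _ p0) mdeg0.
split=> //; exists p@_0; first by rewrite -mcoeff_msupp.
apply/mpolyP => t; rewrite mcoeffC; case: (eqVneq 0%MM t) => [<-|nt]; first by rewrite mulr1.
rewrite mulr0; apply/eqP; rewrite mcoeff_eq0; apply: contra nt => /ep /eqP.
by rewrite e0 eqz_nat mdeg_eq0 eq_sym.
Qed.

End Polynomials.

Section GradedKx.
Variables (K : fieldType) (m : nat).
Local Notation Kx := {mpoly K[m]}.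
Local Notation kx := (kxseq K m).

Lemma kx_family (A : xgradedModule K m) : kfamily kx (@gm_comp _ _ _ A).
Proof.
split=> [k|k u v|k i u ku]; [exact: gm_comp0|exact: gm_compB|].
by rewrite addrC; apply: gm_compZ ku; apply: xhom_kxseq.
Qed.

Definition kx_vanish (A : xgradedModule K m) i k := kvanish kx (@gm_comp _ _ _ A) m i k.

(** By [kbdry_top], vanishing of the top cohomology in degree k - m says that no new generator is
    needed in degree [k]. *)
Lemma top_span (A : xgradedModule K m) k (u : A) : kx_vanish A m (k - m%:Z) ->
  gm_comp k u -> xspan kx (@gm_comp _ _ _ A) m (k - 1) u.
Proof.
move=> van ku; have kE : k - m%:Z + m%:Z = k by rewrite subrK.
have [F0 FB FX] := kx_family A; rewrite -{1}kE; apply/kbdry_top => //.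
by apply: van; [apply/kmem_top => //; exists u; rewrite ?kE|exact: kdiff_top].
Qed.

Section Free.
Variable d : seq int.
Local Notation F := (graded_free K m d).

Lemma free_xspan r k (v : F) : gm_comp k v ->
  xspan kx (@gm_comp _ _ _ F) r (k - 1) v <->
  forall t, xdivisible r ((v : 'rV[Kx]_(size d)) 0 t).
Proof.
move=> kv; split=> [[w _ ->] t|rv].
  rewrite summxE; apply: xdivisible_sum => i _; rewrite mxE.
  exact: xdivisible_kx.
have /choice[w wP] := fun t => xdivisible_span (kv t) (rv t).
exists (fun i => \row_t w t i) => [i _ t|].
  by rewrite mxE addrAC; case: (wP t).
apply/rowP => t; rewrite summxE; have [_ ->] := wP t.
by apply: eq_bigr => i _; rewrite !mxE.
Qed.

Lemma free_below k (v : F) : (forall t, t \in d -> k < t) -> gm_comp k v -> v = 0.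
Proof.
move=> kd kv; apply/rowP => t; rewrite mxE; apply/mpolyP => w; rewrite mcoeff0.
apply/eqP; rewrite mcoeff_eq0; apply/negP => /kv wE.
have : (0 : int) <= k - d`_t by rewrite -wE.
by rewrite subr_ge0 leNgt kd // mem_nth.
Qed.

(** The x_i are regular on a free module, so only H^m remains; it is F / (x) F shifted by [m] and
    sits in the degrees of the generators minus [m]. *)
Lemma free_vanish k i : (forall t, t \in d -> t < k + m%:Z) -> kx_vanish F i k.
Proof.
move=> dk; have [F0 FB FX] := kx_family F.
have [im|mi|->] := ltngtP i m.
- apply: kvanish_regular im => // s k' v sm kv.
  move=> sp; apply/free_xspan => // t.
  apply: (@xdivisible_regular _ _ _ (Ordinal sm)) => //.
  have /free_xspan/(_ t) : xspan kx (@gm_comp _ _ _ F) s (k' + 1 - 1) (kx s *: v) by rewrite addrK.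
  by rewrite mxE -kxseq_ord; apply; apply: FX.
- by move=> u ku _; rewrite (kmem_large mi ku); case: (i) mi => // i' _; exists 0;
    [apply: kmem0|rewrite linear0].
move=> u /(kmem_top F0)[v kv ->] _; apply/kbdry_top => //; apply/free_xspan => // t w wt.
have wE := kv t w wt; have w0 : (0 < mdeg w)%N.
  by rewrite -ltz_nat wE subr_gt0; apply/dk/mem_nth.
have [/existsP[l wl]|/existsPn nw] := boolP [exists l, (0 < w l)%N]; first by exists l.
by move: w0; rewrite mdegE big1 // => l _; apply/eqP; rewrite -leqn0 leqNgt nw.
Qed.

End Free.

Definition kernel_mem (A B : xgradedModule K m) (f : gradedHom A B) (u : A) := f u = 0.

Lemma kernel_mem0 A B (f : gradedHom A B) : kernel_mem f 0.
Proof. exact: linear0. Qed.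

Lemma kernel_memP A B (f : gradedHom A B) p u v :
  kernel_mem f u -> kernel_mem f v -> kernel_mem f (p *: u + v).
Proof. by move=> fu fv; rewrite /kernel_mem linearP fu fv scaler0 addr0. Qed.

Lemma kernel_homog A B (f : gradedHom A B) (s : seq int) (g : int -> A) :
  uniq s -> (forall k, gm_comp k (g k)) -> kernel_mem f (\sum_(k <- s) g k) ->
  forall k, k \in s -> kernel_mem f (g k).
Proof.
move=> us gc fg k ks; apply: (@gm_dec_uniq _ _ _ B s (fun k => f (g k))) => //.
  by move=> l; apply: gh_comp.
by rewrite -linear_sum.
Qed.

Definition kernel A B (f : gradedHom A B) : xgradedModule K m :=
  graded_sub (GradedSubmodule (kernel_mem0 f) (@kernel_memP _ _ f) (@kernel_homog _ _ f)).

Lemma kernelE A B (f : gradedHom A B) (u : kernel f) : f (val u) = 0.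
Proof. exact/asboolP/(valP u). Qed.

Lemma kernel_lift A B (f : gradedHom A B) (u : A) : f u = 0 -> exists v : kernel f, val v = u.
Proof.
move=> fu; have uP : gs_pred (GradedSubmodule (kernel_mem0 f) (@kernel_memP _ _ f)
  (@kernel_homog _ _ f)) u by apply/asboolP.
by exists (Sub u uP).
Qed.

Lemma kexact_kernel A B (f : gradedHom A B) : (forall b, exists a, b = f a) ->
  kexact kx kx kx (val : kernel f -> A) f (@gm_comp _ _ _ (kernel f)) (@gm_comp _ _ _ A)
    (@gm_comp _ _ _ B).
Proof.
move=> fsurj; split=> //; try exact: kx_family.
- by move=> u v; rewrite linearB.
- by move=> i u; rewrite linearZ.
- exact: gh_comp.
- by move=> k a _ a0; apply: val_inj; rewrite a0.
- by move=> k a _; apply: kernelE.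
- by move=> k b kb /kernel_lift[v vE]; exists v; rewrite // /gm_comp /= /sub_comp vE.
move=> k c kc; have [a aE] := fsurj c; exists (gproj k a); first exact: gproj_comp.
by rewrite -gproj_hom -aE gproj_id.
Qed.

Definition minimal_cover d (A : xgradedModule K m) (f : gradedHom (graded_free K m d) A) :=
  (forall a, exists v, a = f v) /\
  forall v, f v = 0 -> forall t, xdivisible m ((v : 'rV[Kx]_(size d)) 0 t).

(** The invariant carried along a minimal resolution: by [kernel_bounded] it passes to syzygies with
    the same constants. Owing to the shift by [m] in [bd_vanish], [b] bounds the degrees of the
    generators. *)
Record bounded (a0 b : int) (A : xgradedModule K m) := Bounded {
  bd_below : forall k (u : A), k < a0 -> gm_comp k u -> u = 0;
  bd_fg : finitely_generated A;
  bd_vanish : forall i k, b < k + m%:Z -> kx_vanish A i k }.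

Section Cover.
Variables (a0 b : int) (d : seq int) (A : xgradedModule K m).
Variable f : gradedHom (graded_free K m d) A.
Hypothesis bA : bounded a0 b A.
Hypothesis minf : minimal_cover f.
Local Notation F := (graded_free K m d).

Definition gen (t : 'I_(size d)) : F := delta_mx 0 t.

Lemma gen_comp (t : 'I_(size d)) : gm_comp d`_t (gen t).
Proof.
move=> t'; rewrite mxE eqxx /=; case: eqP => [->|_] w; last by rewrite msupp0.
by rewrite msupp1 inE => /eqP ->; rewrite mdeg0 subrr.
Qed.

Lemma gen_nonzero t : ~ xdivisible m ((gen t : 'rV[Kx]_(size d)) 0 t).
Proof. by rewrite mxE !eqxx; apply: xdivisible1. Qed.

(** Nakayama's argument: a generator of degree above [b] has its image in (x) A. Lifting that
    expression to F gives a relation whose entry at [t'] has constant term 1, against minimality. *)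
Lemma cover_degree_le t : t \in d -> t <= b.
Proof.
move=> /(nthP 0)[i id <-]; pose t' := Ordinal id; rewrite leNgt; apply/negP => bt.
have van : kx_vanish A m (d`_t' - m%:Z) by apply: (bd_vanish bA); rewrite subrK.
have [w _ wE] := top_span van (gh_comp f (@gen_comp t')).
have /choice[v vP] := fun i => (minf.1 (w i)).
apply: (@gen_nonzero t'); have /minf.2/(_ t') : f (gen t' - \sum_(i < m) kx i *: v i) = 0.
  rewrite linearB linear_sum wE; apply/eqP; rewrite subr_eq0; apply/eqP/eq_bigr => l _.
  by rewrite linearZ vP.
rewrite !mxE summxE => dv.
rewrite -[X in xdivisible _ X](subrK (\sum_(i < m) (kx i *: v i : 'rV_(size d)) 0 t')).
apply: xdivisibleD dv _; apply: xdivisible_sum => l _; rewrite mxE.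
exact: xdivisible_kx.
Qed.

Lemma cover_degree_ge t : t \in d -> a0 <= t.
Proof.
move=> /(nthP 0)[i id <-]; pose t' := Ordinal id; rewrite leNgt; apply/negP => bt.
apply: (@gen_nonzero t'); apply: minf.2.
exact: (bd_below bA bt (gh_comp f (@gen_comp t'))).
Qed.

(** The generators of [F] lie between [a0] and [b], so [F] obeys the same bounds, and the long exact
    sequence hands the vanishing on to the kernel. *)
Lemma kernel_bounded : bounded a0 b (kernel f).
Proof.
have E := kexact_kernel minf.1.
split=> [k u ka ku||i k bk].
- apply: val_inj; apply: (@free_below d k) => // t /cover_degree_ge.
  exact: lt_le_trans.
- have nF := @noetherian_fg K m F (size d) gen.
  have [||k [e [eK egen]]] := nF (kernel_mem f).
  + split; [exact: kernel_mem0|exact: kernel_memP].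
  + move=> u _; exists (fun t => (u : 'rV[Kx]_(size d)) 0 t).
    exact: (row_sum_delta (u : 'rV[Kx]_(size d))).
  have /choice[e' e'P] := fun i => kernel_lift (eK i).
  exists k, e' => u; have [c /eqP cE] := egen (val u) (kernelE u).
  exists c; apply: val_inj; rewrite raddf_sum; move: cE; rewrite subr_eq0 => /eqP ->.
  by apply: eq_bigr => i _; rewrite -(e'P i).
have vF i' : kx_vanish F i' k.
  by apply: free_vanish => t /cover_degree_le; move=> tb; apply: le_lt_trans bk.
case: i => [|i]; first exact: (kvanish_left0 E (vF 0)).
apply: (kvanish_left E _ (vF i.+1)); apply: (kliftable_right E).
exact: (bd_vanish bA).
Qed.

End Cover.

End GradedKx.

Section MinimalCover.
Variables (K : fieldType) (m : nat).
Local Notation Kx := {mpoly K[m]}.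
Local Notation kx := (kxseq K m).

Section Generators.
Variable A : xgradedModule K m.
Implicit Types (e : nat -> A) (u : A).

Definition genspan (s : nat) e u := exists c : nat -> Kx, u = \sum_(i < s) c i *: e i.

Lemma genspan0 s e : genspan s e 0.
Proof. by exists (fun=> 0); rewrite big1 // => i _; rewrite scale0r. Qed.

Lemma genspanD s e u v : genspan s e u -> genspan s e v -> genspan s e (u + v).
Proof.
move=> [c ->] [c' ->]; exists (fun i => c i + c' i); rewrite -big_split.
by apply: eq_bigr => i _; rewrite scalerDl.
Qed.

Lemma genspanZ s e a u : genspan s e u -> genspan s e (a *: u).
Proof.
move=> [c ->]; exists (fun i => a * c i); rewrite scaler_sumr.
by apply: eq_bigr => i _; rewrite scalerA.
Qed.

Lemma genspan_sum s e (J : Type) (r : seq J) (P : pred J) (F : J -> A) :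
  (forall j, P j -> genspan s e (F j)) -> genspan s e (\sum_(j <- r | P j) F j).
Proof. by move=> FP; elim/big_ind: _ => //; [apply: genspan0|apply: genspanD]. Qed.

Lemma genspan_mem s e i : (i < s)%N -> genspan s e (e i).
Proof.
move=> si; exists (fun j => (j == i)%:R); rewrite (bigD1 (Ordinal si)) //= eqxx scale1r.
rewrite big1 ?addr0 // => j ji; rewrite (_ : (j == i :> nat) = false) ?scale0r //.
exact/negbTE.
Qed.

Lemma genspan_nth (s : seq A) u : u \in s -> genspan (size s) (nth 0 s) u.
Proof. by move=> us; rewrite -[u](nth_index 0 us); apply: genspan_mem; rewrite index_mem. Qed.

Definition hgens (d : seq int) e :=
  (forall i, (i < size d)%N -> gm_comp d`_i (e i)) /\ forall u, genspan (size d) e u.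

Lemma hgens_exist : finitely_generated A -> exists d e, hgens d e.
Proof.
move=> [k [a aP]].
have /choice[s sP] : forall i, exists s : seq int, a i = \sum_(h <- s) gproj h (a i).
  by move=> i; have [s [_ _ sE]] := gproj_sum (a i); exists s.
pose l := [seq (h, gproj h (a i)) | i <- enum 'I_k, h <- s i].
exists [seq x.1 | x <- l], (fun i => (nth (0, 0) l i).2); split=> [i|u].
  rewrite size_map => il; rewrite (nth_map (0, 0)) //.
  by have /allpairsPdep[i' [h [_ _ ->]]] := mem_nth (0, 0) il; apply: gproj_comp.
have [c ->] := aP u; apply: genspan_sum => i _; apply: genspanZ; rewrite (sP i) big_seq.
apply: genspan_sum => h hs; rewrite size_map.
have xl : (h, gproj h (a i)) \in l by apply/allpairsPdep; exists i, h; rewrite mem_enum.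
have := @genspan_mem (size l) (fun i => (nth (0, 0) l i).2) (index (h, gproj h (a i)) l).
by rewrite index_mem nth_index //; apply.
Qed.

(** Degrees above [b] are generated from one degree below and those under [a0] are zero, so spanning
    sets of the finitely many degrees in between generate. *)
Lemma fg_of_finite_dim (a0 b : int) :
  (forall k u, k < a0 -> gm_comp k u -> u = 0) ->
  (forall k, exists s : seq A, forall u, gm_comp k u -> kspan s u) ->
  (forall k u, b < k -> gm_comp k u -> xspan kx (@gm_comp _ _ _ A) m (k - 1) u) ->
  finitely_generated A.
Proof.
move=> below /choice[s sP] top.
pose l := flatten [seq s (a0 + i%:Z) | i <- iota 0 (`|b - a0|).+1].
suff H N k u : k - a0 < N%:Z -> gm_comp k u -> genspan (size l) (nth 0 l) u.
  exists (size l), (fun i => l`_i) => u.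
  have [t [_ _ ->]] := gproj_sum u.
  suff [c ->] : genspan (size l) (nth 0 l) (\sum_(g <- t) gproj g u) by exists (fun i => c i).
  apply: genspan_sum => k _; apply: (H (`|k - a0|).+1 k) => //; last exact: gproj_comp.
  by lia.
elim: N k u => [|N IH] k u kN ku.
  by rewrite (below k u) //; [apply: genspan0|lia].
have [ka|ak] := ltP k a0; first by rewrite (below k u) //; apply: genspan0.
have [kb|bk] := leP k b; last first.
  have [w wP ->] := top k u bk ku; apply: genspan_sum => i _; apply: genspanZ.
  by apply: (IH (k - 1)); [lia|apply: wP].
have [c ->] := sP k u ku; rewrite big_seq; apply: genspan_sum => v vs; apply: genspanZ.
apply: genspan_nth; apply/flatten_mapP; exists `|k - a0|%N.
  by rewrite mem_iota; lia.
by rewrite (_ : a0 + _ = k) //; lia.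
Qed.

Section CoverMap.
Variables (d : seq int) (e : nat -> A).
Hypothesis de : forall i, (i < size d)%N -> gm_comp d`_i (e i).
Local Notation F := (graded_free K m d).

Definition cover_fun (v : F) : A := \sum_(t < size d) (v : 'rV[Kx]_(size d)) 0 t *: e t.

Lemma cover_linear : linear cover_fun.
Proof.
move=> a u v; rewrite /cover_fun scaler_sumr -big_split; apply: eq_bigr => t _.
by rewrite !mxE scalerDl scalerA.
Qed.
HB.instance Definition _ := GRing.isLinear.Build Kx F A _ cover_fun cover_linear.

Lemma cover_comp k (v : F) : gm_comp k v -> gm_comp k (cover_fun v).
Proof.
move=> kv; rewrite /cover_fun; elim/big_ind: _ => [||t _]; [exact: gm_comp0|exact: gm_compD|].
rewrite -[k](subrK d`_t); apply: gm_compZ; first exact: kv.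
exact: de.
Qed.

Definition cover : gradedHom F A := GradedHom cover_comp.

End CoverMap.

(** Take homogeneous generators in the least possible number. A relation with an entry outside (x)
    has a homogeneous component where this entry is a nonzero constant, and then the generator at
    [t] could be dropped. *)
Lemma minimal_cover_exists : finitely_generated A ->
  exists (d : seq int) (f : gradedHom (graded_free K m d) A), minimal_cover f.
Proof.
move=> /hgens_exist[d0 [e0 g0]].
have ex : exists l, `[< exists d e, size d = l /\ hgens d e >].
  by exists (size d0); apply/asboolP; exists d0, e0.
case: (ex_minnP ex) => l /asboolP[d [e [dl [de gen]]]] lmin.
exists d, (cover de); split=> [u|v fv t].
  have [c ->] := gen u; exists (\row_t c t); apply: eq_bigr => t _.
  by rewrite mxE.
apply: contrapT => nv.
have [k nk] : exists k, ~ xdivisible m ((gproj k v : 'rV[Kx]_(size d)) 0 t).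
  apply: contrapT => /forallNP H; apply: nv; have [s [_ _ ->]] := gproj_sum v.
  by rewrite summxE; apply: xdivisible_sum => k _; apply: contrapT; apply: H.
have kw := gproj_comp k v; set w := gproj k v in nk kw.
have fw : cover de w = 0 by rewrite -gproj_hom fv gproj0.
have [_ [c c0 wt]] := xhom_constant (kw t) nk.
have dpos : (0 < size d)%N by apply: leq_ltn_trans (ltn_ord t).
have := lmin (size d).-1; rewrite -dl leqNgt prednK // leqnn => /(_ _)/negP; apply=> //.
apply/asboolP; exists (mkseq (fun i => d`_(bump t i)) (size d).-1), (fun i => e (bump t i)).
rewrite /hgens size_mkseq; split=> //; split=> [i il|u].
  by rewrite nth_mkseq //; apply: (de _ (ltn_ord (lift t (Ordinal il)))).
have gl (i : 'I_(size d).-1) : genspan (size d).-1 (fun i => e (bump t i)) (e (lift t i)).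
  exact: (@genspan_mem _ (fun i => e (bump t i))).
have gt : genspan (size d).-1 (fun i => e (bump t i)) (e t).
  have : c%:MP *: e t = - \sum_(i < (size d).-1) (w : 'rV[Kx]_(size d)) 0 (lift t i) *: e (lift t i).
    apply/eqP; rewrite -addr_eq0 -wt; apply/eqP.
    by have := fw; rewrite /= /cover_fun (bigD1_ord t).
  move=> /(congr1 (fun u => (c^-1)%:MP *: u)); rewrite scalerA -mpolyCM mulVf // mpolyC1 scale1r => ->.
  by apply: genspanZ; rewrite -scaleN1r; apply: genspanZ; apply: genspan_sum => i _; apply: genspanZ.
have [c' ->] := gen u; rewrite (bigD1_ord t) //=; apply: genspanD; first exact: genspanZ.
by apply: genspan_sum => i _; apply: genspanZ; apply: gl.
Qed.

End Generators.
End MinimalCover.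

Section Resolutions.
Variables (K : fieldType) (m : nat).
Local Notation Kx := {mpoly K[m]}.
Local Notation kx := (kxseq K m).

Section Comp.
Variables (A B C : xgradedModule K m) (f : gradedHom A B) (g : gradedHom B C).

Lemma comp_comp k u : gm_comp k u -> gm_comp k ((g \o f) u).
Proof. by move=> ku; apply/gh_comp/gh_comp. Qed.

Definition graded_comp : gradedHom A C := GradedHom comp_comp.

Definition kernel_incl (u : kernel g) : B := val u.

Lemma kernel_incl_linear : linear kernel_incl.
Proof. by move=> a u w; rewrite /kernel_incl linearP. Qed.
HB.instance Definition _ := GRing.isLinear.Build Kx (kernel g) B _ kernel_incl kernel_incl_linear.

Definition kernel_val : gradedHom (kernel g) B :=
  @GradedHom _ _ _ (kernel g) B kernel_incl (fun k u ku => ku).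

Hypothesis gf : forall u, g (f u) = 0.

Definition corestrict (u : A) : kernel g := projT1 (cid (kernel_lift (gf u))).

Lemma corestrictE u : val (corestrict u) = f u.
Proof. exact: projT2 (cid (kernel_lift (gf u))). Qed.

Lemma corestrict_linear : linear corestrict.
Proof. by move=> a u w; apply: val_inj; rewrite linearP /= !corestrictE linearP. Qed.
HB.instance Definition _ := GRing.isLinear.Build Kx A (kernel g) _ corestrict corestrict_linear.

Lemma corestrict_comp k u : gm_comp k u -> gm_comp k (corestrict u).
Proof. by move=> ku; rewrite /gm_comp /= /sub_comp corestrictE; apply: gh_comp. Qed.

Definition corestriction : gradedHom A (kernel g) := GradedHom corestrict_comp.

Lemma corestrictionE u : val (corestriction u) = f u.
Proof. exact: corestrictE. Qed.

End Comp.

Section Existence.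
Variables (a0 b : int).

(** Bundled with its bounds, a module can be replaced repeatedly by its syzygy with [iter]. *)
Definition bounded_module := {A : xgradedModule K m | bounded a0 b A}.

Lemma bounded_cover (A : bounded_module) :
  exists c : {d : seq int & gradedHom (graded_free K m d) (sval A)}, minimal_cover (projT2 c).
Proof.
by have [d [f fP]] := minimal_cover_exists (bd_fg (svalP A)); exists (existT _ d f).
Qed.

Definition the_cover A := projT1 (cid (bounded_cover A)).

Lemma the_coverP A : minimal_cover (projT2 (the_cover A)).
Proof. exact: projT2 (cid (bounded_cover A)). Qed.

Definition next_syzygy (A : bounded_module) : bounded_module :=
  exist _ (kernel (projT2 (the_cover A))) (kernel_bounded (svalP A) (the_coverP A)).

Lemma resolution_exists (A : xgradedModule K m) : bounded a0 b A ->
  exists F : minimal_free_resolution A, True.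
Proof.
move=> bA; pose Z i := iter i next_syzygy (exist _ A bA).
pose d i := projT1 (the_cover (Z i)); pose f i := projT2 (the_cover (Z i)).
pose diff i : gradedHom (graded_free K m (d i.+1)) (graded_free K m (d i)) :=
  graded_comp (f i.+1) (kernel_val (f i)).
have diffE i v : diff i v = val (f i.+1 v) by [].
have fP i : minimal_cover (f i) := the_coverP (Z i).
have exact i u : f i u = 0 <-> exists v, u = diff i v.
  split=> [/kernel_lift[w <-]|[v ->]]; last by rewrite diffE kernelE.
  by have [v ->] := (fP i.+1).1 w; exists v.
unshelve eexists (@MinimalFreeResolution K m A d diff (f 0) _ _ _ _) => //.
- exact: (fP 0).1.
- exact: exact.
- move=> i u; rewrite -exact diffE; split=> [e|->]; last by rewrite raddf0.
  exact: val_inj.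
- move=> i v t; apply/xdivisible_ideal; apply: (fP i).2; apply/exact.
  by exists v.
Qed.

End Existence.

Lemma resolution_cover (A : xgradedModule K m) (F : minimal_free_resolution A) :
  minimal_cover (mr_aug F).
Proof.
split; first exact: mr_surj.
by move=> v /mr_exact0[w ->] t; apply/xdivisible_ideal/mr_minimal.
Qed.

(** Dropping F_0 leaves a minimal resolution of the first syzygy, which reduces degree bounds for
    F_i to the case i = 0. *)
Lemma resolution_shift (A : xgradedModule K m) (F : minimal_free_resolution A) :
  exists F' : minimal_free_resolution (kernel (mr_aug F)), forall i, mr_gens F' i = mr_gens F i.+1.
Proof.
have aug0 u : mr_aug F (mr_diff F 0 u) = 0 by apply/mr_exact0; exists u.
unshelve eexists (@MinimalFreeResolution K m _ (fun i => mr_gens F i.+1)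
  (fun i => mr_diff F i.+1) (corestriction aug0) _ _ _ _) => //.
- move=> u; have /mr_exact0[v vE] := kernelE u.
  by exists v; apply: val_inj; rewrite corestrictionE vE.
- move=> u; rewrite -mr_exact -(corestrictionE aug0).
  by split=> [->|e]; [rewrite raddf0|apply: val_inj; rewrite e].
- by move=> i u; apply: mr_exact.
- by move=> i v t; apply: mr_minimal.
Qed.

Lemma resolution_degree_le a0 b i (A : xgradedModule K m) (F : minimal_free_resolution A) t :
  bounded a0 b A -> t \in mr_gens F i -> t <= b.
Proof.
elim: i A F => [|i IH] A F bA ti; first exact: (cover_degree_le bA (resolution_cover F) ti).
have [F' F'E] := resolution_shift F; apply: (IH _ F').
  exact: kernel_bounded bA (resolution_cover F).
by rewrite F'E.
Qed.

Lemma max_of_bounded (P : int -> Prop) (b : int) :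
  (exists a, P a) -> (forall a, P a -> a <= b) -> exists r, is_max P r.
Proof.
move=> [a Pa] Pb.
have ex : exists l, `[< P (b - l%:Z) >].
  by exists `|b - a|%N; apply/asboolP; have := Pb a Pa => ab; rewrite (_ : _ - _ = a) //; lia.
case: (ex_minnP ex) => l /asboolP Pl lmin; exists (b - l%:Z); split=> // a' Pa'.
have ab' := Pb a' Pa'; have := lmin `|b - a'|%N.
have -> : b - `|b - a'|%N%:Z = a' by lia.
by move=> /(_ (introT (asboolP _) Pa')); lia.
Qed.

Lemma is_b_exists (A : xgradedModule K m) (F : minimal_free_resolution A) i :
  mr_gens F i <> [::] -> exists b, is_b F i b.
Proof.
move=> ne; have [c cP] := int_upper_bound (mr_gens F i) id.
apply: (@max_of_bounded _ c) => //; case: (mr_gens F i) ne => // t s _.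
by exists t; rewrite mem_head.
Qed.

Lemma resolution_nonzero (A : xgradedModule K m) (F : minimal_free_resolution A) :
  ~ is_zero A -> mr_gens F 0 <> [::].
Proof.
move=> nz e; apply: nz => u; have [v ->] := mr_surj F u.
suff -> : v = 0 by rewrite linear0.
by apply/rowP => t; have := ltn_ord t; rewrite [in X in (_ < X)%N]e.
Qed.

(** Generators of each F_i have degree at most [b], and subtracting i only lowers this. For the
    lower bound F_0, nonzero here, already contributes a value of at least [a0]. *)
Lemma bounded_reg a0 b (A : xgradedModule K m) : bounded a0 b A -> ~ is_zero A ->
  (exists r, is_reg A r) /\ forall r, is_reg A r -> a0 <= r <= b.
Proof.
move=> bA nz.
have le_b (F : minimal_free_resolution A) a :
    (exists i b', is_b F i b' /\ a = b' - i%:Z) -> a <= b.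
  by move=> [i [b' [[b'F _] ->]]]; have := resolution_degree_le bA b'F; lia.
split.
  have [F _] := resolution_exists bA.
  have [r rP] : exists r, is_max (fun a => exists i b', is_b F i b' /\ a = b' - i%:Z) r.
    apply: (@max_of_bounded _ b) (le_b F).
    have [b' b'P] := is_b_exists (@resolution_nonzero _ F nz).
    by exists (b' - 0%:Z), 0, b'.
  by exists r, F.
move=> r [F [rF rmax]]; rewrite (le_b F) // andbT.
have [b' b'P] := is_b_exists (@resolution_nonzero _ F nz).
apply: (@le_trans _ _ b').
  exact: (cover_degree_ge bA (resolution_cover F) b'P.1).
by have := rmax (b' - 0%:Z); rewrite subr0; apply; exists 0, b'; rewrite subr0.
Qed.

End Resolutions.

Theorem proposition2p4 (K : fieldType) (m n : nat) (M : bigradedModule K m n)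
    (I : injective_resolution M) (q : nat) (hM : relative_CM I q) :
  exists c : int, forall j : int,
    ~ is_zero (row_module (local_cohomology I q) j) ->
    (exists r : int, is_reg (row_module (local_cohomology I q) j) r) /\
    (forall r : int, is_reg (row_module (local_cohomology I q) j) r -> - c <= r <= c).
Proof.
have [_ fgM zero] := hM.
have [a0 a0P] := cohomology_below I fgM.
have [b bP] := xkilled_exact I fgM.
(* The regularity of every nonzero row will lie between [a0] and b + m, neither of which depends on
   [j]. *)
exists (`|a0| + `|b + m%:Z|) => j nz.
have van i k : b < k -> kx_vanish (row_module (local_cohomology I q) j) i k.
  move=> bk; have [ex0 exS] := bP (k, j) bk.
  exact/row_vanish/cohomology_vanish.
have below k (u : row_module (local_cohomology I q) j) : k < a0 -> gm_comp k u -> u = 0.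
  by move=> ka ku; apply: val_inj; apply: (a0P q (k, j)).
(* Added to [b], the [m] cancels the one in [bd_vanish]: its condition becomes b < k. *)
have bd : bounded a0 (b + m%:Z) (row_module (local_cohomology I q) j).
  split=> // [|i k bk]; last by apply: van; lia.
  apply: (@fg_of_finite_dim _ _ _ a0 (b + m%:Z)) => // k.
    have [s sP] := cohomology_finite_dim I fgM q (k, j).
    exact: row_finite_dim sP.
  by move=> u bk ku; apply: top_span => //; apply: van; lia.
have [regE regB] := bounded_reg bd nz.
by split=> // r /regB; lia.
Qed.
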